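(* The 3D steady Stokes operator $\mathfrak L_0:(u,p)\mapsto(\Delta u-\nabla p,\ \operatorname{div}u)$, acting on functions $(u,p)$ on $\mathbb R^3$ with values in $\mathbb R^3\times\mathbb R$, satisfies the Runge property with point controls on $\mathbb R^3$.
   Context: A linear differential operator $A$ with $C^\infty$ matrix-valued coefficients on $\mathbb R^d$ satisfies the Runge property with point controls on $\mathbb R^d$ if: for any compact $K\subset\mathbb R^d$, any $f$ in the image of $C^\infty(\mathbb R^d)$ (vector-valued) by $A$, any integer $k\ge0$, any $\varepsilon>0$, any set $E$ with exactly one point in each bounded connected component of $\mathbb R^d\setminus K$ (and no other point), and any smooth function $U$ defined on an open neighbourhood $\Omega$ of $K$ and satisfying $AU=f$ in $\Omega$, there exists $\overline U$ defined on the whole space $\mathbb R^d$ (a distribution on $\mathbb R^d$ which is a smooth function in a neighbourhood of $K$) such that $A\overline U=f+g$ on $\mathbb R^d$, where $g$ is a finite linear combination (with vector coefficients) of derivatives of Dirac masses located at points of $E$, and $\|\overline U-U\|_{C^k(K)}\le\varepsilon$. Here $\|w\|_{C^k(K)}$ is the maximum over $|\alpha|\le k$ of $\sup_K|\partial^\alpha w|$. In the claim, $d=3$, $A=\mathfrak L_0$ and $U=(u,p)$. *)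

(* Defs.v *)
From HB Require Import structures.
From mathcomp Require Import all_boot all_order all_algebra.
From mathcomp Require Import all_classical all_reals all_analysis.
Import Order.TTheory GRing.Theory Num.Theory.
Import numFieldNormedType.Exports.

Set Implicit Arguments.
Unset Strict Implicit.
Unset Printing Implicit Defensive.

Local Open Scope classical_set_scope.
Local Open Scope ring_scope.

(* Points of R^d are row vectors 'rV[R]_d; values of vector-valued functions
   are column vectors 'cV[R]_n, so that matrix coefficients act by A *m U x.
   A function defined on an open set Omega is represented by a total function
   whose values outside Omega are irrelevant. *)

Section Calculus.
Context {R : realType} {d : nat}.
Implicit Types (f phi : 'rV[R]_d -> R) (Omega : set 'rV[R]_d).

Definition pder (i : 'I_d) f : 'rV[R]_d -> R :=
  fun x => 'D_(delta_mx 0 i) f x.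

Definition mder (a : 'I_d -> nat) f : 'rV[R]_d -> R :=
  foldr (fun i g => iter (a i) (pder i) g) f (enum 'I_d).

(* C^oo on the open set Omega: all iterated partial derivatives, in any order,
   exist and are continuous at every point of Omega. *)
Definition smooth_on Omega f : Prop :=
  forall (s : seq 'I_d) (x : 'rV[R]_d), Omega x ->
    {for x, continuous (foldr pder f s)} /\
    (forall i : 'I_d, derivable (foldr pder f s) x (delta_mx 0 i)).

Definition vcoord n (U : 'rV[R]_d -> 'cV[R]_n) (j : 'I_n) : 'rV[R]_d -> R :=
  fun x => U x j 0.

Definition vsmooth_on n Omega (U : 'rV[R]_d -> 'cV[R]_n) : Prop :=
  forall j, smooth_on Omega (vcoord U j).

Definition vmder n (a : 'I_d -> nat) (U : 'rV[R]_d -> 'cV[R]_n) :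
    'rV[R]_d -> 'cV[R]_n :=
  fun x => \col_j mder a (vcoord U j) x.

Definition enorm n (v : 'cV[R]_n) : R := Num.sqrt (\sum_j v j 0 ^+ 2).

(* The indices a range over the multi-indices of length at most k.  The
   default value 0 matters only when K is empty. *)
Definition Ck_norm n (k : nat) (K : set 'rV[R]_d)
    (U : 'rV[R]_d -> 'cV[R]_n) : \bar R :=
  \big[maxe/0%E]_(a : {ffun 'I_d -> 'I_k.+1} | (\sum_i a i <= k)%N)
    ereal_sup [set (enorm (vmder (fun i => a i : nat) U x))%:E | x in K].

End Calculus.

(* Integral over R^d as an iterated Lebesgue integral; it is only applied to
   continuous compactly supported functions. *)
Fixpoint integralRd {R : realType} (d : nat) : ('rV[R]_d -> R) -> R :=
  match d with
  | 0 => fun f => f 0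
  | d'.+1 => fun f =>
      (\int[@lebesgue_measure R]_(t in [set: R])
         integralRd (fun y : 'rV[R]_d' => f (row_mx (t%:M : 'rV[R]_1) y)))%R
  end.

Section Distributions.
Context {R : realType} {d : nat}.
Implicit Types (f phi psi : 'rV[R]_d -> R).

Definition tsupp f : set 'rV[R]_d := closure [set x | f x != 0].

Definition test_fun phi : Prop := smooth_on setT phi /\ compact (tsupp phi).

(* Only the values on test functions are meaningful. *)
Definition functional := ('rV[R]_d -> R) -> R.

Definition is_distribution (T : functional) : Prop :=
  (forall (c : R) phi psi, test_fun phi -> test_fun psi ->
     T (fun x => c * phi x + psi x) = c * T phi + T psi) /\
  (forall L : set 'rV[R]_d, compact L ->
     exists (C : R) (N : nat), forall phi (M : R),
       test_fun phi -> tsupp phi `<=` L -> 0 <= M ->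
       (forall (a : 'I_d -> nat) x, (\sum_i a i <= N)%N ->
          `|mder a phi x| <= M) ->
       `|T phi| <= C * M).

Definition fun_dist f : functional := fun phi => integralRd (fun x => f x * phi x).

Definition dirac_dist (x : 'rV[R]_d) : functional := fun phi => phi x.

Definition mder_dist (a : 'I_d -> nat) (T : functional) : functional :=
  fun phi => (-1) ^+ (\sum_i a i) * T (mder a phi).

Definition mul_dist f (T : functional) : functional :=
  fun phi => T (fun x => f x * phi x).

End Distributions.
Arguments functional : clear implicits.

(* The operator U |-> \sum_t coef_t * D^(mi_t) U, from functions with values in
   R^n to functions with values in R^m. *)
Record diffop (R : realType) (d m n : nat) := DiffOp {
  op_terms : finType;
  op_mi : op_terms -> 'I_d -> nat;
  op_coef : op_terms -> 'rV[R]_d -> 'M[R]_(m, n);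
  op_coef_smooth : forall t i j, smooth_on setT (fun x => op_coef t x i j)
}.

Section Runge.
Context {R : realType} {d m n : nat}.
Implicit Types (A : diffop R d m n) (K E : set 'rV[R]_d).

Definition op_fun A (U : 'rV[R]_d -> 'cV[R]_n) : 'rV[R]_d -> 'cV[R]_m :=
  fun x => \sum_(t : op_terms A) op_coef t x *m vmder (op_mi t) U x.

Definition op_dist A (T : 'I_n -> functional R d) : 'I_m -> functional R d :=
  fun i phi => \sum_(t : op_terms A) \sum_(j < n)
    mul_dist (fun x => op_coef t x i j) (mder_dist (op_mi t) (T j)) phi.

Definition bounded_component K (C : set 'rV[R]_d) : Prop :=
  (exists2 x, (~` K) x & C = connected_component (~` K) x) /\ bounded_set C.

Definition control_set K E : Prop :=
  (forall C, bounded_component K C -> exists! x, E x /\ C x) /\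
  (forall x, E x -> exists2 C, bounded_component K C & C x).

Definition point_control E (g : 'I_m -> functional R d) : Prop :=
  exists (N : nat) (c : 'I_N -> 'cV[R]_m) (a : 'I_N -> 'I_d -> nat)
         (x : 'I_N -> 'rV[R]_d),
    (forall l, E (x l)) /\
    (forall i phi,
       g i phi = \sum_(l < N) c l i 0 * mder_dist (a l) (dirac_dist (x l)) phi).

Definition runge_point_controls A : Prop :=
  forall (K : set 'rV[R]_d) (f : 'rV[R]_d -> 'cV[R]_m) (k : nat) (eps : R)
         (E Omega : set 'rV[R]_d) (U : 'rV[R]_d -> 'cV[R]_n),
    compact K ->
    (exists2 V, vsmooth_on setT V & f = op_fun A V) ->
    0 < eps ->
    control_set K E ->
    open Omega -> K `<=` Omega ->
    vsmooth_on Omega U ->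
    (forall x, Omega x -> op_fun A U x = f x) ->
    exists (T : 'I_n -> functional R d) (g : 'I_m -> functional R d)
           (W : set 'rV[R]_d) (w : 'rV[R]_d -> 'cV[R]_n),
      [/\ (forall j, is_distribution (T j)),
          [/\ open W, K `<=` W, vsmooth_on W w &
              forall j phi, test_fun phi -> tsupp phi `<=` W ->
                T j phi = fun_dist (vcoord w j) phi],
          point_control E g,
          (forall i phi, test_fun phi ->
             op_dist A T i phi = fun_dist (vcoord f i) phi + g i phi) &
          (Ck_norm k K (fun x => (w x - U x)%R) <= eps%:E)%E].

End Runge.

Lemma foldr_pder_cst (R : realType) (d : nat) (c : R) (s : seq 'I_d) :
  exists c', foldr (@pder R d) (cst c) s = cst c'.
Proof.
elim: s => [|i s [c' IH]]; first by exists c.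
by exists 0; rewrite /= IH; apply/funext => x; rewrite /pder derive_cst.
Qed.

Lemma smooth_cst (R : realType) (d : nat) (c : R) (Omega : set 'rV[R]_d) :
  smooth_on Omega (fun=> c).
Proof.
move=> s x _; have [c' ->] := foldr_pder_cst c s.
by split; [exact: cst_continuous | move=> i; exact: derivable_cst].
Qed.

(* The Stokes operator: the value (u, p) is the block column col_mx u p; see
   stokesE for the explicit formula. *)
Section Stokes.
Variable R : realType.

Definition stokes_mi (t : bool * 'I_3) (i : 'I_3) : nat :=
  if t.1 then (i == t.2).*2 else (i == t.2).

Definition stokes_coef (t : bool * 'I_3) : 'M[R]_(3 + 1, 3 + 1) :=
  if t.1 then block_mx 1%:M 0 0 0
  else block_mx 0 (- delta_mx t.2 0) (delta_mx 0 t.2) 0.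

Definition stokes : diffop R 3 (3 + 1) (3 + 1) :=
  @DiffOp R 3 (3 + 1) (3 + 1) (bool * 'I_3)%type stokes_mi
    (fun t _ => stokes_coef t)
    (fun t i j => smooth_cst (stokes_coef t i j) (Omega := setT)).

Definition laplacian (f : 'rV[R]_3 -> R) (x : 'rV[R]_3) : R :=
  \sum_(i < 3) pder i (pder i f) x.

Definition divergence (u : 'rV[R]_3 -> 'cV[R]_3) (x : 'rV[R]_3) : R :=
  \sum_(i < 3) pder i (vcoord u i) x.

Lemma mder_stokes_mi t (f : 'rV[R]_3 -> R) :
  mder (stokes_mi t) f = if t.1 then pder t.2 (pder t.2 f) else pder t.2 f.
Proof.
rewrite /mder !enum_ordSl enum_ord0 /stokes_mi.
by case: t => [[]] [[|[|[|//]]] i3] /=; congr pder => //; try congr pder;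
  try exact: val_inj; apply/funext => x; rewrite /pder; congr derive;
  congr delta_mx; exact: val_inj.
Qed.

Lemma stokesE (u : 'rV[R]_3 -> 'cV[R]_3) (p : 'rV[R]_3 -> R) (x : 'rV[R]_3) :
  op_fun stokes (fun y => col_mx (u y) (p y)%:M) x =
  col_mx (\col_i (laplacian (vcoord u i) x - pder i p x)) (divergence u x)%:M.
Proof.
have vmderE t : vmder (stokes_mi t) (fun y => col_mx (u y) (p y)%:M) x =
    col_mx (vmder (stokes_mi t) u x) (mder (stokes_mi t) p x)%:M.
  apply/colP => k; rewrite [RHS]/=.
  case: (split_ordP k) => j ->; rewrite mxE.
    rewrite col_mxEu mxE; congr (mder _ _ _); apply/funext => y.
    by rewrite /vcoord col_mxEu.
  rewrite col_mxEd !ord1 mxE eqxx mulr1n; congr (mder _ _ _).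
  by apply/funext => y; rewrite /vcoord col_mxEd mxE eqxx.
rewrite /op_fun /= (eq_bigr _ (fun t _ => congr1 _ (vmderE t))).
rewrite -(pair_bigA _ (fun b j => stokes_coef (b, j) *m
  col_mx (vmder (stokes_mi (b, j)) u x) (mder (stokes_mi (b, j)) p x)%:M)) /=.
rewrite big_bool /stokes_coef /=.
under eq_bigr do rewrite mul_block_col mul1mx !mul0mx !addr0.
under [X in _ + X]eq_bigr do rewrite mul_block_col !mul0mx add0r addr0.
apply/colP => k; rewrite mxE !summxE.
case: (split_ordP k) => i ->.
  rewrite col_mxEu mxE; congr (_ + _).
    by apply: eq_bigr => j _; rewrite col_mxEu mxE mder_stokes_mi.
  rewrite (bigD1 i) //= big1 ?addr0 => [|j ji].
    rewrite col_mxEu mxE big_ord1 !mxE !eqxx mulr1n mder_stokes_mi /=.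
    by rewrite mulN1r.
  by rewrite col_mxEu mxE big_ord1 !mxE eq_sym (negbTE ji) oppr0 mul0r.
rewrite col_mxEd mxE !ord1 eqxx mulr1n big1 ?add0r => [|j _]; last first.
  by rewrite col_mxEd mxE.
apply: eq_bigr => j _; rewrite col_mxEd mxE (bigD1 j) //= big1 ?addr0.
  by rewrite !mxE !eqxx mul1r mder_stokes_mi.
by move=> l lj; rewrite !mxE (negbTE lj) andbF mul0r.
Qed.

End Stokes.

(* Main.v *)
(* Composing the Stokes operator A on either side with a suitable operator Q
   with constant coefficients gives the bilaplacian on every component.  The
   bilaplacian has the fundamental solution c |x|, c constant.  Subtracting a
   global solution we may take f = 0.  If chi is a cutoff equal to 1 near K, then
   near K a solution u of A u = 0 equals chi u = Q b, where b is the convolution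
   of c |x| with A (chi u), a field supported in a compact set disjoint from K.
   Riemann sums approximate b on K, with all derivatives, by combinations of
   translates |x - y| with y outside K.  The pole y can be moved inside its
   component of the complement of K by Taylor expansion of |x - y| in y: in a
   bounded component it is moved to the point of E, and in the unbounded one so
   far away that Taylor expansion in x gives biharmonic polynomials.  Applying
   Q to the resulting potentials, whose bilaplacians are combinations of
   derivatives of Dirac masses at points of E, and using A Q = bilaplacian,
   gives the required solution. *)

(* The scalar kernel |x| of order four has an advantage over the singular matrix kernel of the
   Stokes system: it is continuous. Integrals over the space are therefore only taken of continuous
   compactly supported functions, and a singular derivative of |x - e| enters as a distribution,
   with the derivatives placed on the test function. Of the constant in the fundamental solution
   only the sign is established, which suffices to divide by it.

   Moving a pole requires Taylor series that converge on a radius proportional to the distance to K.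
   This rests on an explicit bound 3^k k! r^(1-k) for the derivatives of order k of the Euclidean
   norm r, obtained by counting terms under differentiation. Near any point off K a pole can be
   moved in both directions, so the admissible poles are both open and closed in a component, and no
   path has to be chosen. All derivatives of the kernel at a pole are moved together, because the
   Taylor terms at the next pole involve them all; approximation is therefore formulated for whole
   jets, which also absorbs the up to four derivatives that Q costs. *)
Require Import Defs.
From mathcomp Require Import all_boot all_order all_algebra.
From mathcomp Require Import finmap.
From mathcomp Require Import all_classical all_reals all_analysis.
From mathcomp Require Import zify ring lra.
Import Order.TTheory GRing.Theory Num.Theory.
Import numFieldNormedType.Exports.

Set Implicit Arguments.
Unset Strict Implicit.
Unset Printing Implicit Defensive.

Local Open Scope classical_set_scope.
Local Open Scope ring_scope.

(** * Iterated partial derivatives *)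

(* Opaque copies of [pder] and [smooth_on]: unfolding these during conversion
   checks is prohibitively slow. *)
Fact pd_key (R : realType) (d : nat) :
  {p : 'I_d -> ('rV[R]_d -> R) -> 'rV[R]_d -> R | p = @pder R d}.
Proof. by exists (@pder R d). Qed.

Definition pd {R : realType} {d : nat} := sval (@pd_key R d).

Lemma pdE R d : @pd R d = @pder R d.
Proof. exact: svalP (pd_key R d). Qed.

Fact smooth_key (R : realType) (d : nat) :
  {p : set 'rV[R]_d -> ('rV[R]_d -> R) -> Prop | p = @smooth_on R d}.
Proof. by exists (@smooth_on R d). Qed.

Definition smooth {R : realType} {d : nat} := sval (@smooth_key R d).

Lemma smoothE R d : @smooth R d = @smooth_on R d.
Proof. exact: svalP (smooth_key R d). Qed.

Notation D s f := (foldr (@pd _ _) f s).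

Section Derivatives.
Context {R : realType} {d : nat}.
Implicit Types (f g : 'rV[R]_d -> R) (W : set 'rV[R]_d) (x v a : 'rV[R]_d).

(** Restriction to the line through [x] in direction [v] leaves the difference quotients unchanged.
    Directional derivatives thereby become one-variable ones, to which the chain rule and the mean
    value theorem apply. *)
Lemma growth_line f v x (t : R) :
  (fun h : R => h^-1 *: (((fun h : R => f (h *: v + x)) \o shift t) (h *: (1 : R)) - f (t *: v + x)))
  = (fun h : R => h^-1 *: ((f \o shift (t *: v + x)) (h *: v) - f (t *: v + x))).
Proof.
apply/funext => h /=; congr (_ *: (f _ - _)).
by rewrite [h *: 1]mulr1 scalerDl addrA.
Qed.

Lemma is_derive_line f v x (t : R) l : is_derive (t *: v + x) v f l ->
  is_derive t (1 : R) (fun h : R => f (h *: v + x)) l.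
Proof.
case=> df <-; apply: DeriveDef; first by rewrite /derivable growth_line.
by rewrite /derive growth_line.
Qed.

Lemma is_derive_line0 f v x l : is_derive (0 : R) (1 : R) (fun h : R => f (h *: v + x)) l ->
  is_derive x v f l.
Proof.
have E := growth_line f v x 0; rewrite scale0r add0r in E.
case=> df <-; apply: DeriveDef.
  by move: df; rewrite /derivable -E scale0r add0r.
by rewrite /derive -E scale0r add0r.
Qed.

Lemma is_derive_comp1 f (g : R -> R) x v df dg :
  is_derive x v f df -> is_derive (f x) 1 g dg ->
  is_derive x v (fun y => g (f y)) (dg * df).
Proof.
move=> f' g'; apply: is_derive_line0.
have F : is_derive (0 : R) (1 : R) (fun h : R => f (h *: v + x)) df.
  by apply: is_derive_line; rewrite scale0r add0r.
have := @is_derive1_comp R g (fun h => f (h *: v + x)) 0 dg df.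
rewrite /= scale0r add0r; apply; by [].
Qed.


Lemma is_derive_shift_arg f a x v l : is_derive (x - a) v f l ->
  is_derive x v (fun y => f (y - a)) l.
Proof.
move=> H; apply: is_derive_line0.
have -> : (fun h : R => f (h *: v + x - a)) = (fun h => f (h *: v + (x - a))).
  by apply/funext => h; rewrite addrA.
by apply: is_derive_line; rewrite scale0r add0r.
Qed.

Lemma is_derive_reflect f a x v l : is_derive (a - x) v f l ->
  is_derive x v (fun y => f (a - y)) (- l).
Proof.
move=> H; apply: is_derive_line0.
have -> : (fun h : R => f (a - (h *: v + x))) = (fun h => f ((- h) *: v + (a - x))).
  by apply/funext => h; congr f; rewrite opprD scaleNr; rewrite addrCA addrA.
have F : is_derive (- 0 : R) (1 : R) (fun h : R => f (h *: v + (a - x))) l.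
  by apply: is_derive_line; rewrite oppr0 scale0r add0r.
have := @is_derive1_comp R (fun h => f (h *: v + (a - x))) (fun h => - h) 0 l (- 1).
rewrite mulrN1; apply; by [].
Qed.

Lemma pd_is_derive i f x l : is_derive x (delta_mx 0 i) f l -> pd i f x = l.
Proof. by rewrite pdE; case. Qed.

Lemma near_open W x : open W -> W x -> \forall y \near x, W y.
Proof. by move=> oW Wx; apply: open_nbhs_nbhs; split. Qed.


Lemma pd_local W f g i : open W -> (forall x, W x -> f x = g x) ->
  forall x, W x -> pd i f x = pd i g x.
Proof.
move=> oW fg x Wx; rewrite pdE; apply: near_eq_derive.
by apply: filterS (near_open oW Wx) => y /fg.
Qed.

Lemma dword_local W f g s : open W -> (forall x, W x -> f x = g x) ->
  forall x, W x -> D s f x = D s g x.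
Proof. by move=> oW fg; elim: s => //= i s IH; apply: pd_local. Qed.

Lemma continuous_near_eq f g x : (\forall y \near x, f y = g y) ->
  {for x, continuous f} -> {for x, continuous g}.
Proof.
move=> fg c; suff: g @ x --> g x by [].
rewrite -(nbhs_singleton fg).
exact: cvg_trans (near_eq_cvg fg) c.
Qed.

Lemma continuous_reflect a : continuous (fun y : 'rV[R]_d => a - y).
Proof.
by move=> y; apply: (@continuousB _ _ _ (fun=> a) id); [exact: cst_continuous | exact: cvg_id].
Qed.

Lemma continuous_subr_cst a : continuous (fun y : 'rV[R]_d => y - a).
Proof.
by move=> y; apply: (@continuousB _ _ _ id (fun=> a)); [exact: cvg_id | exact: cst_continuous].
Qed.

Lemma open_reflect W a : open W -> open [set y : 'rV[R]_d | W (a - y)].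
Proof. by move=> oW; apply: open_comp oW => y _; apply: continuous_reflect. Qed.

Lemma open_shift W a : open W -> open [set y : 'rV[R]_d | W (y - a)].
Proof. by move=> oW; apply: open_comp oW => y _; apply: continuous_subr_cst. Qed.

(** The recursion strips the derivative nearest to [f], so that sums, products, inverses and
    compositions are treated by induction on the order, from a formula for the first partials alone.
    In [smooth_on] the letter at the head of the word is the outermost derivative; [rcons] converts
    between the two. *)
Fixpoint Cn n W f : Prop :=
  (forall x, W x -> {for x, continuous f}) /\
  (if n is n'.+1 then (forall x i, W x -> derivable f x (delta_mx 0 i)) /\
     (forall i, Cn n' W (pd i f)) else True).

Lemma Cn_cont n W f x : Cn n W f -> W x -> {for x, continuous f}.
Proof. by case: n => [|n] [+ _]; apply. Qed.

Lemma smooth_onP W f : smooth_on W f <-> forall n, Cn n W f.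
Proof.
split.
  rewrite -?pdE; have sp g i : smooth_on W g -> smooth_on W (pd i g).
    rewrite pdE; move=> sg s x Wx; by have := sg (rcons s i) x Wx; rewrite foldr_rcons.
  move=> + n; elim: n f => [|n IH] f sf.
    by split => // x Wx; case: (sf [::] x Wx).
  split; first by move=> x Wx; case: (sf [::] x Wx).
  split; first by move=> x i Wx; case: (sf [::] x Wx).
  by move=> i; apply: IH; apply: sp.
move=> + s; elim/last_ind: s f => [|s i IH] f Cf x Wx.
  by case: (Cf 1%N) => c [df _]; split; [exact: c | move=> i; exact: df].
rewrite foldr_rcons; apply: IH => // n.
have [_ [_ H]] := Cf n.+1.
by rewrite -pdE; apply: H.
Qed.

Lemma smoothP W f : smooth W f <-> forall n, Cn n W f.
Proof. by rewrite smoothE; apply: smooth_onP. Qed.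

Lemma smooth_dwordP W f : smooth W f <-> forall s x, W x ->
  {for x, continuous (D s f)} /\ forall i, derivable (D s f) x (delta_mx 0 i).
Proof. by rewrite smoothE pdE. Qed.

Lemma smooth_pd W f i : smooth W f -> smooth W (pd i f).
Proof. by move=> /smoothP sf; apply/smoothP => n; case: (sf n.+1) => _ [_]; apply. Qed.

Lemma smooth_dword W f s : smooth W f -> smooth W (D s f).
Proof. by move=> sf; elim: s => //= i s; apply: smooth_pd. Qed.

Lemma Cn_local n W f g : open W -> (forall x, W x -> f x = g x) -> Cn n W f -> Cn n W g.
Proof.
move=> oW; elim: n f g => [|n IH] f g fg /= [c H].
  split=> // x Wx.
  have fgn : \forall y \near x, f y = g y by apply: filterS (near_open oW Wx) => y /fg.
  exact: continuous_near_eq fgn (c _ Wx).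
case: H => df H; split.
  move=> x Wx; have fgn : \forall y \near x, f y = g y by apply: filterS (near_open oW Wx) => y /fg.
  exact: continuous_near_eq fgn (c _ Wx).
split.
  move=> x i Wx; apply: near_eq_derivable (df x i Wx).
  by apply: filterS (near_open oW Wx) => y /fg.
by move=> i; apply: IH (H i); apply: pd_local.
Qed.

Lemma Cn_S n W f : Cn n.+1 W f -> Cn n W f.
Proof.
elim: n f => [|n IH] f; first by case=> c _; split.
by case=> c [df H]; split=> //; split=> // i; apply: IH; apply: H.
Qed.

Lemma Cn_derivable n W f x i : Cn n.+1 W f -> W x -> derivable f x (delta_mx 0 i).
Proof. by case=> _ [df _]; apply: df. Qed.

Lemma Cn_pd n W f i : Cn n.+1 W f -> Cn n W (pd i f).
Proof. by case=> _ [_]; apply. Qed.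

Lemma Cn_is_derive n W f x i : Cn n.+1 W f -> W x ->
  is_derive x (delta_mx 0 i) f (pd i f x).
Proof. by move=> Cf Wx; rewrite pdE; apply: derivableP; exact: Cn_derivable Cf Wx. Qed.

(* To prove [C^(n+1)] it suffices to exhibit candidates for the partials. *)
Lemma Cn_intro n W f (f' : 'I_d -> 'rV[R]_d -> R) : open W ->
  (forall x, W x -> {for x, continuous f}) ->
  (forall x i, W x -> is_derive x (delta_mx 0 i) f (f' i x)) ->
  (forall i, Cn n W (f' i)) -> Cn n.+1 W f.
Proof.
move=> oW c df Cf'; split=> //; split; first by move=> x i /(df x i) [].
by move=> i; apply: Cn_local (Cf' i) => // x /(df x i) H; rewrite (pd_is_derive H).
Qed.

Lemma Cn_cst n W c : Cn n W (fun=> c).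
Proof. by move: n; apply/smooth_onP; apply: smooth_cst. Qed.

Lemma Cn_lin n W (c : R) f g : open W -> Cn n W f -> Cn n W g ->
  Cn n W (fun x => c * f x + g x).
Proof.
move=> oW; have Hc f1 g1 x : {for x, continuous f1} -> {for x, continuous g1} ->
    {for x, continuous (fun x => c * f1 x + g1 x)}.
  move=> cf cg; apply: (@continuousD _ _ _ (fun x => c * f1 x) g1) => //.
  by apply: (@continuousM _ _ (fun=> c) f1) => //; apply: cst_continuous.
elim: n f g => [|n IH] f g Cf Cg.
  by split => // x Wx; apply: Hc; [exact: (Cn_cont Cf) | exact: (Cn_cont Cg)].
apply: (@Cn_intro _ _ _ (fun i x => c * pd i f x + pd i g x)) => //.
- by move=> x Wx; apply: Hc; [exact: (Cn_cont Cf) | exact: (Cn_cont Cg)].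
- move=> x i Wx; have ? := Cn_is_derive i Cf Wx; have ? := Cn_is_derive i Cg Wx.
  exact: (@is_deriveD _ _ _ (c \*: f) g).
- by move=> i; apply: IH; exact: Cn_pd.
Qed.

Lemma Cn_mul n W f g : open W -> Cn n W f -> Cn n W g ->
  Cn n W (fun x => f x * g x).
Proof.
move=> oW; have Hc f1 g1 x : {for x, continuous f1} -> {for x, continuous g1} ->
    {for x, continuous (fun x => f1 x * g1 x)}.
  by move=> cf cg; apply: (@continuousM _ _ f1 g1).
elim: n f g => [|n IH] f g Cf Cg.
  by split => // x Wx; apply: Hc; [exact: (Cn_cont Cf) | exact: (Cn_cont Cg)].
apply: (@Cn_intro _ _ _ (fun i x => 1 * (f x * pd i g x) + g x * pd i f x)) => //.
- by move=> x Wx; apply: Hc; [exact: (Cn_cont Cf) | exact: (Cn_cont Cg)].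
- move=> x i Wx; rewrite mul1r.
  have ? := Cn_is_derive i Cf Wx; have ? := Cn_is_derive i Cg Wx.
  exact: (@is_deriveM _ _ f g).
- move=> i; apply: Cn_lin => //; apply: IH; try exact: Cn_pd; exact: Cn_S.
Qed.

Lemma Cn_inv n W f : open W -> (forall x, W x -> f x != 0) -> Cn n W f ->
  Cn n W (fun x => (f x)^-1).
Proof.
move=> oW f0; elim: n => [|n IH] Cf.
  by split=> // x Wx; apply: continuousV; [exact: f0 | exact: (Cn_cont Cf)].
apply: (@Cn_intro _ _ _ (fun i x => -1 * (((f x)^-1 * (f x)^-1) * pd i f x) + 0)) => //.
- by move=> x Wx; apply: continuousV; [exact: f0 | exact: (Cn_cont Cf)].
- move=> x i Wx; have [df df'] := Cn_is_derive i Cf Wx.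
  apply: DeriveDef; first by apply: derivableV => //; exact: f0.
  rewrite deriveV //; last exact: f0.
  by rewrite df' addr0 mulN1r -expr2 exprVn scaleNr.
- move=> i; have CS := Cn_S Cf; have IHS := IH CS.
  apply: Cn_lin => //; last exact: Cn_cst.
  apply: Cn_mul => //; last exact: Cn_pd.
  exact: Cn_mul.
Qed.

Lemma coord_is_derive x i j :
  is_derive x (delta_mx 0 i) (fun y : 'rV[R]_d => y 0 j) (i == j)%:R.
Proof.
apply: is_derive_line0.
have -> : (fun h : R => (h *: delta_mx 0 i + x) 0 j) = (fun h => h * (i == j)%:R + x 0 j).
  by apply/funext => h; rewrite !mxE eqxx /= eq_sym.
have := @is_deriveD _ _ _ (fun h : R => h * (i == j)%:R) (fun=> x 0 j) 0 1
  ((i == j)%:R) 0.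
rewrite addr0; apply.
have := @is_deriveM _ _ (fun h : R => h) (fun=> (i == j)%:R) 0 1 1 0.
by rewrite scale0r add0r /GRing.scale /= mulr1; apply.
Qed.

Lemma Cn_coord n W j : open W -> Cn n W (fun x => x 0 j).
Proof.
move=> oW; case: n => [|n]; first by split=> // x _; exact: coord_continuous.
apply: (@Cn_intro _ _ _ (fun i x => (i == j)%:R)) => //.
- by move=> x _; exact: coord_continuous.
- by move=> x i _; exact: coord_is_derive.
- by move=> i; apply: Cn_cst.
Qed.

Lemma Cn_sum n W (I : Type) (r : seq I) (F : I -> 'rV[R]_d -> R) : open W ->
  (forall i, Cn n W (F i)) -> Cn n W (fun x => \sum_(i <- r) F i x).
Proof.
move=> oW CF; elim: r => [|i r IH].
  by under eq_fun do rewrite big_nil; apply: Cn_cst.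
by under eq_fun do rewrite big_cons -[F _ _]mul1r; apply: Cn_lin.
Qed.

Lemma Cn_sub n W W' f : W' `<=` W -> Cn n W f -> Cn n W' f.
Proof.
move=> WW; elim: n f => [|n IH] f /= [c H]; first by split=> // x /WW; exact: c.
case: H => df H; split; first by move=> x /WW; exact: c.
by split; [move=> x i /WW; exact: df | move=> i; apply: IH].
Qed.

Lemma smooth_const W c : smooth W (fun=> c).
Proof. by rewrite smoothE; apply: smooth_cst. Qed.

Lemma smooth_sub W W' f : W' `<=` W -> smooth W f -> smooth W' f.
Proof. by move=> WW /smoothP H; apply/smoothP => n; apply: Cn_sub (H n). Qed.

Lemma smooth_local W f g : open W -> (forall x, W x -> f x = g x) ->
  smooth W f -> smooth W g.
Proof. by move=> oW fg /smoothP H; apply/smoothP => n; apply: Cn_local (H n). Qed.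

Lemma smooth_union W W' f : smooth W f -> smooth W' f -> smooth (W `|` W') f.
Proof. by move=> /smooth_dwordP H /smooth_dwordP H'; apply/smooth_dwordP => s x [/H | /H']. Qed.

Lemma smooth_lin W (c : R) f g : open W -> smooth W f -> smooth W g ->
  smooth W (fun x => c * f x + g x).
Proof. by move=> oW /smoothP H /smoothP H'; apply/smoothP => n; apply: Cn_lin. Qed.

Lemma smooth_add W f g : open W -> smooth W f -> smooth W g ->
  smooth W (fun x => f x + g x).
Proof.
move=> oW sf sg; have -> : (fun x => f x + g x) = (fun x => 1 * f x + g x).
  by apply/funext => x; rewrite mul1r.
exact: smooth_lin.
Qed.

Lemma smooth_sum W (I : Type) (r : seq I) (F : I -> 'rV[R]_d -> R) : open W ->
  (forall i, smooth W (F i)) -> smooth W (fun x => \sum_(i <- r) F i x).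
Proof.
by move=> oW SF; apply/smoothP => n; apply: Cn_sum => // i; move: n; apply/smoothP.
Qed.

Lemma smooth_mul W f g : open W -> smooth W f -> smooth W g ->
  smooth W (fun x => f x * g x).
Proof. by move=> oW /smoothP H /smoothP H'; apply/smoothP => n; apply: Cn_mul. Qed.

Lemma smooth_scale W c f : open W -> smooth W f -> smooth W (fun x => c * f x).
Proof. by move=> oW H; apply: smooth_mul => //; apply: smooth_const. Qed.

Lemma smooth_sub2 W f g : open W -> smooth W f -> smooth W g ->
  smooth W (fun x => f x - g x).
Proof.
move=> oW sf sg; have -> : (fun x => f x - g x) = (fun x => -1 * g x + f x).
  by apply/funext => x; rewrite mulN1r addrC.
exact: smooth_lin.
Qed.

Lemma smooth_coord W j : open W -> smooth W (fun x => x 0 j).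
Proof. by move=> oW; apply/smoothP => n; apply: Cn_coord. Qed.

Lemma smooth_is_derive W f x i : smooth W f -> W x ->
  is_derive x (delta_mx 0 i) f (pd i f x).
Proof. by move/smoothP/(_ 1%N) => C Wx; apply: Cn_is_derive C Wx. Qed.

Lemma smooth_continuous W f x : smooth W f -> W x -> {for x, continuous f}.
Proof. by move=> sf Wx; case: ((smooth_dwordP _ _).1 sf [::] x Wx). Qed.

Lemma pd_lin W (c : R) f g i x : smooth W f -> smooth W g -> W x ->
  pd i (fun x => c * f x + g x) x = c * pd i f x + pd i g x.
Proof.
move=> sf sg Wx; have ? := smooth_is_derive i sf Wx; have ? := smooth_is_derive i sg Wx.
by apply: pd_is_derive; exact: (@is_deriveD _ _ _ (c \*: f) g).
Qed.

Lemma dword_lin W (c : R) f g s x : open W -> smooth W f -> smooth W g -> W x ->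
  D s (fun x => c * f x + g x) x = c * D s f x + D s g x.
Proof.
move=> oW sf sg; elim: s x => //= i s IH x Wx.
rewrite (pd_local _ oW IH) //; apply: (pd_lin (W := W)) => //; exact: smooth_dword.
Qed.

Lemma pd_cst i c : pd i (fun=> c : R) = (fun=> 0) :> ('rV[R]_d -> R).
Proof. by apply/funext => x; rewrite pdE /pder derive_cst. Qed.

Lemma dword_cst s c x : s != [::] -> D s (fun=> c) x = 0 :> R.
Proof.
case: s => // i s _ /=; rewrite pdE; have [c' E] := foldr_pder_cst (d := d) c s.
by rewrite E -pdE pd_cst.
Qed.

Lemma dword_sum W (I : Type) (r : seq I) (F : I -> 'rV[R]_d -> R) s x :
  open W -> (forall i, smooth W (F i)) -> W x ->
  D s (fun x => \sum_(i <- r) F i x) x = \sum_(i <- r) D s (F i) x.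
Proof.
move=> oW SF Wx; elim: r => [|i r IH].
  under [in LHS]eq_fun do rewrite big_nil.
  by rewrite big_nil; case: s => // j s; rewrite dword_cst.
under [in LHS]eq_fun do rewrite big_cons -[F _ _]mul1r.
by rewrite big_cons (dword_lin (W := W)) // ?mul1r ?IH //; exact: smooth_sum.
Qed.

Lemma dword_cat s t f : D (s ++ t) f = D s (D t f).
Proof. exact: foldr_cat. Qed.

Lemma dword_shift f a s x : D s (fun y => f (y - a)) x = D s f (x - a).
Proof.
elim: s x => //= i s IH x.
have -> : D s (fun y => f (y - a)) = (fun y => D s f (y - a)) by apply/funext.
move: (D s f) => g.
suff E : (fun h : R => h^-1 *: (((fun y => g (y - a)) \o shift x) (h *: delta_mx 0 i)
    - g (x - a))) = (fun h => h^-1 *: ((g \o shift (x - a)) (h *: delta_mx 0 i)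
    - g (x - a))) by rewrite pdE /pder /derive E.
by apply/funext => h /=; rewrite addrA.
Qed.

Lemma dword_reflect W f a s x : open W -> smooth W f -> W (a - x) ->
  D s (fun y => f (a - y)) x = (-1) ^+ size s * D s f (a - x).
Proof.
move=> oW sf; elim: s x => [|i s IH] x Wx /=; first by rewrite mul1r.
have oW' := open_reflect (a := a) oW.
  rewrite (pd_local i oW' IH) //; apply: pd_is_derive.
rewrite exprS mulN1r mulNr -mulrN.
have ? := is_derive_reflect (smooth_is_derive i (smooth_dword s sf) Wx).
exact: (@is_deriveZ _ _ _ (fun y => D s f (a - y))).
Qed.

Lemma smooth_shift W f a : open W -> smooth W f ->
  smooth [set x | W (x - a)] (fun y => f (y - a)).
Proof.
move=> oW sf; apply/smooth_dwordP => s x Wx; have E : D s (fun y => f (y - a)) = (fun y => D s f (y - a)).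
  by apply/funext => y; apply: dword_shift.
have [c df] := (smooth_dwordP _ _).1 sf s _ Wx; rewrite E; split.
  by apply: continuous_comp; [exact: continuous_subr_cst | exact: c].
by move=> i; have [] := is_derive_shift_arg (derivableP (df i)).
Qed.

Lemma smooth_reflect W f a : open W -> smooth W f ->
  smooth [set x | W (a - x)] (fun y => f (a - y)).
Proof.
move=> oW /smoothP sf; have oW' := open_reflect (a := a) oW.
apply/smoothP => n; elim: n f {sf}(sf n) => [|n IH] f Cf; last first.
  apply: (@Cn_intro _ _ _ (fun i x => -1 * pd i f (a - x) + 0)) => //.
  - move=> x Wx; by apply: continuous_comp; [exact: continuous_reflect | exact: (Cn_cont Cf)].
  - move=> x i Wx; rewrite addr0 mulN1r; apply: is_derive_reflect.
    exact: Cn_is_derive Cf Wx.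
  - move=> i; apply: Cn_lin => //; last exact: Cn_cst.
    by apply: IH; apply: Cn_pd.
split=> // x Wx; by apply: continuous_comp; [exact: continuous_reflect | exact: (Cn_cont Cf)].
Qed.

End Derivatives.

(** * The sup norm of row vectors and the symmetry of mixed derivatives *)

Section NormRow.
Context {R : realType} {d : nat}.
Implicit Types (x y v : 'rV[R]_d).

Lemma coord_le_norm x i : `|x 0 i| <= `|x|.
Proof.
rewrite [leRHS]/Num.norm /= mx_normrE.
by apply: (le_bigmax _ (fun ij : 'I_1 * 'I_d => `|x ij.1 ij.2|) (0, i)).
Qed.

Lemma norm_row_le x (M : R) : 0 <= M -> (forall i, `|x 0 i| <= M) -> `|x| <= M.
Proof.
move=> M0 H; rewrite [leLHS]/Num.norm /= mx_normrE; apply: bigmax_le => //= -[i j] _ /=.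
by rewrite [i]ord1.
Qed.

Lemma norm_row_lt x (M : R) : 0 < M -> (forall i, `|x 0 i| < M) -> `|x| < M.
Proof.
move=> M0 H; rewrite [ltLHS]/Num.norm /= mx_normrE; apply/bigmax_ltP; split=> //= -[i j] _ /=.
by rewrite [i]ord1.
Qed.

Lemma norm_delta i : `|delta_mx 0 i : 'rV[R]_d| <= 1.
Proof.
apply: norm_row_le => // j; rewrite !mxE eqxx /=.
by case: (j == i); rewrite ?normr1 ?normr0.
Qed.

Lemma nbhs_rowP x (P : set 'rV[R]_d) : nbhs x P <->
  exists2 e : R, 0 < e & forall y, `|y - x| < e -> P y.
Proof.
rewrite -nbhs_ballE; split=> -[e /= e0 H]; exists e => //.
  by move=> y yx; apply: H; rewrite -ball_normE /= distrC.
by move=> y; rewrite -ball_normE /= distrC; apply: H.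
Qed.

Lemma open_rowP (W : set 'rV[R]_d) x : open W -> W x ->
  exists2 e : R, 0 < e & forall y, `|y - x| < e -> W y.
Proof. by move=> oW Wx; apply/nbhs_rowP; apply: near_open. Qed.

Lemma cont_rowP (f : 'rV[R]_d -> R) x : {for x, continuous f} <->
  forall e : R, 0 < e -> exists2 h : R, 0 < h & forall y, `|y - x| < h -> `|f y - f x| < e.
Proof.
split.
  move=> c e e0; apply/nbhs_rowP; move/cvgrPdist_lt/(_ e e0): c.
  by apply: filterS => y; rewrite distrC.
move=> H; apply/(@cvgrPdist_lt _ _ _ (nbhs x)) => e e0; apply/nbhs_rowP.
by have [h h0 Hh] := H e e0; exists h => // y /Hh; rewrite distrC.
Qed.

Lemma line_MVT (f f' : 'rV[R]_d -> R) x v (h : R) : 0 < h ->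
  (forall t, 0 <= t <= h -> is_derive (t *: v + x) v f (f' (t *: v + x))) ->
  exists2 t, 0 < t < h & f (h *: v + x) - f x = f' (t *: v + x) * h.
Proof.
move=> h0 H; pose g (t : R) := f (t *: v + x); pose g' t := f' (t *: v + x).
have dg t : 0 <= t <= h -> is_derive t 1 g (g' t).
  by move=> /H; apply: is_derive_line.
have [||t + E] := @MVT R g g' 0 h h0.
- by move=> t /andP[/ltW a /ltW b]; apply: dg; rewrite a b.
- by apply: derivable_within_continuous => t /dg [].
- by rewrite in_itv /= => t01; exists t => //; move: E; rewrite /g /g' scale0r add0r subr0.
Qed.

Lemma second_difference W (f : 'rV[R]_d -> R) x i j (h : R) : 0 < h ->
  smooth W f -> (forall y, `|y - x| <= 2 * h -> W y) ->
  exists2 y, `|y - x| <= 2 * h &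
    f (h *: delta_mx 0 i + (h *: delta_mx 0 j + x)) - f (h *: delta_mx 0 j + x)
    - (f (h *: delta_mx 0 i + x) - f x) = pd j (pd i f) y * h * h.
Proof.
move=> h0 sf HW; set ei := delta_mx 0 i; set ej := delta_mx 0 j.
have near2 (s t : R) : 0 <= s <= h -> 0 <= t <= h -> `|s *: ej + (t *: ei + x) - x| <= 2 * h.
  move=> /andP[s0 sh] /andP[t0 th]; rewrite addrA addrK.
  apply: le_trans (ler_normD _ _) _; rewrite !normrZ !ger0_norm // mulr_natl mulr2n.
  apply: lerD.
    by apply: le_trans (ler_wpM2l s0 (norm_delta _)) _; rewrite mulr1.
  by apply: le_trans (ler_wpM2l t0 (norm_delta _)) _; rewrite mulr1.
have hh : 0 <= h <= h by rewrite lexx ltW.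
have h00 : (0 : R) <= 0 <= h by rewrite lexx ltW.
(* With this sign [y - a] is the forward translate of [y] by [h *: ej]. The mean value theorem is
   applied to [F] along [ei], then to [pd i f] along [ej]. *)
pose a := - (h *: ej).
pose F y := f (y - a) - f y; pose F' y := pd i f (y - a) - pd i f y.
have [|t /andP[t0 th] E] := @line_MVT F F' x ei h h0.
  move=> t t01; apply: (@is_deriveB _ _ _ (fun y => f (y - a)) f).
    apply: is_derive_shift_arg; apply: smooth_is_derive sf _; apply: HW.
    by rewrite opprK [X in X - x]addrC; apply: near2.
  apply: smooth_is_derive sf _; apply: HW.
  by have := near2 0 t h00 t01; rewrite scale0r add0r.
have t01 : 0 <= t <= h by rewrite !ltW.
have [|s /andP[s0 sh] E'] := @line_MVT (pd i f) (pd j (pd i f)) (t *: ei + x) ej h h0.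
  move=> s s01; apply: smooth_is_derive (smooth_pd i sf) _; apply: HW.
  exact: near2.
exists (s *: ej + (t *: ei + x)); first by apply: near2 => //; rewrite !ltW.
have -> : pd j (pd i f) (s *: ej + (t *: ei + x)) * h * h = F (h *: ei + x) - F x.
  by rewrite E -E' /F' /a opprK [t *: ei + x + _]addrC.
rewrite /F /a !opprK -!addrA [x + h *: ej]addrC; ring.
Qed.

(** The second difference is symmetric in [i] and [j], so one mixed partial at some point within
    [2 * h] of [x] equals the other at another such point; continuity at [x] does the rest. *)
Lemma schwarz W (f : 'rV[R]_d -> R) x i j : open W -> smooth W f -> W x ->
  pd i (pd j f) x = pd j (pd i f) x.
Proof.
move=> oW sf Wx; apply/eqP; rewrite -subr_eq0 -normr_le0 leNgt; apply/negP => e0.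
set e := `|_| in e0.
have e2 : 0 < e / 2 by rewrite divr_gt0.
have [r r0 Hr] := open_rowP oW Wx.
have [h1 h10 H1] := (cont_rowP _ _).1 (smooth_continuous (smooth_pd i (smooth_pd j sf)) Wx) _ e2.
have [h2 h20 H2] := (cont_rowP _ _).1 (smooth_continuous (smooth_pd j (smooth_pd i sf)) Wx) _ e2.
pose h := Num.min r (Num.min h1 h2) / 4.
have m0 : 0 < Num.min r (Num.min h1 h2) by rewrite !lt_min r0 h10.
have h0 : 0 < h by rewrite divr_gt0.
have lth : 2 * h < Num.min r (Num.min h1 h2) by rewrite /h; lra.
move: (lth); rewrite !lt_min => /andP[hr /andP[hh1 hh2]].
have HW y : `|y - x| <= 2 * h -> W y by move=> H; apply: Hr; apply: le_lt_trans H hr.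
have [y1 y1x E1] := second_difference i j h0 sf HW.
have [y2 y2x E2] := second_difference j i h0 sf HW.
have E : pd j (pd i f) y1 = pd i (pd j f) y2.
  apply: (mulIf (lt0r_neq0 h0)); apply: (mulIf (lt0r_neq0 h0)).
  by rewrite -E1 -E2 addrCA; ring.
have := H1 _ (le_lt_trans y2x hh1); have := H2 _ (le_lt_trans y1x hh2); rewrite E.
move=> A B; have : e < e / 2 + e / 2; last by rewrite -splitr ltxx.
by apply: le_lt_trans (ler_distD (pd i (pd j f) y2) _ _) _; rewrite ltrD // distrC.
Qed.

Lemma dword_move W (f : 'rV[R]_d -> R) s1 i s2 x : open W -> smooth W f -> W x ->
  D (s1 ++ i :: s2) f x = D (i :: s1 ++ s2) f x.
Proof.
move=> oW sf; elim: s1 x => [|j s1 IH] x Wx //.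
rewrite -cat_cons [LHS]/= (pd_local _ oW IH) //= (schwarz _ _ oW) //.
exact: smooth_dword.
Qed.

Lemma dword_perm W (f : 'rV[R]_d -> R) s t x : open W -> smooth W f -> W x ->
  perm_eq s t -> D s f x = D t f x.
Proof.
move=> oW sf; elim: s t x => [|i s IH] t x Wx st.
  by move: st; rewrite perm_sym => /perm_nilP ->.
have : i \in t by rewrite -(perm_mem st) inE eqxx.
move=> /path.splitPr it; case: it st => t1 t2 st.
rewrite (dword_move _ _ _ oW) //=; apply: pd_local oW _ _ Wx => y Wy.
by apply: IH => //; rewrite -(perm_cons i) (permPl st) -cat1s perm_catCA.
Qed.

(** Derivatives are indexed by words because concatenation composes them; this sorted word leads
    back to the multi-indices of [mder]. *)
Definition word_of (a : 'I_d -> nat) := flatten [seq nseq (a i) i | i <- enum 'I_d].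

Lemma mder_word (a : 'I_d -> nat) (f : 'rV[R]_d -> R) : mder a f = D (word_of a) f.
Proof.
rewrite /mder /word_of pdE; elim: (enum 'I_d) => //= i s IH.
rewrite foldr_cat -IH; by elim: (a i) => //= n ->.
Qed.

Lemma size_word_of a : size (word_of a) = (\sum_i a i)%N.
Proof.
rewrite /word_of size_flatten sumnE /shape big_map big_map.
by rewrite big_enum /=; apply: eq_bigr => i _; rewrite size_nseq.
Qed.

Lemma word_of_count s : perm_eq s (word_of (fun i => count_mem i s)).
Proof.
apply/allP => i _ /=; apply/eqP; rewrite /word_of count_flatten sumnE big_map big_map.
rewrite big_enum /= (bigD1 i) //= big1 ?addn0.
  by rewrite count_nseq /= eqxx mul1n.
by move=> j ji; rewrite count_nseq /= (negbTE ji).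
Qed.

Lemma dword_mder W (f : 'rV[R]_d -> R) s x : open W -> smooth W f -> W x ->
  D s f x = mder (fun i => count_mem i s) f x.
Proof. by move=> oW sf Wx; rewrite mder_word; apply: (dword_perm oW sf Wx); apply: word_of_count. Qed.

Lemma sum_count s : (\sum_(i : 'I_d) count_mem i s)%N = size s.
Proof. by rewrite -size_word_of; rewrite -(perm_size (word_of_count s)). Qed.

End NormRow.

(** * Iterated integrals *)

Section OneDim.
Context {R : realType}.
Implicit Types (g G : R -> R).

(** Uniform continuity, unlike mere continuity, passes directly to the function of [t] obtained by
    integrating out the other variables, so the class is stable in the induction on the dimension.
    The radius [L] is explicit because it enters the estimates. *)
Definition uc1 (L : R) g : Prop :=
  [/\ 0 < L, (forall e, 0 < e -> exists2 h, 0 < h & forall s t, `|s - t| < h -> `|g s - g t| < e)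
    & forall t, L <= `|t| -> g t = 0].

Notation primitive G g := (forall t : R, is_derive t (1 : R) G (g t)).

Lemma MVT1 G g (a b : R) : primitive G g -> a <= b ->
  exists2 c, a <= c <= b & G b - G a = g c * (b - a).
Proof.
move=> dG ab; have [|c] := @MVT_segment R G g a b ab (fun x _ => dG x).
  by apply: derivable_within_continuous => t _; case: (dG t).
by rewrite in_itv /=; exists c.
Qed.

Lemma primitive_lin G1 g1 G2 g2 c : primitive G1 g1 -> primitive G2 g2 ->
  primitive (fun t => c * G1 t + G2 t) (fun t => c * g1 t + g2 t).
Proof.
by move=> d1 d2 t; have ? := d1 t; have ? := d2 t; exact: (@is_deriveD _ _ _ (c \*: G1) G2).
Qed.

Lemma uc1_continuous L g : uc1 L g -> continuous g.
Proof.
case=> _ u _ x; apply/cvgrPdist_lt => e e0; have [h h0 Hh] := u e e0.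
exists h => //= y; rewrite /ball_ /= => yx; exact: Hh.
Qed.

Lemma uc1_integrable L g : uc1 L g -> (@lebesgue_measure R).-integrable setT (EFin \o g).
Proof.
move=> ug; have [_ _ z] := ug.
have -> : EFin \o g = (EFin \o g) \_ `[- L, L].
  apply/funext => t; rewrite patchE; case: ifPn => // /negP.
  rewrite inE /= in_itv /= => H /=; rewrite z //.
  by rewrite leNgt; apply/negP => /ltW; rewrite ler_norml.
have mi : measurable (`[- L, L] : set R) by exact: measurable_itv.
have H : (@lebesgue_measure R).-integrable `[- L, L] (EFin \o g).
  apply: continuous_compact_integrable; first exact: segment_compact.
  by apply: continuous_subspaceT; exact: uc1_continuous ug.
have [+ _] := @integrable_mkcond _ _ _ (@lebesgue_measure R) _ (EFin \o g) mi.
by move=> /(_ H).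
Qed.

(** The primitive is the integral over the half-line up to [x]. Linearity, translation invariance
    and all bounds below thus become statements about primitives, settled by the mean value
    theorem. *)
Lemma uc1_primitive L g : uc1 L g -> exists2 G, primitive G g &
  (\int[@lebesgue_measure R]_(t in [set: R]) g t)%R = G L - G (- L).
Proof.
move=> ug; have ig := uc1_integrable ug; have [L0 _ z] := ug.
exists (fun x => (\int[lebesgue_measure]_(t in [set` `]-oo, x]%R]) g t)%R).
  move=> t.
  have it : (@lebesgue_measure R).-integrable [set` `]-oo, t + 1]%R] (EFin \o g).
    by apply: integrableS ig => //; exact: measurable_itv.
  have tt : t < t + 1 by rewrite ltrDl.
  have FT := continuous_FTC1 tt it; have [dG eG] := FT (ltNyr _) (@uc1_continuous _ _ ug t).
  by rewrite derive1E in eG; apply: DeriveDef.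
have -> : (\int[lebesgue_measure]_(t in [set` `]-oo, - L]%R]) g t)%R = 0.
  have Z : g \_ [set` `]-oo, - L]%R] = (fun=> 0).
    apply/funext => t; rewrite patchE; case: ifPn => //.
    rewrite inE /= in_itv /= => tL; apply: z; rewrite -normrN; apply: le_trans (ler_norm _).
    by rewrite lerNr.
  by rewrite Rintegral_mkcond Z Rintegral_cst ?mul0r.
rewrite subr0 [RHS]Rintegral_mkcond; apply: eq_Rintegral => t _; rewrite patchE.
case: ifPn => // /negP; rewrite inE /= in_itv /= => /negP; rewrite -ltNge => Lt.
by apply: z; apply: le_trans (ltW Lt) (ler_norm _).
Qed.

Lemma uc1_int L M g G : uc1 L g -> primitive G g -> L <= M ->
  (\int[@lebesgue_measure R]_(t in [set: R]) g t)%R = G M - G (- M).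
Proof.
move=> ug dG LM; have [G' dG' ->] := uc1_primitive ug; have [L0 _ z] := ug.
have E a b : a <= b -> G b - G a = G' b - G' a.
  move=> ab; have d0 := primitive_lin (-1) dG dG'.
  have [c _] := MVT1 d0 ab; rewrite !mulN1r addNr mul0r; lra.
have E1 : G M = G L.
  by have [c /andP[cL _]] := MVT1 dG LM; rewrite z ?mul0r; [lra | apply: le_trans cL (ler_norm _)].
have E2 : G (- L) = G (- M).
  have [|c /andP[_ cL]] := MVT1 dG (_ : - M <= - L); first by rewrite lerN2.
  rewrite z ?mul0r; first lra.
  by rewrite -normrN; apply: le_trans (ler_norm _); rewrite lerNr.
rewrite -E; last by rewrite ge0_cp // ltW.
by rewrite E1 E2.
Qed.

Lemma int1_lin L g1 g2 c : uc1 L g1 -> uc1 L g2 -> uc1 L (fun t => c * g1 t + g2 t) ->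
  (\int[@lebesgue_measure R]_(t in [set: R]) (c * g1 t + g2 t))%R =
  c * (\int[@lebesgue_measure R]_(t in [set: R]) g1 t)%R +
  (\int[@lebesgue_measure R]_(t in [set: R]) g2 t)%R.
Proof.
move=> u1 u2 u; have [G1 d1 ->] := uc1_primitive u1; have [G2 d2 ->] := uc1_primitive u2.
rewrite (uc1_int u (primitive_lin c d1 d2) (lexx L)); ring.
Qed.

Lemma int1_shift L g a : uc1 L g -> uc1 (L + `|a|) (fun t => g (t + a)) ->
  (\int[@lebesgue_measure R]_(t in [set: R]) g (t + a))%R =
  (\int[@lebesgue_measure R]_(t in [set: R]) g t)%R.
Proof.
move=> u ua; have [G dG _] := uc1_primitive u.
have dGa : primitive (fun t => G (t + a)) (fun t => g (t + a)).
  move=> t; have := @is_derive1_comp R G (shift a) t (g (t + a)) 1.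
  by rewrite mulr1; apply => //; exact: is_derive_shift.
have E b : L <= b -> G b = G L.
  have [_ _ z] := u => Lb; have [c /andP[cL _]] := MVT1 dG Lb.
  by rewrite z ?mul0r; [lra | apply: le_trans cL (ler_norm _)].
have E' b : b <= - L -> G b = G (- L).
  have [_ _ z] := u => Lb; have [c /andP[_ cL]] := MVT1 dG Lb.
  rewrite z ?mul0r; first lra.
  by rewrite -normrN; apply: le_trans (ler_norm _); rewrite lerNr.
rewrite (uc1_int ua dGa (lexx _)) (uc1_int u dG (lexx _)).
have := ler_norm a; have := ler_norm (- a); rewrite normrN => h1 h2.
by rewrite (E (L + `|a| + a)) ?(E' (- (L + `|a|) + a)); lra.
Qed.

Lemma deriv_le G g (a b : R) : a <= b -> (forall t, a <= t <= b -> is_derive t (1 : R) G (g t)) ->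
  (forall t, a <= t <= b -> 0 <= g t) -> G a <= G b.
Proof.
move=> ab dG g0.
have dG' x : x \in `]a, b[%R -> is_derive x (1 : R) G (g x).
  by rewrite in_itv /= => /andP[h1 h2]; apply: dG; rewrite !ltW.
have [|c] := MVT_segment ab dG'.
  apply: derivable_within_continuous => t; rewrite in_itv /= => tab.
  by case: (dG t tab).
by rewrite in_itv /= => cab E; rewrite -subr_ge0 E mulr_ge0 ?subr_ge0 // g0.
Qed.

Lemma primitive_le G g (a b : R) : primitive G g -> a <= b ->
  (forall t, a <= t <= b -> 0 <= g t) -> G a <= G b.
Proof. by move=> dG ab; apply: deriv_le ab _ => t _. Qed.

(** Both [M + G] and [M - G] have a nonnegative derivative. *)
Lemma deriv_maj G g M m (a b : R) : a <= b ->
  (forall t, a <= t <= b -> is_derive t (1 : R) G (g t)) ->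
  (forall t, a <= t <= b -> is_derive t (1 : R) M (m t)) ->
  (forall t, a <= t <= b -> `|g t| <= m t) -> `|G b - G a| <= M b - M a.
Proof.
move=> ab dG dM H.
have H1 : M a + G a <= M b + G b.
  apply: (@deriv_le (fun t => M t + G t) (fun t => m t + g t)) => // t tab.
    have ? := dG t tab; have ? := dM t tab; exact: (@is_deriveD _ _ _ M G).
  by have := H t tab; rewrite ler_norml => /andP[]; lra.
have H2 : M a - G a <= M b - G b.
  apply: (@deriv_le (fun t => M t - G t) (fun t => m t - g t)) => // t tab.
    have ? := dG t tab; have ? := dM t tab; exact: (@is_deriveB _ _ _ M G).
  by have := H t tab; rewrite ler_norml => /andP[]; lra.
by rewrite ler_norml; apply/andP; split; lra.
Qed.

Lemma int1_maj L g (m M : R -> R) A : uc1 L g -> primitive M m ->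
  (forall t, - L <= t <= L -> `|g t| <= A * m t) ->
  `|(\int[@lebesgue_measure R]_(t in [set: R]) g t)%R| <= A * (M L - M (- L)).
Proof.
move=> u dM H; have [G dG ->] := uc1_primitive u; have [L0 _ _] := u.
have LL : - L <= L by lra.
have dA : primitive (fun t => A * M t) (fun t => A * m t).
  move=> t; have ? := dM t; exact: (@is_deriveZ _ _ _ M A).
by rewrite mulrBr; apply: (deriv_maj LL (fun t _ => dG t) (fun t _ => dA t)) H.
Qed.

Lemma int1_low L g (m e : R) : uc1 L g -> 0 <= e <= L -> (forall t, 0 <= g t) ->
  (forall t, `|t| <= e -> m <= g t) ->
  m * (2 * e) <= (\int[@lebesgue_measure R]_(t in [set: R]) g t)%R.
Proof.
move=> u /andP[e0 eL] g0 H; have [G dG ->] := uc1_primitive u.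
have G1 : G (- L) <= G (- e) by apply: primitive_le dG _ _ => //; lra.
have G2 : G e <= G L by apply: primitive_le dG _ _ => //; lra.
have dm : primitive (fun t => m * t) (fun=> m).
  move=> t; have := @is_deriveZ _ _ _ (@id R) m t 1 1 (is_derive_id _ _).
  by rewrite [_ *: _]mulr1.
have := primitive_le (primitive_lin (-1) dm dG) (_ : - e <= e).
rewrite /=; have -> : - e <= e by lra.
move=> /(_ isT) K; have : -1 * (m * - e) + G (- e) <= -1 * (m * e) + G e.
  by apply: K => t te; have := H t; rewrite ler_norml => /(_ te); lra.
lra.
Qed.

(** A rectangle rule whose nodes depend on [L] and [h] alone: one list serves every integrand with
    the given modulus of continuity. This uniformity later allows one combination of kernels to
    approximate a potential at all points of a compact set. *)
Lemma int1_quad (L h : R) : 0 < L -> 0 < h -> exists r : seq (R * R),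
  forall g (e : R), uc1 L g -> (forall s t, `|s - t| <= h -> `|g s - g t| <= e) ->
   [/\ forall p, p \in r -> 0 <= p.1, \sum_(p <- r) p.1 = 2 * L &
  `|(\int[@lebesgue_measure R]_(t in [set: R]) g t)%R - \sum_(p <- r) p.1 * g p.2|
    <= 2 * L * e].
Proof.
move=> L0 h0; pose N := (Num.trunc (2 * L / h)).+1.
have N0 : 0 < N%:R :> R by rewrite ltr0n.
pose k : R := 2 * L / N%:R.
have k0 : 0 < k by rewrite divr_gt0 // mulr_gt0.
have kh : k <= h.
  rewrite /k ler_pdivrMr // [h * _]mulrC -ler_pdivrMr // ltW //.
  by rewrite /N truncnS_gt.
have kN : N%:R * k = 2 * L by rewrite /k mulrC divfK // lt0r_neq0.
pose x (i : nat) : R := - L + i%:R * k.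
have xS i : x i.+1 - x i = k by rewrite /x -natr1; ring.
exists (mkseq (fun i => (k, x i)) N) => g e u H; split.
- by move=> p /mapP[i _ ->] /=; exact: ltW.
- rewrite big_map big_const_seq count_predT size_iota iter_addr addr0 /=.
  by rewrite -[k *+ _]mulr_natl.
have [G dG ->] := uc1_primitive u.
have -> : G L - G (- L) = \sum_(0 <= i < N) (G (x i.+1) - G (x i)).
  rewrite telescope_sumr //; congr (G _ - G _); rewrite /x ?kN ?mul0r; ring.
rewrite big_map /index_iota subn0 -sumrB; apply: le_trans (ler_norm_sum _ _ _) _.
apply: (@le_trans _ _ (\sum_(i <- iota 0 N) k * e)); last first.
  rewrite big_const_seq count_predT size_iota iter_addr addr0 -[(k * e) *+ _]mulr_natl.
  by rewrite mulrA kN.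
apply: ler_sum => i _ /=.
have [|c /andP[c1 c2] ->] := MVT1 dG (_ : x i <= x i.+1).
  by rewrite -subr_ge0 xS ltW.
rewrite xS mulrC -mulrBr normrM (gtr0_norm k0).
apply: ler_wpM2l; first exact: ltW.
apply: H; rewrite ger0_norm ?subr_ge0 //; have := xS i; lra.
Qed.

End OneDim.
Notation primitive G g := (forall t, is_derive t 1 G (g t)).

(* Opaque copy: at a concrete dimension the fixpoint [integralRd] would be
   unfolded by conversion checks. *)
Fact rint_key (R : realType) (d : nat) :
  {I : ('rV[R]_d -> R) -> R | I = @integralRd R d}.
Proof. by exists (@integralRd R d). Qed.

Definition rint {R : realType} {d : nat} := sval (@rint_key R d).

Lemma rintE R d : @rint R d = @integralRd R d.
Proof. exact: svalP (rint_key R d). Qed.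

(** * Integration over row vectors by slicing off the first coordinate *)

Section RowIntegral.
Context {R : realType}.
Implicit Types (d : nat).

Definition ucc d (L : R) (f : 'rV[R]_d -> R) : Prop :=
  [/\ 0 < L, (forall e : R, 0 < e -> exists2 h : R, 0 < h & forall x y, `|x - y| < h -> `|f x - f y| < e)
    & forall x, L <= `|x| -> f x = 0].

Definition consr d (t : R) (y : 'rV[R]_d) : 'rV[R]_d.+1 := row_mx (t%:M : 'rV[R]_1) y.

Lemma consr0 d t (y : 'rV[R]_d) : consr t y 0 0 = t.
Proof.
have -> : (0 : 'I_d.+1) = lshift d (0 : 'I_1) by apply: val_inj.
by rewrite /consr (@row_mxEl _ 1 1 d) mxE eqxx mulr1n.
Qed.

Lemma consrS d t (y : 'rV[R]_d) (i : 'I_d) : consr t y 0 (lift ord0 i) = y 0 i.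
Proof.
have -> : lift ord0 i = rshift 1 i :> 'I_d.+1 by apply: val_inj.
by rewrite /consr (@row_mxEr _ 1 1 d).
Qed.

Lemma consrB d s t (x y : 'rV[R]_d) : consr s x - consr t y = consr (s - t) (x - y).
Proof.
apply/rowP => i; rewrite [LHS]mxE [X in _ + X]mxE.
by case: (unliftP ord0 i) => [j|] ->; rewrite ?consrS ?consr0 ?mxE.
Qed.

Lemma consrD d s t (x y : 'rV[R]_d) : consr s x + consr t y = consr (s + t) (x + y).
Proof.
by apply/rowP => i; rewrite [LHS]mxE; case: (unliftP ord0 i) => [j|] ->;
  rewrite ?consrS ?consr0 ?mxE.
Qed.

Lemma norm_consr_ge0 d t (y : 'rV[R]_d) : `|t| <= `|consr t y|.
Proof. by rewrite -{1}(consr0 t y); apply: coord_le_norm. Qed.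

Lemma norm_consr_geS d t (y : 'rV[R]_d) : `|y| <= `|consr t y|.
Proof. by apply: norm_row_le => // i; rewrite -(consrS t y); apply: coord_le_norm. Qed.

Lemma norm_consr_le d t (y : 'rV[R]_d) M : 0 <= M -> `|t| <= M -> `|y| <= M -> `|consr t y| <= M.
Proof.
move=> M0 tM yM; apply: norm_row_le => // i.
case: (unliftP ord0 i) => [j|] ->; rewrite ?consrS ?consr0 //.
by apply: le_trans yM; apply: coord_le_norm.
Qed.

Lemma norm_consr_lt d t (y : 'rV[R]_d) M : `|t| < M -> `|y| < M -> `|consr t y| < M.
Proof.
move=> tM yM; apply: norm_row_lt; first exact: le_lt_trans tM.
move=> i; case: (unliftP ord0 i) => [j|] ->; rewrite ?consrS ?consr0 //.
by apply: le_lt_trans yM; apply: coord_le_norm.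
Qed.

Lemma rintS d (f : 'rV[R]_d.+1 -> R) :
  rint f = (\int[@lebesgue_measure R]_(t in [set: R]) rint (fun y => f (consr t y)))%R.
Proof. by rewrite !rintE. Qed.

Lemma rint0 (f : 'rV[R]_0 -> R) : rint f = f 0.
Proof. by rewrite rintE. Qed.

Lemma ucc_lin d L c (f g : 'rV[R]_d -> R) : ucc L f -> ucc L g ->
  ucc L (fun x => c * f x + g x).
Proof.
move=> [L0 uf zf] [_ ug zg]; split=> //; last by move=> x Lx; rewrite zf ?zg // mulr0 addr0.
move=> e e0; have e2 : 0 < e / 2 by rewrite divr_gt0.
have c0 : 0 < `|c| + 1 by rewrite ltr_wpDl.
have e3 : 0 < e / 2 / (`|c| + 1) by rewrite divr_gt0.
have [h1 h10 H1] := uf _ e3; have [h2 h20 H2] := ug _ e2.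
exists (Num.min h1 h2); first by rewrite lt_min h10.
move=> x y; rewrite lt_min => /andP[/H1 p1 /H2 p2].
have -> : c * f x + g x - (c * f y + g y) = c * (f x - f y) + (g x - g y) by ring.
rewrite [e]splitr; apply: le_lt_trans (ler_normD _ _) _; apply: ler_ltD => //.
rewrite normrM; apply: le_trans (_ : (`|c| + 1) * (e / 2 / (`|c| + 1)) <= _); last first.
  by rewrite mulrC divfK // lt0r_neq0.
by apply: ler_pM => //; rewrite ?lerDl // ltW.
Qed.

Lemma ucc_slice d L (f : 'rV[R]_d.+1 -> R) t : ucc L f -> ucc L (fun y => f (consr t y)).
Proof.
move=> [L0 u z]; split=> //.
  move=> e /u [h h0 H]; exists h => // x y xy; apply: H.
  by rewrite consrB subrr; apply: norm_consr_lt => //; rewrite normr0.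
by move=> x Lx; apply: z; apply: le_trans Lx (norm_consr_geS _ _).
Qed.

Lemma ucc_wide d L M (f : 'rV[R]_d -> R) : L <= M -> ucc L f -> ucc M f.
Proof.
move=> LM [L0 u z]; split=> //; first exact: lt_le_trans LM.
by move=> x /(le_trans LM); apply: z.
Qed.

Lemma ucc_shift d L (f : 'rV[R]_d -> R) a : ucc L f -> ucc (L + `|a|) (fun x => f (x + a)).
Proof.
move=> [L0 u z]; split; first by rewrite ltr_wpDr.
  move=> e /u [h h0 H]; exists h => // x y xy; apply: H.
  by rewrite opprD addrACA subrr addr0.
move=> x Lx; apply: z; rewrite -(lerD2r `|a|); apply: le_trans Lx _.
by rewrite -[in X in X <= _](addrK a x) ler_normB.
Qed.

Definition int_linear d := forall L c (f g : 'rV[R]_d -> R), ucc L f -> ucc L g ->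
  rint (fun x => c * f x + g x) = c * rint f + rint g.

(** The majorant is a product of one-variable functions, so its integral over a cube is a power.
    Taking [m] constant gives the volume bound; taking for [M] a scaled arctangent gives a bound
    independent of the scale, as needed for an approximate identity. *)
Definition int_majorized d :=
  forall L (f : 'rV[R]_d -> R) (m M : R -> R) A, ucc L f ->
  (forall t : R, is_derive t (1 : R) M (m t)) -> (forall t, 0 <= m t) -> 0 <= A ->
  (forall x, `|x| <= L -> `|f x| <= A * \prod_i m (x 0 i)) ->
  `|rint f| <= A * (M L - M (- L)) ^+ d.

Lemma int_majorized_cst d : int_majorized d -> forall L (f : 'rV[R]_d -> R) e,
  ucc L f -> 0 <= e -> (forall x, `|f x| <= e) -> `|rint f| <= e * (2 * L) ^+ d.
Proof.
move=> IHm L f e u e0 H; have -> : 2 * L = id L - id (- L) by rewrite /=; ring.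
apply: (IHm L f (fun=> 1)) => // x _.
by rewrite big1 ?mulr1.
Qed.

Lemma int_slice d : int_linear d -> int_majorized d -> forall L (f : 'rV[R]_d.+1 -> R),
  ucc L f -> uc1 L (fun t => rint (fun y => f (consr t y))).
Proof.
move=> IHl IHm; have bd := int_majorized_cst IHm => L f uf; have [L0 u z] := uf.
have z0 : rint (fun _ : 'rV[R]_d => 0 : R) = 0.
  have u0 : ucc L (fun _ : 'rV[R]_d => 0 : R).
    by split=> // e e0; exists 1 => // x y _; rewrite subrr normr0.
  have : `|rint (fun _ : 'rV[R]_d => 0 : R)| <= 0 * (2 * L) ^+ d.
    by apply: bd => // x; rewrite normr0.
  by rewrite mul0r normr_le0 => /eqP.
split=> //.
  move=> e e0; have k0 : 0 < (2 * L) ^+ d by rewrite exprn_gt0 // mulr_gt0.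
  have e2 : 0 < e / 2 / (2 * L) ^+ d by rewrite !divr_gt0.
  have [h h0 H] := u _ e2; exists h => // s t st.
  have -> : rint (fun y => f (consr s y)) - rint (fun y => f (consr t y)) =
     rint (fun y => -1 * f (consr t y) + f (consr s y)).
    by rewrite (IHl L) ?mulN1r 1?addrC //; exact: ucc_slice.
  apply: le_lt_trans (_ : e / 2 / (2 * L) ^+ d * (2 * L) ^+ d < e); last first.
    rewrite divfK ?lt0r_neq0 //; lra.
  apply: bd => [||y]; [|exact: ltW|].
    by apply: ucc_lin; apply: ucc_slice.
  rewrite mulN1r addrC; apply/ltW/H.
  by rewrite consrB subrr; apply: norm_consr_lt; rewrite ?normr0.
move=> t Lt; rewrite -[RHS]z0; congr rint; apply/funext => y; apply: z.
exact: le_trans Lt (norm_consr_ge0 _ _).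
Qed.

(** The two properties advance together: uniform continuity of the slice integrals in dimension
    [d.+1] uses both of them in dimension [d], and the one-variable results apply only to such slice
    integrals. *)
Lemma integral_lin_maj d : int_linear d /\ int_majorized d.
Proof.
elim: d => [|d [IHl IHm]].
  split=> [L c f g _ _|L f m M A [L0 _ _] _ _ A0 H]; rewrite !rint0 //.
  by have := H 0; rewrite normr0 ltW // => /(_ isT); rewrite big_ord0 expr0.
split.
  move=> L c f g uf ug; rewrite !rintS.
  have E : (fun t => rint (fun y => c * f (consr t y) + g (consr t y))) =
     (fun t => c * rint (fun y => f (consr t y)) + rint (fun y => g (consr t y))).
    by apply/funext => t; rewrite (IHl L) //; apply: ucc_slice.
  rewrite E; apply: int1_lin (int_slice IHl IHm uf) (int_slice IHl IHm ug) _.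
  by rewrite -E; apply: (int_slice IHl IHm (f := fun x => c * f x + g x)); apply: ucc_lin.
move=> L f m M A uf dM m0 A0 H; rewrite rintS exprSr mulrA.
have [L0 _ _] := uf.
have ML : 0 <= M L - M (- L).
  by rewrite subr_ge0; apply: primitive_le dM _ _ => //; lra.
apply: (int1_maj (int_slice IHl IHm uf) dM) => t tL.
have tL' : `|t| <= L by rewrite ler_norml.
apply: le_trans (IHm L _ m M (A * m t) (ucc_slice _ uf) dM m0 _ _) _.
- by rewrite mulr_ge0.
- move=> y yL; apply: le_trans (H _ (norm_consr_le (ltW L0) tL' yL)) _.
  rewrite big_ord_recl consr0 mulrA le_eqVlt; apply/orP; left; apply/eqP; congr (_ * _).
  by apply: eq_bigr => i _; rewrite consrS.
by rewrite mulrAC.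
Qed.

Lemma integral_lin d L c (f g : 'rV[R]_d -> R) : ucc L f -> ucc L g ->
  rint (fun x => c * f x + g x) = c * rint f + rint g.
Proof. by apply: (integral_lin_maj d).1. Qed.

Lemma integral_maj d : int_majorized d.
Proof. exact: (integral_lin_maj d).2. Qed.

Lemma integral_bound d L (f : 'rV[R]_d -> R) e :
  ucc L f -> 0 <= e -> (forall x, `|f x| <= e) -> `|rint f| <= e * (2 * L) ^+ d.
Proof. by apply: int_majorized_cst; apply: integral_maj. Qed.

Lemma uc1_slice d L (f : 'rV[R]_d.+1 -> R) :
  ucc L f -> uc1 L (fun t => rint (fun y => f (consr t y))).
Proof. by case: (integral_lin_maj d) => H1 H2; apply: int_slice. Qed.

Lemma integral_low d L (f : 'rV[R]_d -> R) (m e : R) : ucc L f -> 0 <= e <= L -> 0 <= m ->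
  (forall x, 0 <= f x) -> (forall x, `|x| <= e -> m <= f x) ->
  m * (2 * e) ^+ d <= rint f.
Proof.
move=> + eL m0; have /andP[e0 _] := eL; have e20 k : 0 <= m * (2 * e) ^+ k.
  by rewrite mulr_ge0 // exprn_ge0 // mulr_ge0.
elim: d f => [|d IH] f u f0 H.
  by rewrite expr0 mulr1 rint0; apply: H; rewrite normr0.
rewrite rintS exprSr mulrA; apply: int1_low (uc1_slice u) eL _ _.
  move=> t; have [L0 _ _] := u; have z0 : 0 <= (0 : R) <= L by rewrite lexx ltW.
  clear H IH.
  suff P k (g : 'rV[R]_k -> R) : ucc L g -> (forall x, 0 <= g x) -> 0 <= rint g.
    by apply: P => //; apply: ucc_slice.
  elim: k g => [|k IH] g ug g0; first by rewrite rint0; exact: g0.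
  rewrite rintS; have := int1_low (m := 0) (uc1_slice ug) z0; rewrite mul0r; apply.
    by move=> s; apply: IH => //; apply: ucc_slice.
  by move=> s _; apply: IH => //; apply: ucc_slice.
move=> t te; apply: IH => //; first exact: ucc_slice.
by move=> y ye; apply: H; apply: norm_consr_le.
Qed.

Lemma uc1_shift L (g : R -> R) a : uc1 L g -> uc1 (L + `|a|) (fun t => g (t + a)).
Proof.
move=> [L0 u z]; split; first by rewrite ltr_wpDr.
  move=> e /u [h h0 H]; exists h => // x y xy; apply: H.
  by rewrite opprD addrACA subrr addr0.
move=> x Lx; apply: z; rewrite -(lerD2r `|a|); apply: le_trans Lx _.
by rewrite -[in X in X <= _](addrK a x) ler_normB.
Qed.

Lemma integral_shift d L (f : 'rV[R]_d -> R) a : ucc L f ->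
  rint (fun x => f (x + a)) = rint f.
Proof.
elim: d f a => [|d IH] f a u.
  by rewrite !rint0; congr f; apply/rowP => -[].
rewrite !rintS.
pose a0 := a 0 0; pose a' : 'rV[R]_d := \row_i a 0 (lift ord0 i).
have aE : a = consr a0 a'.
  by apply/rowP => i; case: (unliftP ord0 i) => [j|] ->; rewrite ?consrS ?consr0 ?mxE.
have E : (fun t => rint (fun y => f (consr t y + a))) =
    (fun t => rint (fun y => f (consr (t + a0) y))).
  apply/funext => t; rewrite -(IH _ a' (ucc_slice (t + a0) u)); congr rint.
  by apply/funext => y; rewrite {1}aE consrD.
rewrite E; apply: (int1_shift (L := L) (g := fun t => rint (fun y => f (consr t y)))).
  exact: uc1_slice.
exact: uc1_shift (uc1_slice u).
Qed.

(** Tensor product of one-variable rules. The slice integrals have modulus [K * e], which gives the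
    first summand of the constant; the inner rule gives the second, weighted by the total mass
    [2 * L] of the outer one. *)
Lemma integral_quad d (L : R) : 0 < L -> exists2 C : R, 0 <= C &
  forall h : R, 0 < h -> exists r : seq (R * 'rV[R]_d), forall f (e : R), ucc L f -> 0 <= e ->
    (forall x y, `|x - y| <= h -> `|f x - f y| <= e) ->
    `|rint f - \sum_(p <- r) p.1 * f p.2| <= C * e.
Proof.
move=> L0; elim: d => [|d [C C0 IHd]].
  exists 0 => // h _; exists [:: (1, 0)] => f e u e0 H.
  by rewrite big_seq1 mul1r mul0r rint0 subrr normr0.
pose K := (2 * L) ^+ d; have K0 : 0 <= K by rewrite exprn_ge0 // mulr_ge0 // ltW.
exists (2 * L * K + 2 * L * C).
  by rewrite addr_ge0 // mulr_ge0 // mulr_ge0 // ltW.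
move=> h h0; have [q Hq] := int1_quad L0 h0; have [r IH] := IHd h h0.
exists [seq (p.1 * p'.1, consr p.2 p'.2) | p <- q, p' <- r] => f e u e0 H; rewrite rintS.
have Hg s t : `|s - t| <= h -> `|rint (fun y => f (consr s y)) - rint (fun y => f (consr t y))| <= K * e.
  move=> st; have -> : rint (fun y => f (consr s y)) - rint (fun y => f (consr t y)) =
     rint (fun y => -1 * f (consr t y) + f (consr s y)).
    by rewrite (integral_lin (L := L)) ?mulN1r 1?addrC //; exact: ucc_slice.
  rewrite mulrC; apply: integral_bound => // [|y]; first by apply: ucc_lin; apply: ucc_slice.
  rewrite mulN1r addrC; apply: H.
  by rewrite consrB subrr; apply: norm_consr_le; rewrite ?normr0 // ltW.
have [q0 qL Hqe] := Hq _ _ (uc1_slice u) Hg.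
rewrite big_allpairs_dep.
apply: le_trans (ler_distD (\sum_(p <- q) p.1 * rint (fun y => f (consr p.2 y))) _ _) _.
rewrite mulrDl; apply: lerD; first by rewrite -mulrA.
rewrite -sumrB; apply: le_trans (ler_norm_sum _ _ _) _.
rewrite -qL -mulrA mulr_suml !big_seq; apply: ler_sum => p pq /=.
have -> : \sum_(j <- r) p.1 * j.1 * f (consr p.2 j.2) =
   p.1 * \sum_(j <- r) j.1 * f (consr p.2 j.2).
  by rewrite mulr_sumr; apply: eq_bigr => j _; rewrite mulrA.
rewrite -mulrBr normrM (ger0_norm (q0 _ pq)); apply: ler_wpM2l; first exact: q0.
apply: IH => //; first exact: ucc_slice.
move=> x y xy; apply: H; rewrite consrB subrr; apply: norm_consr_le => //.
  exact: ltW.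
by rewrite normr0 ltW.
Qed.

End RowIntegral.

(** * Test functions and integration by parts *)

Section ByParts.
Context {R : realType} {d : nat}.
Implicit Types (f phi : 'rV[R]_d -> R) (W : set 'rV[R]_d) (x y : 'rV[R]_d).

(** Continuity is required at points of [A] only, while [y] may leave [A]; the lemma is thus
    applicable to kernels with singularities off [A]. Compactness is used in its near-covering form,
    along the filter of small positive radii. *)
Lemma heine (A : set 'rV[R]_d) f (e : R) : compact A -> 0 < e ->
  (forall x, A x -> {for x, continuous f}) ->
  exists2 h : R, 0 < h & forall x y, A x -> `|y - x| < h -> `|f y - f x| < e.
Proof.
move=> /compact_near_coveringP cA e0 cf.
pose P (h : R) x := forall y, `|y - x| < h -> `|f y - f x| < e.
have [x Ax|] := cA R (0 : R)^'+ P _.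
  have e2 : 0 < e / 2 by rewrite divr_gt0.
  have [r r0 Hr] := (cont_rowP _ _).1 (cf x Ax) _ e2.
  have r2 : 0 < r / 2 by rewrite divr_gt0.
  exists ([set y | `|y - x| < r / 2], [set h | h < r / 2]).
    split=> /=; first by apply/nbhs_rowP; exists (r / 2).
    exact: nbhs_right_lt.
  move=> [y h] /= [yx hr] z zy.
  have zx : `|z - x| < r.
    apply: le_lt_trans (ler_distD y _ _) _; rewrite [r]splitr; apply: ltrD => //.
    exact: lt_trans zy hr.
  have yx' : `|y - x| < r by apply: lt_trans yx _; rewrite ltr_pdivrMr // ltr_pMr // ltr1n.
  apply: le_lt_trans (ler_distD (f x) _ _) _; rewrite [e]splitr; apply: ltrD.
    exact: Hr.
  by rewrite distrC; apply: Hr.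
move=> h /= h0 H; exists (h / 2); first by rewrite divr_gt0.
move=> x y Ax yx; apply: (H (h / 2) _ _ x Ax y yx) => /=.
  rewrite sub0r normrN gtr0_norm ?divr_gt0 // ltr_pdivrMr // ltr_pMr // ltr1n //.
by rewrite divr_gt0.
Qed.

Lemma compact_ball (M : R) : compact [set x : 'rV[R]_d | `|x| <= M].
Proof.
apply: bounded_closed_compact.
  exists M; split; first exact: num_real.
  by move=> N MN x /= xM; apply: le_trans xM (ltW MN).
apply: (@closed_comp _ _ (fun x : 'rV[R]_d => `|x|) [set t | t <= M]).
  by move=> x _; exact: norm_continuous.
exact: closed_le.
Qed.

Lemma continuous_ucc L f : 0 < L -> continuous f -> (forall x, L <= `|x| -> f x = 0) -> ucc L f.
Proof.
move=> L0 cf z; split=> // e e0.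
have [h h0 H] := heine (@compact_ball L) e0 (fun x _ => cf x).
exists h => // x y xy.
have [yL|yL] := leP `|y| L; first exact: H.
have [xL|xL] := leP `|x| L; first by rewrite distrC; apply: H => //; rewrite distrC.
by rewrite !z ?subrr ?normr0 // ltW.
Qed.

(* Test functions, with the support condition in the form used by [ucc]. *)
Definition tf phi := smooth setT phi /\ exists2 L : R, 0 < L & forall x, L <= `|x| -> phi x = 0.

Lemma tf_smooth phi : tf phi -> smooth setT phi.
Proof. by case. Qed.

Lemma tf_ucc phi : tf phi -> exists L, ucc L phi.
Proof.
move=> [s [L L0 z]]; exists L; apply: continuous_ucc => // x.
exact: smooth_continuous s _.
Qed.

Lemma tf_ucc_large phi M : tf phi -> exists2 L, M <= L & ucc L phi.
Proof.
move=> /tf_ucc [L u]; exists (Num.max L M); first by rewrite le_max lexx orbT.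
by apply: ucc_wide u; rewrite le_max lexx.
Qed.

Lemma tf_zero_dword phi L s : (forall x, L <= `|x| -> phi x = 0) ->
  forall x, L + 1 <= `|x| -> D s phi x = 0.
Proof.
move=> z x Lx; have oW : open [set x : 'rV[R]_d | L < `|x|].
  apply: (@open_comp _ _ (fun x : 'rV[R]_d => `|x|) [set t | L < t]).
    by move=> y _; exact: norm_continuous.
  exact: open_gt.
have Wx : L < `|x| by lra.
rewrite (dword_local s oW (g := fun=> 0)) //; last by move=> y /= /ltW; apply: z.
by case: s => // i s; rewrite dword_cst.
Qed.

Lemma tf_dword phi s : tf phi -> tf (D s phi).
Proof.
move=> [sp [L L0 z]]; split; first exact: smooth_dword.
exists (L + 1); first lra.
exact: tf_zero_dword.
Qed.

Lemma tf_pd phi i : tf phi -> tf (pd i phi).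
Proof. exact: (tf_dword [:: i]). Qed.

Lemma tf_lin c phi psi : tf phi -> tf psi -> tf (fun x => c * phi x + psi x).
Proof.
move=> [sp [L L0 z]] [sp' [L' L0' z']]; split; first by apply: smooth_lin => //; exact: openT.
exists (Num.max L L'); first by rewrite lt_max L0.
by move=> x; rewrite ge_max => /andP[/z -> /z' ->]; rewrite mulr0 addr0.
Qed.

Lemma tf0 : tf (fun=> 0).
Proof. by split; [exact: smooth_const | exists 1]. Qed.

Lemma tf_scale c phi : tf phi -> tf (fun x => c * phi x).
Proof.
move=> tp; have -> : (fun x => c * phi x) = (fun x => c * phi x + 0) by apply/funext => x; rewrite addr0.
by apply: tf_lin => //; exact: tf0.
Qed.

Lemma tf_add phi psi : tf phi -> tf psi -> tf (fun x => phi x + psi x).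
Proof.
move=> tp tq; have -> : (fun x => phi x + psi x) = (fun x => 1 * phi x + psi x).
  by apply/funext => x; rewrite mul1r.
exact: tf_lin.
Qed.

Lemma tf_sum (I : Type) (r : seq I) (F : I -> 'rV[R]_d -> R) :
  (forall i, tf (F i)) -> tf (fun x => \sum_(i <- r) F i x).
Proof.
move=> H; elim: r => [|i r IH]; first by under eq_fun do rewrite big_nil; exact: tf0.
by under eq_fun do rewrite big_cons; apply: tf_add.
Qed.

Lemma tf_int_lin c phi psi : tf phi -> tf psi ->
  rint (fun x => c * phi x + psi x) = c * rint phi + rint psi.
Proof.
move=> tp tq; have [L up] := tf_ucc tp; have [L' uq] := tf_ucc tq.
apply: (integral_lin (L := Num.max L L')).
  by apply: ucc_wide up; rewrite le_max lexx.
by apply: ucc_wide uq; rewrite le_max lexx orbT.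
Qed.

Lemma le_small (a K : R) : 0 <= K -> (forall e : R, 0 < e -> a <= K * e) -> a <= 0.
Proof.
move=> K0 H; rewrite leNgt; apply/negP => a0.
have K1 : 0 < K + 1 by rewrite ltr_wpDl.
have e0 : 0 < a / 2 / (K + 1) by rewrite !divr_gt0.
have := H _ e0; apply/negP; rewrite -ltNge.
have : (K + 1) * (a / 2 / (K + 1)) < a by rewrite mulrC divfK ?lt0r_neq0 //; lra.
by apply: le_lt_trans; rewrite ler_pM2r // lerDl.
Qed.

(** By translation invariance a difference quotient of [F] has integral zero, and by the mean value
    theorem and the uniform continuity of [pd i F] it is uniformly close to [pd i F]. *)
Lemma integral_pd F i : tf F -> rint (pd i F) = 0.
Proof.
move=> tF; have [L uF] := tf_ucc tF; have [M LM uP] := tf_ucc_large (L + 1) (tf_pd i tF).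
have [M0 u _] := uP; have [L0 _ _] := uF; have sF := tf_smooth tF.
apply/eqP; rewrite -normr_le0; apply: (@le_small _ ((2 * M) ^+ d)).
  by rewrite exprn_ge0 // mulr_ge0 // ltW.
move=> e e0; have [h h0 H] := u _ e0.
pose k := Num.min h 1 / 2; have k0 : 0 < k by rewrite divr_gt0 // lt_min h0 ltr01.
have kh : k < h.
  by rewrite /k ltr_pdivrMr //; apply: le_lt_trans (_ : h < _); rewrite ?ge_min ?lexx //; lra.
have k1 : k <= 1 by rewrite /k ler_pdivrMr // mul1r ge_min orbC ler1n.
pose v := k *: delta_mx 0 i : 'rV[R]_d.
have v1 : `|v| <= 1.
  rewrite normrZ gtr0_norm //; apply: le_trans (ler_wpM2l (ltW k0) (norm_delta _)) _; lra.
have uF' : ucc M F by apply: ucc_wide uF; lra.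
have uv : ucc M (fun x => F (x + v)).
  by apply: ucc_wide (ucc_shift v uF); lra.
have Iv : rint (fun x => F (x + v)) = rint F by apply: integral_shift uF.
(* The added terms form minus the difference quotient with step [k], whose integral vanishes by
   [Iv]. *)
have E : rint (pd i F) =
    rint (fun x => k^-1 * F x + (- k^-1 * F (x + v) + pd i F x)).
  rewrite (integral_lin (L := M)) //; last exact: ucc_lin.
  by rewrite (integral_lin (L := M)) // Iv; ring.
rewrite E mulrC; apply: integral_bound; [|exact: ltW|].
  by apply: ucc_lin => //; apply: ucc_lin.
move=> x; have [|t /andP[t0 tk] Et] := @line_MVT _ _ F (pd i F) x (delta_mx 0 i) k k0.
  by move=> t _; apply: smooth_is_derive sF _.
have -> : k^-1 * F x + (- k^-1 * F (x + v) + pd i F x) = pd i F x - pd i F (t *: delta_mx 0 i + x).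
  apply/eqP; rewrite -subr_eq0; apply/eqP.
  have -> : pd i F (t *: delta_mx 0 i + x) = k^-1 * (F (v + x) - F x).
    by rewrite Et mulrC mulfK // lt0r_neq0.
  by rewrite [v + x]addrC; ring.
apply/ltW/H; rewrite opprD addrCA subrr addr0 normrN normrZ gtr0_norm //.
apply: le_lt_trans (ler_wpM2l (ltW t0) (norm_delta _)) _; lra.
Qed.

Lemma pd_mul W f phi i x : smooth W f -> smooth W phi -> W x ->
  pd i (fun y => f y * phi y) x = f x * pd i phi x + phi x * pd i f x.
Proof.
move=> sf sp Wx; have ? := smooth_is_derive i sf Wx; have ? := smooth_is_derive i sp Wx.
by apply: pd_is_derive; exact: (@is_deriveM _ _ f phi).
Qed.

Lemma tsupp_closed phi : closed (tsupp phi).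
Proof. exact: closed_closure. Qed.

Lemma tsupp_out phi x : ~ tsupp phi x -> phi x = 0.
Proof.
by move=> H; apply/eqP; apply: contra_notT H => H; apply: subset_closure.
Qed.

Lemma tsupp_open phi : open (~` tsupp phi).
Proof. exact/closed_openC/tsupp_closed. Qed.

Lemma dword_tsupp_out phi s x : ~ tsupp phi x -> D s phi x = 0.
Proof.
move=> H; rewrite (dword_local s (@tsupp_open phi) (g := fun=> 0)) //.
  by case: s => // i s; rewrite dword_cst.
by move=> y; exact: tsupp_out.
Qed.

Lemma tsupp_dword phi s : tsupp (D s phi) `<=` tsupp phi.
Proof.
rewrite {1}/tsupp closureE; apply: smallest_sub; first exact: tsupp_closed.
by move=> x /= /eqP Hx; apply: contrapT => /dword_tsupp_out.
Qed.

(** The space is covered by [W] and the complement of the support; on the latter the product is zero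
    whatever values [f] has. *)
Lemma smooth_mul_tsupp W f phi : open W -> smooth W f -> smooth setT phi -> tsupp phi `<=` W ->
  smooth setT (fun x => f x * phi x).
Proof.
move=> oW sf sp tW; have -> : setT = W `|` ~` tsupp phi.
  apply/seteqP; split=> // x _; have [xp|xp] := pselect (tsupp phi x); [left; exact: tW | by right].
apply: smooth_union.
  by apply: smooth_mul => //; exact: smooth_sub sp.
apply: (smooth_local (f := fun=> 0)); [exact: tsupp_open | | exact: smooth_const].
by move=> x /tsupp_out ->; rewrite mulr0.
Qed.

Lemma tf_mul_tsupp W f phi : open W -> smooth W f -> tf phi -> tsupp phi `<=` W ->
  tf (fun x => f x * phi x).
Proof.
move=> oW sf [sp [L L0 z]] tW; split; first exact: smooth_mul_tsupp tW.
by exists L => // x /z ->; rewrite mulr0.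
Qed.

Lemma by_parts1 W f phi i : open W -> smooth W f -> tf phi -> tsupp phi `<=` W ->
  rint (fun x => f x * pd i phi x) = - rint (fun x => pd i f x * phi x).
Proof.
move=> oW sf tp tW; have tm := tf_mul_tsupp oW sf tp tW.
have t1 : tf (fun x => f x * pd i phi x).
  apply: (tf_mul_tsupp oW) => //; first exact: tf_pd.
  by move=> x /(@tsupp_dword phi [:: i]); exact: tW.
have t2 : tf (fun x => pd i f x * phi x).
  by apply: (tf_mul_tsupp oW) => //; exact: smooth_pd.
have E : pd i (fun x => f x * phi x) = (fun x => 1 * (f x * pd i phi x) + pd i f x * phi x).
  apply/funext => x; have [Wx|nWx] := pselect (W x).
    rewrite (pd_mul (W := W)) // ?mul1r 1?[phi x * _]mulrC //.
    exact: smooth_sub (tf_smooth tp).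
  have nx : ~ tsupp phi x by move=> /tW.
  rewrite (tsupp_out nx) [pd i phi x](@dword_tsupp_out phi [:: i]) // !mulr0 addr0.
  apply: (@dword_tsupp_out _ [:: i]) => H; apply: nx; move: x H {nWx}.
  apply: closure_subset => x /=; apply: contra_neq => ->; exact: mulr0.
have := integral_pd i tm; rewrite E tf_int_lin // mul1r => /eqP.
by rewrite addr_eq0 => /eqP.
Qed.

Lemma by_parts W f phi s : open W -> smooth W f -> tf phi -> tsupp phi `<=` W ->
  rint (fun x => f x * D s phi x) = (-1) ^+ size s * rint (fun x => D s f x * phi x).
Proof.
move=> oW sf tp tW; elim: s f sf => [|i s IH] f sf /=; first by rewrite mul1r.
rewrite (by_parts1 _ oW) //; first last.
- by move=> x /tsupp_dword; exact: tW.
- exact: tf_dword.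
rewrite IH; last exact: smooth_pd.
rewrite exprS mulN1r mulNr; congr (- (_ * rint _)); apply/funext => x.
have [Wx|nWx] := pselect (W x); last by rewrite (tsupp_out (contra_not (@tW x) nWx)) !mulr0.
congr (_ * _); rewrite -foldr_rcons -/(D (i :: s) f).
by apply: (dword_perm oW sf Wx); rewrite perm_rcons.
Qed.

Lemma test_fun_tf phi : test_fun phi -> tf phi.
Proof.
case=> sp cp; split; first by rewrite smoothE.
have [M [_ HM]] := compact_bounded cp.
pose L := Num.max M 0 + 1; have ML : M < L.
  by rewrite /L; apply: le_lt_trans (_ : M <= Num.max M 0) _; rewrite ?le_max ?lexx // ltrDl.
have L0 : 0 < L by rewrite ltr_wpDl // le_max lexx orbT.
exists (L + 1); first lra.
move=> x Lx; apply: tsupp_out => /(HM L ML x) /=; lra.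
Qed.

End ByParts.

(** * Cutoff functions *)

Section Flat.
Context {R : realType}.

(** The powers of 1/t are included to make the family closed under differentiation: [j] leads to
    [j.+1] and [j.+2], so smoothness is proved by induction on the order for all [j] at once. *)
Definition flat j (t : R) : R := if 0 < t then t^-1 ^+ j * expR (- t^-1) else 0.

Lemma flat_ge0 j t : 0 <= flat j t.
Proof.
by rewrite /flat; case: ifP => // t0; rewrite mulr_ge0 ?expR_ge0 // exprn_ge0 // invr_ge0 ltW.
Qed.

Lemma flat_gt0 t : 0 < t -> 0 < flat 0 t.
Proof. by move=> t0; rewrite /flat t0 mul1r expR_gt0. Qed.

Lemma flat_le0 j t : t <= 0 -> flat j t = 0.
Proof. by rewrite /flat ltNge => ->. Qed.

(** With s = 1/t the exponential series gives exp(s) >= s^(j+2) / (j+2)!. The two extra powers leave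
    the factor t^2, which makes the difference quotient at 0 tend to 0. *)
Lemma flat_bound j t : `|flat j t| <= (j.+2)`!%:R * t ^+ 2.
Proof.
rewrite ger0_norm ?flat_ge0 // /flat; case: ifP => [t0|_]; last first.
  by rewrite mulr_ge0 // sqr_ge0.
have s0 : 0 < t^-1 by rewrite invr_gt0.
have f0 : 0 < (j.+2)`!%:R :> R by rewrite ltr0n fact_gt0.
have e0 := expR_gt0 t^-1.
have := expR_ge1Dxn j.+1 (ltW s0) => H.
have H1 : t^-1 ^+ j.+2 <= (j.+2)`!%:R * expR t^-1.
  by rewrite mulrC -ler_pdivrMr //; lra.
rewrite expRN ler_pdivrMr //.
have -> : t^-1 ^+ j = t^-1 ^+ j.+2 * t ^+ 2.
  by rewrite -addn2 exprD -mulrA -exprMn mulVf ?expr1n ?mulr1 // lt0r_neq0.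
by rewrite [leRHS]mulrAC; apply: ler_wpM2r => //; exact: sqr_ge0.
Qed.

Lemma flat_is_derive j (t : R) : is_derive t (1 : R) (flat j) (flat j.+2 t - j%:R * flat j.+1 t).
Proof.
have [t0|t0|<-] := ltgtP 0 t.
- have dV : is_derive t (1 : R) (fun y : R => y^-1) (- t^-1 ^+ 2).
    have t1 : t != 0 by rewrite lt0r_neq0.
    apply: DeriveDef; first exact: derivableV.
    by rewrite deriveV // derive_id [_ *: _]mulr1 exprVn.
  have dE : is_derive t (1 : R) (fun y : R => expR (- y^-1)) (expR (- t^-1) * t^-1 ^+ 2).
    apply: is_derive1_comp; rewrite -[X in is_derive _ _ _ X]opprK.
    exact: (@is_deriveN _ _ _ (fun y : R => y^-1)).
  have dX := @is_deriveX _ _ (fun y : R => y^-1) j t 1 _ dV.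
  have := @is_deriveM _ _ _ _ t 1 _ _ dX dE.
  have N : \forall y \near t, ((fun y : R => y^-1) ^+ j * (fun y : R => expR (- y^-1))) y = flat j y.
    have : \forall y \near t, [set y | 0 < y] y by apply: open_nbhs_nbhs; split=> //; exact: open_gt.
    apply: filterS => y /= y0; rewrite /flat y0.
    have -> : ((fun y : R => y^-1) ^+ j * (fun y : R => expR (- y^-1))) y
      = ((fun y : R => y^-1) ^+ j) y * expR (- y^-1) by [].
    by rewrite exprfctE.
  move/(near_eq_is_derive N) => H; apply: is_derive_eq H _.
  rewrite /flat t0 exprfctE /GRing.scale /=; case: (j) => [|k] /=; first by rewrite expr0; ring.
  by rewrite !exprS; ring.
- have N : \forall y \near t, (fun=> 0) y = flat j y.
    have : \forall y \near t, [set y | y < 0] y by apply: open_nbhs_nbhs; split=> //; exact: open_lt.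
    by apply: filterS => y /= y0; rewrite flat_le0 // ltW.
  apply: is_derive_eq; first by apply: (near_eq_is_derive N); exact: is_derive_cst.
  by rewrite !flat_le0 ?mulr0 ?subr0 // ltW.
- have L : h^-1 *: ((flat j \o shift 0) (h *: (1 : R)) - flat j 0) @[h --> 0^'] --> (0 : R).
    have C0 : 0 < (j.+2)`!%:R :> R by rewrite ltr0n fact_gt0.
    apply/cvgrPdist_lt => e e0; have r0 : 0 < e / (j.+2)`!%:R by rewrite divr_gt0.
    exists (e / (j.+2)`!%:R) => //= h; rewrite /ball_ /= !sub0r !normrN => hr h0.
    rewrite (flat_le0 j (lexx 0)) subr0 addr0 [h *: 1]mulr1.
    have hp : 0 < `|h| by rewrite normr_gt0.
    rewrite [_ *: _]mulrC normrM normfV ltr_pdivrMr //.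
    apply: le_lt_trans (flat_bound j h) _; rewrite -real_normK ?num_real // expr2 mulrA.
    by rewrite ltr_pM2r // mulrC -ltr_pdivlMr.
  apply: DeriveDef; first by apply/cvg_ex; exists 0.
  by rewrite /derive (cvg_lim _ L) // !flat_le0 // mulr0 subr0.
Qed.

End Flat.

Section Compositions.
Context {R : realType} {d : nat}.
Implicit Types (f g : 'rV[R]_d -> R) (W : set 'rV[R]_d) (x y : 'rV[R]_d).

Lemma smooth_flat W f j : open W -> smooth W f -> smooth W (fun x => flat j (f x)).
Proof.
move=> oW /smoothP sf; apply/smoothP => n.
have c k x : W x -> {for x, continuous (fun x => flat k (f x))}.
  move=> Wx; apply: continuous_comp; first exact: (Cn_cont (sf 0%N)).
  by apply/differentiable_continuous/derivable1_diffP; case: (flat_is_derive k (f x)).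
elim: n j => [|n IH] j; first by split=> // x; exact: c.
apply: (@Cn_intro _ _ _ _ _ (fun i x => (- j%:R * flat j.+1 (f x) + flat j.+2 (f x)) * pd i f x)) => //.
- by move=> x; exact: c.
- move=> x i Wx; apply: is_derive_eq; first apply: is_derive_comp1 (flat_is_derive _ _).
    exact: Cn_is_derive (sf 1%N) Wx.
  by congr (_ * _); ring.
- by move=> i; apply: Cn_mul => //; [exact: Cn_lin | apply: Cn_pd].
Qed.

Lemma smooth_inv W f : open W -> (forall x, W x -> f x != 0) -> smooth W f ->
  smooth W (fun x => (f x)^-1).
Proof. by move=> oW f0 /smoothP sf; apply/smoothP => n; apply: Cn_inv. Qed.

Lemma sqrt_is_derive f x i l : 0 < f x -> is_derive x (delta_mx 0 i) f l ->
  is_derive x (delta_mx 0 i) (fun y => Num.sqrt (f y)) ((2 * Num.sqrt (f x))^-1 * l).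
Proof. by move=> f0 H; apply: is_derive_comp1 H (is_derive1_sqrt f0). Qed.

Lemma smooth_sqrt W f : open W -> (forall x, W x -> 0 < f x) -> smooth W f ->
  smooth W (fun x => Num.sqrt (f x)).
Proof.
move=> oW f0 /smoothP sf; apply/smoothP => n.
have c x : W x -> {for x, continuous (fun x => Num.sqrt (f x))}.
  move=> Wx; apply: continuous_comp; first exact: (Cn_cont (sf 0%N)).
  exact: sqrt_continuous.
elim: n => [|n IH]; first by split=> // x; exact: c.
apply: (@Cn_intro _ _ _ _ _ (fun i x => (2 * Num.sqrt (f x))^-1 * pd i f x)) => //.
- move=> x i Wx; apply: sqrt_is_derive; first exact: f0.
  exact: Cn_is_derive (sf 1%N) Wx.
- move=> i; apply: Cn_mul => //; last exact: Cn_pd.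
  apply: Cn_inv => //.
    by move=> x Wx; rewrite mulf_neq0 // lt0r_neq0 // sqrtr_gt0 f0.
  by apply: Cn_mul => //; exact: Cn_cst.
Qed.

(** The norm on row vectors is the sup norm, which is not smooth; the squared Euclidean distance
    takes its place wherever derivatives are involved. *)
Definition sqd (a x : 'rV[R]_d) : R := \sum_i (x 0 i - a 0 i) ^+ 2.

Lemma sqd_ge0 a x : 0 <= sqd a x.
Proof. by apply: sumr_ge0 => i _; exact: sqr_ge0. Qed.

Lemma smooth_sqd W a : open W -> smooth W (sqd a).
Proof.
move=> oW; apply: smooth_sum => // i.
have E : smooth W (fun x => x 0 i - a 0 i).
  by apply: smooth_sub2 => //; [exact: smooth_coord | exact: smooth_const].
by apply: smooth_mul.
Qed.

Lemma sqd_norm a x : `|x - a| ^+ 2 <= sqd a x.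
Proof.
have S i : `|(x - a) 0 i| ^+ 2 <= sqd a x.
  rewrite real_normK ?num_real // !mxE /sqd (bigD1 i) //= lerDl.
  by apply: sumr_ge0 => j _; exact: sqr_ge0.
have E : `|x - a| <= Num.sqrt (sqd a x).
  apply: norm_row_le => [|i]; first exact: sqrtr_ge0.
  by rewrite -[X in X <= _]normr_id -sqrtr_sqr ler_sqrt // sqd_ge0.
by rewrite -[leRHS]sqr_sqrtr ?sqd_ge0 // lerXn2r // nnegrE // sqrtr_ge0.
Qed.

Lemma sqd_norm_le a x : sqd a x <= d%:R * `|x - a| ^+ 2.
Proof.
apply: (@le_trans _ _ (\sum_(i < d) `|x - a| ^+ 2)).
  apply: ler_sum => i _; rewrite -real_normK ?num_real // lerXn2r ?nnegrE //.
  by have := coord_le_norm (x - a) i; rewrite !mxE.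
by rewrite sumr_const card_ord mulr_natl.
Qed.

(** For [s > 0] the denominator is positive, since [2 * s - sqd a x] or [sqd a x - s] is. The value
    is 1 up to squared radius [s] and 0 from [2 * s] on. *)
Definition bumpf a (s : R) x : R :=
  flat 0 (2 * s - sqd a x) / (flat 0 (2 * s - sqd a x) + flat 0 (sqd a x - s)).

Section Bump.
Variables (a : 'rV[R]_d) (s : R).
Hypothesis s0 : 0 < s.

Lemma bumpf_den_gt0 x : 0 < flat 0 (2 * s - sqd a x) + flat 0 (sqd a x - s).
Proof.
have [H|H] := ltP (sqd a x) (2 * s).
  by rewrite ltr_wpDr ?flat_ge0 // flat_gt0 // subr_gt0.
by rewrite ltr_wpDl ?flat_ge0 // flat_gt0 //; have := s0; lra.
Qed.

Lemma bumpf_ge0 x : 0 <= bumpf a s x.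
Proof. by rewrite divr_ge0 ?flat_ge0 // ltW // bumpf_den_gt0. Qed.

Lemma bumpf_near x : sqd a x <= s -> bumpf a s x = 1.
Proof.
move=> H; have := bumpf_den_gt0 x; rewrite /bumpf [flat 0 (_ - s)]flat_le0 ?subr_le0 // addr0.
by move=> K; rewrite divff // lt0r_neq0.
Qed.

Lemma bumpf_far x : 2 * s <= sqd a x -> bumpf a s x = 0.
Proof. by move=> H; rewrite /bumpf flat_le0 ?mul0r // subr_le0. Qed.

Lemma smooth_bumpf W : open W -> smooth W (bumpf a s).
Proof.
move=> oW.
have S1 : smooth W (fun x => flat 0 (2 * s - sqd a x)).
  by apply: smooth_flat => //; apply: smooth_sub2 => //; [exact: smooth_const | exact: smooth_sqd].
have S2 : smooth W (fun x => flat 0 (sqd a x - s)).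
  by apply: smooth_flat => //; apply: smooth_sub2 => //; [exact: smooth_sqd | exact: smooth_const].
apply: smooth_mul => //; apply: smooth_inv => //; last exact: smooth_add.
by move=> x _; rewrite lt0r_neq0 // bumpf_den_gt0.
Qed.

Lemma tf_bumpf : tf (bumpf a s).
Proof.
split; first by apply: smooth_bumpf; exact: openT.
exists (`|a| + 2 * s + 1); first by rewrite ltr_wpDl // addr_ge0 // mulr_ge0 // ltW.
move=> x Hx; apply: bumpf_far; apply: le_trans (sqd_norm a x).
have H : 2 * s + 1 <= `|x - a|.
  by have := ler_normD (x - a) a; rewrite subrK => ?; lra.
have : 1 * `|x - a| <= `|x - a| * `|x - a| by apply: ler_wpM2r => //; have := s0; lra.
by rewrite mul1r -expr2; have := s0; lra.
Qed.

End Bump.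

Lemma cutoff (K Om : set 'rV[R]_d) : compact K -> open Om -> K `<=` Om ->
  exists (chi : 'rV[R]_d -> R) (N S : set 'rV[R]_d),
  [/\ smooth setT chi, open N, K `<=` N, forall x, N x -> chi x = 1 &
   [/\ compact S, S `<=` Om & forall x, ~ S x -> chi x = 0]].
Proof.
move=> cK oOm KO.
have [s Hs] : exists s : 'rV[R]_d -> R, forall a, K a -> 0 < s a /\
    forall x, sqd a x <= 2 * s a -> Om x.
  have H a : exists sa : R, K a -> 0 < sa /\ forall x, sqd a x <= 2 * sa -> Om x.
    have [Ka|nK] := pselect (K a); last by exists 0.
    have [r r0 Hr] := open_rowP oOm (KO a Ka).
    exists (r ^+ 2 / 4) => _; split; first by rewrite divr_gt0 // exprn_gt0.
    move=> x Hx; apply: Hr; rewrite ltNge; apply/negP => rx.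
    have : r ^+ 2 <= `|x - a| ^+ 2 by rewrite lerXn2r // nnegrE // ltW.
    have := sqd_norm a x; have : 0 < r ^+ 2 by rewrite exprn_gt0.
    lra.
  by exists (fun a => sval (cid (H a))) => a; apply: svalP (cid (H a)).
pose F a := [set x | sqd a x < s a].
have oF a : open (F a).
  apply: (@open_comp _ _ (sqd a) [set t | t < s a]); last exact: open_lt.
  by move=> x _; apply: smooth_continuous (smooth_sqd a openT) _.
have cov : K `<=` cover K F.
  move=> x Kx; exists x => //=; rewrite /F /= /sqd big1 ?(Hs x Kx).1 //.
  by move=> i _; rewrite subrr expr0n.
have cK' : cover_compact K by rewrite -compact_cover.
have := cK' => /(_ _ K F (fun a _ => oF a) cov) [D' D'K covD].
have [l [lP covl]] : exists l : seq 'rV[R]_d, (forall a, a \in l -> K a) /\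
    forall x, K x -> exists2 a, a \in l & sqd a x < s a.
  exists (enum_fset D'); split; first by move=> a /D'K /set_mem.
  by move=> x /covD [a aD xa]; exists a.
have open_eq (f : 'rV[R]_d -> R) (t : R) : smooth setT f -> open [set x | f x < t].
  move=> sf; apply: (@open_comp _ _ f [set u | u < t]); last exact: open_lt.
  by move=> x _; apply: smooth_continuous sf _.
(* Passing to the complement turns the gluing of bumps into a product: a single factor [1 - bumpf]
   forces zero on its ball, and the product is 1 off the union of the larger balls. *)
suff [chi [N [S [H1 H2 H3 H4 [H5 H6 H7]]]]] : exists (chi : 'rV[R]_d -> R) (N S : set 'rV[R]_d),
  [/\ smooth setT chi, open N, (forall x a, a \in l -> sqd a x < s a -> N x),
    forall x, N x -> chi x = 0 &
   [/\ compact S, S `<=` Om & forall x, ~ S x -> chi x = 1]].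
  exists (fun x => 1 - chi x), N, S; split=> //.
  - by apply: smooth_sub2 => //; [exact: openT | exact: smooth_const].
  - by move=> x /covl [a al xa]; exact: (H3 x a).
  - by move=> x /H4 ->; rewrite subr0.
  - by split=> // x /H7 ->; rewrite subrr.
elim: l lP {covl} => [|a l IH] lP.
  exists (fun=> 1), set0, set0; split=> //; first exact: smooth_const.
  by split=> //; exact: compact0.
have [|chi [N [S [H1 H2 H3 H4 [H5 H6 H7]]]]] := IH; first by move=> b bl; apply: lP; rewrite inE bl orbT.
have Ka : K a by apply: lP; rewrite inE eqxx.
have [sa0 sO] := Hs a Ka.
exists (fun x => (1 - bumpf a (s a) x) * chi x), (F a `|` N), ([set x | sqd a x <= 2 * s a] `|` S).
have sB := smooth_bumpf a sa0 openT.
split.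
- apply: smooth_mul => //; first exact: openT.
  by apply: smooth_sub2 => //; [exact: openT | exact: smooth_const].
- exact: openU.
- move=> x b; rewrite inE => /orP[/eqP -> xa|bl xb]; first by left.
  by right; apply: H3 xb.
- move=> x [xa|/H4 ->]; last by rewrite mulr0.
  by rewrite bumpf_near ?subrr ?mul0r // ltW.
split.
- apply: compactU => //; apply: bounded_closed_compact; last first.
    apply: (@closed_comp _ _ (sqd a) [set t | t <= 2 * s a]); last exact: closed_le.
    by move=> x _; apply: smooth_continuous (smooth_sqd a openT) _.
  exists (`|a| + 2 * s a + 1); split; first exact: num_real.
  move=> M LM x /= Hx; apply: le_trans (ltW LM); rewrite leNgt; apply/negP => Lx.
  suff : 2 * s a < sqd a x by rewrite ltNge Hx.
  apply: lt_le_trans (sqd_norm a x).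
  have H : 2 * s a + 1 <= `|x - a|.
    by have := ler_normD (x - a) a; rewrite subrK => ?; lra.
  have : 1 * `|x - a| <= `|x - a| * `|x - a| by apply: ler_wpM2r => //; lra.
  by rewrite mul1r -expr2; lra.
- by move=> x [/sO //|/H6].
move=> x /not_orP [xa xS]; rewrite H7 // bumpf_far ?subr0 ?mulr1 //.
by apply: ltW; rewrite ltNge; apply/negP.
Qed.

End Compositions.

(** * The fundamental solution of the bilaplacian *)

Section Laplacian.
Context {R : realType} {d : nat}.
Implicit Types (f phi : 'rV[R]_d -> R) (W : set 'rV[R]_d) (x y : 'rV[R]_d).

Definition lap f x : R := \sum_i D [:: i; i] f x.

Lemma lap_local W f g x : open W -> (forall x, W x -> f x = g x) -> W x -> lap f x = lap g x.
Proof. by move=> oW H Wx; apply: eq_bigr => i _; apply: dword_local Wx. Qed.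

Lemma smooth_lap W f : open W -> smooth W f -> smooth W (lap f).
Proof. by move=> oW sf; apply: smooth_sum => // i; exact: (smooth_dword [:: i; i] sf). Qed.

Lemma tf_lap phi : tf phi -> tf (lap phi).
Proof. by move=> tp; apply: tf_sum => i; exact: (tf_dword [:: i; i] tp). Qed.

Lemma lap_lin W (c : R) f g x : open W -> smooth W f -> smooth W g -> W x ->
  lap (fun x => c * f x + g x) x = c * lap f x + lap g x.
Proof.
move=> oW sf sg Wx; rewrite /lap mulr_sumr -big_split /=; apply: eq_bigr => i _.
exact: (dword_lin c [:: i; i] oW sf sg Wx).
Qed.

Lemma dword_lap W f s x : open W -> smooth W f -> W x ->
  D s (lap f) x = \sum_i D (s ++ [:: i; i]) f x.
Proof.
move=> oW sf Wx; rewrite (dword_sum (W := W)) //; last by move=> i; exact: (smooth_dword [:: i; i] sf).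
by apply: eq_bigr => i _; rewrite dword_cat.
Qed.

Lemma lap_shift f a x : lap (fun y => f (y - a)) x = lap f (x - a).
Proof. by apply: eq_bigr => i _; rewrite dword_shift. Qed.

Lemma tf_int0 : rint (fun _ : 'rV[R]_d => 0 : R) = 0.
Proof.
transitivity (rint (fun _ : 'rV[R]_d => -1 * 0 + 0 : R)).
  by congr rint; apply/funext => x; rewrite mulr0 addr0.
by rewrite (tf_int_lin _ (@tf0 R d) (@tf0 R d)) mulN1r addNr.
Qed.

Lemma tf_int_sum (I : Type) (r : seq I) (F : I -> 'rV[R]_d -> R) : (forall i, tf (F i)) ->
  rint (fun x => \sum_(i <- r) F i x) = \sum_(i <- r) rint (F i).
Proof.
move=> H; elim: r => [|i r IH].
  by rewrite big_nil; under eq_fun do rewrite big_nil; exact: tf_int0.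
rewrite big_cons -IH -[rint (F i)]mul1r -tf_int_lin //; last exact: tf_sum.
by congr rint; apply/funext => x; rewrite big_cons mul1r.
Qed.

Lemma by_parts_lap W f phi : open W -> smooth W f -> tf phi -> tsupp phi `<=` W ->
  rint (fun x => f x * lap phi x) = rint (fun x => lap f x * phi x).
Proof.
move=> oW sf tp tW.
have tD i : tsupp (D [:: i; i] phi) `<=` W by move=> x /tsupp_dword; exact: tW.
transitivity (rint (fun x => \sum_i f x * D [:: i; i] phi x)).
  by congr rint; apply/funext => x; rewrite mulr_sumr.
rewrite tf_int_sum; last by move=> i; apply: (tf_mul_tsupp oW) => //; exact: tf_dword.
transitivity (rint (fun x => \sum_i D [:: i; i] f x * phi x)); last first.
  by congr rint; apply/funext => x; rewrite mulr_suml.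
rewrite tf_int_sum; last first.
  by move=> i; apply: (tf_mul_tsupp oW) => //; exact: smooth_dword.
by apply: eq_bigr => i _; rewrite (by_parts _ oW) //= expr2 mulN1r opprK mul1r.
Qed.

Lemma tf_bounded phi : tf phi ->
  exists2 M : R, 0 <= M & forall y, `|phi y| <= M.
Proof.
move=> tp; have [L uL] := tf_ucc tp; have [_ _ z] := uL.
have cA : compact (phi @` [set x | `|x| <= L]).
  apply: continuous_compact; last exact: compact_ball.
  by apply: continuous_subspaceT => x; apply: smooth_continuous (tf_smooth tp) _.
have [M [_ HM]] := compact_bounded cA.
exists (`|M| + 1); first by rewrite addr_ge0.
move=> y; have [yL|yL] := leP `|y| L.
  apply: (HM (`|M| + 1)); first by apply: le_lt_trans (ler_norm _) _; rewrite ltrDl.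
  by exists y.
by rewrite z ?normr0 ?addr_ge0 // ltW.
Qed.

Lemma ucc_mul_tf f phi M : continuous f -> tf phi ->
  exists2 L, M <= L & ucc L (fun y => f y * phi y).
Proof.
move=> cf [sp [L L0 z]]; exists (Num.max L M); first by rewrite le_max lexx orbT.
apply: continuous_ucc; first by rewrite lt_max L0.
  move=> x; apply: (@continuousM _ _ f phi); [exact: cf | exact: smooth_continuous sp _].
by move=> x; rewrite ge_max => /andP[/z -> _]; rewrite mulr0.
Qed.

End Laplacian.

Section Kernel.
Context {R : realType}.
Local Notation V := 'rV[R]_3.
Implicit Types (x y : V) (c : R) (phi : V -> R).

(** The Euclidean norm, regularized by [c] under the root: [ker 0] is the norm itself, and for
    positive [c] the function is smooth everywhere. Its derivatives are polynomials in the
    coordinates and in the inverse [rho c], which keeps the computations algebraic. *)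
Definition ker c x : R := Num.sqrt (sqd 0 x + c).
Definition rho c x : R := (ker c x)^-1.
Definition kdom c : set V := [set x | 0 < sqd 0 x + c].

Lemma open_kdom c : open (kdom c).
Proof.
apply: (@open_comp _ _ (fun x => sqd 0 x + c) [set t | 0 < t]); last exact: open_gt.
move=> x _; apply: (smooth_continuous (W := setT)) => //.
by apply: smooth_add; [exact: openT | apply: smooth_sqd; exact: openT | exact: smooth_const].
Qed.

Lemma kdom_pos c : 0 < c -> kdom c = setT.
Proof. by move=> c0; apply/seteqP; split=> // x _; rewrite /kdom /= ltr_wpDl ?sqd_ge0. Qed.

Lemma ker_gt0 c x : kdom c x -> 0 < ker c x.
Proof. by rewrite /kdom /= sqrtr_gt0. Qed.

Lemma rho_gt0 c x : kdom c x -> 0 < rho c x.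
Proof. by rewrite invr_gt0; exact: ker_gt0. Qed.

Lemma ker_sqr c x : kdom c x -> ker c x ^+ 2 = sqd 0 x + c.
Proof. by move=> /ltW H; rewrite sqr_sqrtr. Qed.

Lemma smooth_kerarg c W : open W -> smooth W (fun x => sqd 0 x + c).
Proof. by move=> oW; apply: smooth_add => //; [exact: smooth_sqd | exact: smooth_const]. Qed.

Lemma smooth_ker c : smooth (kdom c) (ker c).
Proof.
by apply: smooth_sqrt; [exact: open_kdom | | apply: smooth_kerarg; exact: open_kdom].
Qed.

Lemma sqd_is_derive x i : is_derive x (delta_mx 0 i) (sqd 0) (2 * x 0 i).
Proof.
have H (j : 'I_3) : is_derive x (delta_mx 0 i) (fun y : V => (y 0 j - (0 : V) 0 j) ^+ 2) (2 * x 0 j * (i == j)%:R).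
  have h1 := coord_is_derive x i j.
  have -> : (fun y : V => (y 0 j - (0 : V) 0 j) ^+ 2) = (fun y : V => y 0 j * y 0 j).
    by apply/funext => y; rewrite mxE subr0 expr2.
  apply: is_derive_eq (@is_deriveM _ _ (fun y : V => y 0 j) (fun y : V => y 0 j) _ _ _ _ h1 h1) _.
  by rewrite /GRing.scale /=; ring.
have := @is_derive_sum _ _ _ 3 (fun j (y : V) => (y 0 j - (0 : V) 0 j) ^+ 2) x (delta_mx 0 i) _ H.
have -> : \sum_(i0 < 3) (fun y : V => (y 0 i0 - (0 : V) 0 i0) ^+ 2) = sqd 0.
  by apply/funext => y; rewrite fct_sumE.
move=> E; apply: is_derive_eq E _; rewrite (bigD1 i) //= eqxx mulr1 big1 ?addr0 //.
by move=> j ji; rewrite eq_sym (negbTE ji) mulr0.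
Qed.

Lemma ker_is_derive c x i : kdom c x ->
  is_derive x (delta_mx 0 i) (ker c) (x 0 i * rho c x).
Proof.
move=> kx; have H : is_derive x (delta_mx 0 i) (fun y => sqd 0 y + c) (2 * x 0 i + 0).
  have h := sqd_is_derive x i; exact: (@is_deriveD _ _ _ (sqd 0) (fun=> c)).
apply: is_derive_eq; first exact: sqrt_is_derive H.
have k0 := lt0r_neq0 (ker_gt0 kx); rewrite -/(ker c x) /rho; field.
by rewrite k0.
Qed.

Lemma rho_is_derive c x i n : kdom c x ->
  is_derive x (delta_mx 0 i) (fun y => rho c y ^+ n) (- n%:R * x 0 i * rho c x ^+ n.+2).
Proof.
move=> kx; have k0 := lt0r_neq0 (ker_gt0 kx).
have H : is_derive x (delta_mx 0 i) (rho c) (- x 0 i * rho c x ^+ 3).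
  have [dk ek] := ker_is_derive i kx; apply: DeriveDef; first exact: derivableV.
  by rewrite deriveV // ek /GRing.scale /= /rho -exprVn; ring.
have := @is_deriveX _ _ (rho c) n x (delta_mx 0 i) _ H.
have -> : rho c ^+ n = (fun y => rho c y ^+ n) by apply/funext => y; rewrite exprfctE.
move=> E; apply: is_derive_eq E _; rewrite /GRing.scale /=.
by case: n => [|n] /=; [ring | rewrite !exprS -natr1; ring].
Qed.

Lemma xrho_is_derive c x i n : kdom c x ->
  is_derive x (delta_mx 0 i) (fun y : V => y 0 i * rho c y ^+ n)
   (rho c x ^+ n - n%:R * x 0 i ^+ 2 * rho c x ^+ n.+2).
Proof.
move=> kx; have h1 := coord_is_derive x i i; have h2 := rho_is_derive i n kx.
apply: is_derive_eq (@is_deriveM _ _ (fun y : V => y 0 i) (fun y => rho c y ^+ n) _ _ _ _ h1 h2) _.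
by rewrite eqxx /GRing.scale /=; ring.
Qed.

Lemma sqd_rho c x n : kdom c x -> sqd 0 x * rho c x ^+ n.+2 = rho c x ^+ n - c * rho c x ^+ n.+2.
Proof.
move=> kx; have k0 := lt0r_neq0 (ker_gt0 kx).
have -> : sqd 0 x = ker c x ^+ 2 - c by rewrite ker_sqr // addrK.
rewrite mulrBl; congr (_ - _); rewrite -(addn2 n) exprD mulrCA -exprMn.
by rewrite /rho divff // expr1n mulr1.
Qed.

Lemma sum_xrho c x n : \sum_(i < 3) (rho c x ^+ n - n%:R * x 0 i ^+ 2 * rho c x ^+ n.+2) =
  3 * rho c x ^+ n - n%:R * (sqd 0 x * rho c x ^+ n.+2).
Proof.
have -> : sqd 0 x = \sum_(i < 3) x 0 i ^+ 2 by apply: eq_bigr => i _; rewrite mxE subr0.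
by rewrite !big_ord_recl !big_ord0; ring.
Qed.

Lemma lap_ker c x : kdom c x -> lap (ker c) x = 2 * rho c x ^+ 1 + c * rho c x ^+ 3.
Proof.
move=> kx; rewrite /lap.
transitivity (\sum_(i < 3) (rho c x ^+ 1 - 1%:R * x 0 i ^+ 2 * rho c x ^+ 3)).
  apply: eq_bigr => i _ /=; rewrite (pd_local i (@open_kdom c) (g := fun y : V => y 0 i * rho c y ^+ 1)) //.
    exact/pd_is_derive/xrho_is_derive.
  by move=> y ky; rewrite expr1; apply/pd_is_derive/ker_is_derive.
by rewrite sum_xrho sqd_rho //; ring.
Qed.

Lemma lap_rho c x n : kdom c x -> lap (fun y => rho c y ^+ n) x =
  - n%:R * ((1 - n%:R) * rho c x ^+ n.+2 + n.+2%:R * c * rho c x ^+ n.+4).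
Proof.
move=> kx; rewrite /lap.
transitivity (\sum_(i < 3) (- n%:R * (rho c x ^+ n.+2 - n.+2%:R * x 0 i ^+ 2 * rho c x ^+ n.+4))).
  apply: eq_bigr => i _ /=; rewrite (pd_local i (@open_kdom c) (g := fun y : V => - n%:R * (y 0 i * rho c y ^+ n.+2))) //.
    apply: pd_is_derive; have h := xrho_is_derive i n.+2 kx.
    exact: (@is_deriveZ _ _ _ (fun y : V => y 0 i * rho c y ^+ n.+2)).
  by move=> y ky; rewrite mulrA; apply/pd_is_derive/rho_is_derive.
rewrite -mulr_sumr sum_xrho sqd_rho //; congr (_ * _); rewrite -[n.+2%:R]natr1 -[n.+1%:R]natr1; ring.
Qed.

Lemma smooth_rhoX c n : smooth (kdom c) (fun x => rho c x ^+ n).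
Proof.
have S : smooth (kdom c) (rho c).
  apply: smooth_inv (smooth_ker c); first exact: open_kdom.
  by move=> x /ker_gt0 /lt0r_neq0.
elim: n => [|n IH]; first exact: smooth_const.
by under eq_fun do rewrite exprS; apply: smooth_mul => //; exact: open_kdom.
Qed.

(** The fifth powers of [rho c] coming from the two terms of [lap_ker] cancel, an effect of
    dimension three. At [c = 0] the formula is the biharmonicity of the norm off the origin. *)
Lemma bilap_ker c x : kdom c x -> lap (lap (ker c)) x = - 15 * c ^+ 2 * rho c x ^+ 7.
Proof.
move=> kx; have oW := @open_kdom c; have sr := smooth_rhoX c.
rewrite (lap_local oW (g := fun y => 2 * rho c y ^+ 1 + c * rho c y ^+ 3)) //; last first.
  exact: lap_ker.
rewrite (lap_lin _ oW) //; last by apply: smooth_scale.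
have -> : lap (fun y => c * rho c y ^+ 3) x = c * lap (fun y => rho c y ^+ 3) x.
  have := lap_lin c oW (sr 3%N) (smooth_const (kdom c) 0) kx.
  under eq_fun do rewrite addr0; move=> ->.
  by rewrite /lap [X in _ + X]big1 ?addr0 // => i _; rewrite dword_cst.
by rewrite !lap_rho //; ring.
Qed.


Definition bilap_pairing phi : R := rint (fun y => ker 0 y * lap (lap phi) y).

Lemma continuous_ker c : continuous (ker c).
Proof.
move=> x; apply: (@continuous_comp _ _ _ (fun y => sqd 0 y + c) Num.sqrt).
  by apply: (smooth_continuous (smooth_kerarg c openT)).
exact: sqrt_continuous.
Qed.

Lemma ker_close c x : 0 <= c -> 0 <= ker (c ^+ 2) x - ker 0 x <= c.
Proof.
move=> c0; have q0 := sqd_ge0 0 x; rewrite /ker addr0.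
have h1 : Num.sqrt (sqd 0 x) <= Num.sqrt (sqd 0 x + c ^+ 2).
  by rewrite ler_sqrt ?lerDl ?sqr_ge0 // addr_ge0 // sqr_ge0.
rewrite subr_ge0 h1 lerBlDl /=.
rewrite -[leRHS]ger0_norm; last by rewrite addr_ge0 // sqrtr_ge0.
rewrite -sqrtr_sqr ler_sqrt ?sqr_ge0 // sqrrD sqr_sqrtr //.
by rewrite -addrA lerD2l lerDr mulrn_wge0 // mulr_ge0 // sqrtr_ge0.
Qed.

(* Up to a factor, the bilaplacian [- 15 c^4 rho^7] of the regularized kernel
   [ker (c^2)] is an approximate identity as [c] tends to 0. *)
Lemma bilap_regularized phi c : 0 < c -> tf phi ->
  rint (fun y => ker (c ^+ 2) y * lap (lap phi) y) =
  rint (fun y => - 15 * c ^+ 4 * rho (c ^+ 2) y ^+ 7 * phi y).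
Proof.
move=> c0 tp; have c2 : 0 < c ^+ 2 by rewrite exprn_gt0.
have kT := kdom_pos c2; have oW := @open_kdom (c ^+ 2); have sk := @smooth_ker (c ^+ 2).
have sub (psi : V -> R) : tsupp psi `<=` kdom (c ^+ 2) by rewrite kT.
rewrite (by_parts_lap oW sk (tf_lap tp) (sub _)).
rewrite (by_parts_lap oW (smooth_lap oW sk) tp (sub _)).
congr rint; apply/funext => y; rewrite bilap_ker ?kT //.
by congr (_ * _ * _); ring.
Qed.

(** Regularization changes the norm by at most [c], uniformly, while [lap (lap phi)] is bounded with
    compact support. *)
Lemma bilap_pairing_close phi : tf phi -> exists2 C, 0 <= C & forall c, 0 < c ->
  `|bilap_pairing phi - rint (fun y => - 15 * c ^+ 4 * rho (c ^+ 2) y ^+ 7 * phi y)| <= C * c.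
Proof.
move=> tp; have tl := tf_lap (tf_lap tp); have [L uL] := tf_ucc tl.
have [L0 _ _] := uL.
have [M M0 HM] := tf_bounded tl.
exists (M * (2 * L) ^+ 3); first by rewrite mulr_ge0 // exprn_ge0 // mulr_ge0 // ltW.
move=> c c0; rewrite -bilap_regularized //.
have u c' : ucc L (fun y => ker c' y * lap (lap phi) y).
  apply: continuous_ucc => //.
    move=> x; apply: (@continuousM _ _ (ker c') (lap (lap phi))).
      exact: continuous_ker.
    exact: smooth_continuous (tf_smooth tl) _.
  by case: uL => _ _ z x Lx; rewrite z ?mulr0.
have -> : bilap_pairing phi - rint (fun y => ker (c ^+ 2) y * lap (lap phi) y) =
    rint (fun y => -1 * (ker (c ^+ 2) y * lap (lap phi) y) + ker 0 y * lap (lap phi) y).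
  by rewrite (integral_lin _ (u _) (u _)) mulN1r addrC.
rewrite mulrAC; apply: integral_bound; [by apply: ucc_lin | by rewrite mulr_ge0 // ltW |].
move=> y; have -> : -1 * (ker (c ^+ 2) y * lap (lap phi) y) + ker 0 y * lap (lap phi) y =
   - (ker (c ^+ 2) y - ker 0 y) * lap (lap phi) y by ring.
have /andP[h1 h2] := ker_close y (ltW c0).
by rewrite normrM normrN (ger0_norm h1) [M * c]mulrC; apply: ler_pM.
Qed.

(** Each square of [rho] is bounded by dropping all coordinates but one. The result is a product of
    Cauchy kernels of mass pi, the majorant required by [int_majorized]; of the seven powers in
    [bilap_ker] one is left over for the estimate of [phi]. *)
Lemma rho_pow6_le c x : 0 < c -> c ^+ 3 * rho (c ^+ 2) x ^+ 6 <= \prod_(i < 3) (c / (c ^+ 2 + x 0 i ^+ 2)).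
Proof.
move=> c0; have c2 : 0 < c ^+ 2 by rewrite exprn_gt0.
have kx : kdom (c ^+ 2) x by rewrite kdom_pos.
have q i : rho (c ^+ 2) x ^+ 2 <= (c ^+ 2 + x 0 i ^+ 2)^-1.
  have p : 0 < c ^+ 2 + x 0 i ^+ 2 by rewrite ltr_wpDr // sqr_ge0.
  rewrite /rho exprVn lef_pV2 ?posrE ?exprn_gt0 ?ker_gt0 // ker_sqr // addrC lerD2r.
  rewrite /sqd (bigD1 i) //= mxE subr0 lerDl; apply: sumr_ge0 => j _; exact: sqr_ge0.
have r0 := ltW (rho_gt0 kx).
have -> : c ^+ 3 * rho (c ^+ 2) x ^+ 6 = \prod_(i < 3) (c * rho (c ^+ 2) x ^+ 2).
  by rewrite prodr_const card_ord exprMn -exprM.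
apply: ler_prod => i _; apply/andP; split; first by rewrite mulr_ge0 ?sqr_ge0 ?ltW.
by rewrite ler_pM2l.
Qed.

Lemma atan_scaled_is_derive c (t : R) : 0 < c ->
  is_derive t (1 : R) (fun t => atan (t / c)) (c / (c ^+ 2 + t ^+ 2)).
Proof.
move=> c0; have d1 : is_derive t (1 : R) (fun t : R => t / c) (c^-1).
  have := @is_deriveM _ _ (fun t : R => t) (fun=> c^-1) t 1 1 0 (is_derive_id _ _) (is_derive_cst _ _ _).
  by rewrite scaler0 add0r [_ *: _]mulr1.
have := @is_derive1_comp R atan (fun t => t / c) t _ _ (is_derive1_atan (t / c)) d1.
move=> H; apply: is_derive_eq H _; field.
by apply/andP; split; apply: lt0r_neq0 => //; rewrite ltr_wpDr ?sqr_ge0 // exprn_gt0.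
Qed.

Lemma bilap_pairing_zero phi : tf phi -> phi 0 = 0 -> bilap_pairing phi = 0.
Proof.
move=> tp p0; have [C C0 HC] := bilap_pairing_close tp.
have [M M0 HM] := tf_bounded tp; have [L uL] := tf_ucc tp; have [L0 _ _] := uL.
apply/eqP; rewrite -normr_le0; apply: (@le_small _ _ (C + 30 * pi ^+ 3)).
  by rewrite addr_ge0 // mulr_ge0 // exprn_ge0 // pi_ge0.
move=> e e0.
have [h h0 Hh] := (cont_rowP _ _).1 (smooth_continuous (tf_smooth tp) (I : setT (0 : V))) _ e0.
(* The first bound makes the regularization error [C * c] small; the second gives [M * c / h <= e],
   used outside the cube of half-side [h]. *)
pose c := Num.min e (e * h / (M + 1)).
have M1 : 0 < M + 1 by rewrite ltr_wpDl.
have c0 : 0 < c by rewrite lt_min e0 divr_gt0 // mulr_gt0.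
have ce : c <= e by rewrite ge_min lexx.
have cM : M * c / h <= e.
  rewrite ler_pdivrMr //; apply: le_trans (_ : (M + 1) * (e * h / (M + 1)) <= _).
    by apply: ler_pM => //; rewrite ?lerDl ?(ltW c0) // ge_min lexx orbT.
  by rewrite mulrC divfK // lt0r_neq0.
have c2 : 0 < c ^+ 2 by rewrite exprn_gt0.
have kT : kdom (c ^+ 2) = setT by exact: kdom_pos.
set f := fun y => - 15 * c ^+ 4 * rho (c ^+ 2) y ^+ 7 * phi y.
have uf : ucc L f.
  have tf_f : tf f.
    apply: (tf_mul_tsupp openT) => //; rewrite -kT; apply: smooth_scale; first exact: open_kdom.
    exact: smooth_rhoX.
  apply: continuous_ucc => // [x|x Lx]; first exact: smooth_continuous (tf_smooth tf_f) _.
  by case: uL => _ _ z; rewrite /f z ?mulr0.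
have mP t : 0 <= c / (c ^+ 2 + t ^+ 2).
  by rewrite divr_ge0 ?(ltW c0) // addr_ge0 ?sqr_ge0 // ltW.
have e15 : 0 <= 15 * e by lra.
have := integral_maj uf (fun t => atan_scaled_is_derive t c0) mP e15 => J.
have HJ : `|rint f| <= 15 * e * pi ^+ 3.
  apply: le_trans (J _) _; last first.
    apply: ler_wpM2l => //; rewrite lerXn2r ?nnegrE ?pi_ge0 //.
      by rewrite subr_ge0 ltW // lt_atan // ltr_pM2r ?invr_gt0 //; lra.
    by have := atan_ltpi2 (L / c); have := atan_gtNpi2 (- L / c); lra.
  move=> y _; have ky : kdom (c ^+ 2) y by rewrite kT.
  have r0 := rho_gt0 ky; have k0 := ker_gt0 ky.
  have -> : `|f y| = 15 * (c ^+ 3 * rho (c ^+ 2) y ^+ 6) * (c * rho (c ^+ 2) y * `|phi y|).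
    have -> : f y = - (15 * (c ^+ 3 * rho (c ^+ 2) y ^+ 6) * (c * rho (c ^+ 2) y)) * phi y by rewrite /f; ring.
    have p1 := ltW c0; have p2 := ltW r0.
    have hA : 0 <= 15 * (c ^+ 3 * rho (c ^+ 2) y ^+ 6) * (c * rho (c ^+ 2) y).
      by rewrite !mulr_ge0 // exprn_ge0.
    by rewrite [RHS]mulrA normrM normrN (ger0_norm hA).
  have -> : 15 * e * \prod_i (c / (c ^+ 2 + y 0 i ^+ 2)) = 15 * \prod_i (c / (c ^+ 2 + y 0 i ^+ 2)) * e by ring.
  apply: ler_pM.
  - by rewrite mulr_ge0 // mulr_ge0 // exprn_ge0 // ltW.
  - by rewrite mulr_ge0 // mulr_ge0 // ltW.
  - by apply: ler_wpM2l => //; exact: rho_pow6_le.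
  (* Near 0 the values of [phi] are small and [c * rho] is at most 1; farther out [phi] is only
     bounded by [M], but [c * rho] is at most [c / h]. *)
  have [yh|hy] := ltP `|y| h.
    have cr : c * rho (c ^+ 2) y <= 1.
      rewrite /rho ler_pdivrMr // mul1r -[leLHS]ger0_norm ?(ltW c0) // -sqrtr_sqr ler_sqrt ?(ltW ky) //.
      by rewrite lerDr sqd_ge0.
    rewrite -[e]mul1r; apply: ler_pM => //; first by rewrite mulr_ge0 // ltW.
    by have := Hh y; rewrite p0 !subr0 => /(_ yh) /ltW.
  apply: le_trans cM; rewrite mulrAC [c * _]mulrC; apply: ler_pM; rewrite ?mulr_ge0 ?(ltW c0) ?(ltW r0) //.
    by apply: ler_wpM2r; rewrite ?(ltW c0).
  rewrite /rho lef_pV2 ?posrE //; apply: le_trans hy _; rewrite -[leLHS]normr_id -sqrtr_sqr.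
  rewrite ler_sqrt ?(ltW ky) //; have := sqd_norm 0 y; rewrite subr0; have := ltW c2; lra.
have := HC c c0; rewrite -/f => H1.
have : `|bilap_pairing phi| <= C * c + 15 * e * pi ^+ 3.
  by rewrite -[X in `|X|](subrK (rint f)); apply: le_trans (ler_normD _ _) _; apply: lerD.
have : C * c <= C * e by apply: ler_wpM2l.
have : 0 <= e * pi ^+ 3 by rewrite mulr_ge0 ?(ltW e0) // exprn_ge0 // pi_ge0.
set p := pi ^+ 3; have -> : (C + 30 * p) * e = C * e + 30 * (e * p) by ring.
have -> : 15 * e * p = 15 * (e * p) by ring.
lra.
Qed.

(** On the cube of half-side c the squared Euclidean norm is at most 3c^2, so [rho] is at least
    1/(2c), and the bump is 1 there. This cube alone contributes 15 c^4 (2c)^(-7) (2c)^3 = 15/16 in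
    absolute value, which exceeds the error [C * c], at most 1/2. *)
Lemma bilap_pairing_bump : bilap_pairing (bumpf 0 1) < 0.
Proof.
have tp := @tf_bumpf R 3 0 1 ltr01.
have [C C0 HC] := bilap_pairing_close tp.
pose c := Num.min (1 / 2) (1 / (2 * (C + 1))).
have C1 : 0 < C + 1 by rewrite ltr_wpDl.
have c0 : 0 < c by rewrite lt_min !divr_gt0 // mulr_gt0.
have ch : c <= 1 / 2 by rewrite ge_min lexx.
have Cc : C * c <= 1 / 2.
  apply: le_trans (_ : (C + 1) * (1 / (2 * (C + 1))) <= _).
    by apply: ler_pM => //; rewrite ?lerDl ?(ltW c0) // ge_min lexx orbT.
  by rewrite le_eqVlt; apply/orP; left; apply/eqP; field; rewrite lt0r_neq0.
have := HC c c0; set f := fun y => _ => H1.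
have c2 : 0 < c ^+ 2 by rewrite exprn_gt0.
have kT : kdom (c ^+ 2) = setT by exact: kdom_pos.
have tf_f : tf f.
  apply: (tf_mul_tsupp openT) => //; rewrite -kT; apply: smooth_scale; first exact: open_kdom.
  exact: smooth_rhoX.
have tf_g := tf_scale (-1) tf_f.
have [L L1 uL] := tf_ucc_large 1 tf_g.
have m0 : 0 <= 15 * c ^+ 4 * (2 * c)^-1 ^+ 7.
  have p1 := ltW c0; have p2 : 0 <= (2 * c)^-1 by rewrite invr_ge0 mulr_ge0.
  by apply: mulr_ge0; [apply: mulr_ge0 => // |]; exact: exprn_ge0.
have cL : 0 <= c <= L by rewrite (ltW c0) /=; lra.
have rp y : 0 < rho (c ^+ 2) y by apply: rho_gt0; rewrite kT.
have gE y : -1 * f y = 15 * c ^+ 4 * rho (c ^+ 2) y ^+ 7 * bumpf 0 1 y by rewrite /f; ring.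
have := integral_low uL cL m0; rewrite /= => J.
have : 15 * c ^+ 4 * (2 * c)^-1 ^+ 7 * (2 * c) ^+ 3 <= rint (fun x => -1 * f x).
  apply: J => y.
    have p1 := ltW c0; have p2 := ltW (rp y); rewrite gE; apply: mulr_ge0; last exact: bumpf_ge0.
    by apply: mulr_ge0; [apply: mulr_ge0 => // |]; exact: exprn_ge0.
  move=> yc; rewrite gE.
  have qy : sqd 0 y <= 3 * c ^+ 2.
    apply: le_trans (sqd_norm_le _ _) _; apply: ler_wpM2l => //.
    by rewrite subr0 lerXn2r // nnegrE // ltW.
  have c4 : c ^+ 2 <= 1 / 4.
    have -> : 1 / 4 = (1 / 2) ^+ 2 :> R by field.
    by rewrite lerXn2r // nnegrE // ltW.
  rewrite (bumpf_near ltr01) ?mulr1; last lra.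
  apply: ler_wpM2l; first by rewrite mulr_ge0 // exprn_ge0 // ltW.
  have p1 := ltW (rp y); have p2 : 0 <= (2 * c)^-1 by rewrite invr_ge0 mulr_ge0 // ltW.
  rewrite lerXn2r ?nnegrE //.
  have ky : kdom (c ^+ 2) y by rewrite kT.
  rewrite /rho lef_pV2 ?posrE ?ker_gt0 ?mulr_gt0 //.
  have -> : 2 * c = Num.sqrt ((2 * c) ^+ 2) by rewrite sqrtr_sqr gtr0_norm // mulr_gt0.
  rewrite /ker ler_sqrt ?sqr_ge0 //.
  have -> : (2 * c) ^+ 2 = 4 * c ^+ 2 by ring.
  lra.
have -> : 15 * c ^+ 4 * (2 * c)^-1 ^+ 7 * (2 * c) ^+ 3 = 15 / 16.
  by field; rewrite lt0r_neq0.
have -> : rint (fun x => -1 * f x) = - rint f.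
  have := tf_int_lin (-1) tf_f (@tf0 R 3); rewrite /=.
  rewrite tf_int0.
  by rewrite addr0 mulN1r; under eq_fun do rewrite addr0.
by move: H1; rewrite ler_norml => /andP[_]; lra.
Qed.

Lemma bilap_pairing_lin a phi psi : tf phi -> tf psi ->
  bilap_pairing (fun x => a * phi x + psi x) = a * bilap_pairing phi + bilap_pairing psi.
Proof.
move=> tp tq; rewrite /bilap_pairing.
have E y : lap (lap (fun x => a * phi x + psi x)) y = a * lap (lap phi) y + lap (lap psi) y.
  rewrite -(lap_lin (W := setT)) //; try exact: openT; try exact: tf_smooth (tf_lap _).
  by apply: lap_local openT _ I => z _; apply: lap_lin openT _ _ I; exact: tf_smooth.
have [L _ u1] := ucc_mul_tf 0 (@continuous_ker 0) (tf_lap (tf_lap tp)).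
have [L' LL' u2] := ucc_mul_tf L (@continuous_ker 0) (tf_lap (tf_lap tq)).
rewrite -(integral_lin _ (ucc_wide LL' u1) u2); congr rint; apply/funext => y.
by rewrite E; ring.
Qed.

Definition bilap_cst : R := bilap_pairing (bumpf 0 1).

Lemma bilap_cst_neq0 : bilap_cst != 0.
Proof. by rewrite lt_eqF // bilap_pairing_bump. Qed.

(** Subtracting [phi 0] times a bump equal to 1 at the origin leaves a function that vanishes at 0,
    on which the pairing is zero. *)
Lemma bilap_pairing0 phi : tf phi -> bilap_pairing phi = bilap_cst * phi 0.
Proof.
move=> tp; have tb := @tf_bumpf R 3 0 1 ltr01.
have b1 : bumpf 0 1 (0 : V) = 1.
  by apply: bumpf_near => //; rewrite /sqd big1 // => i _; rewrite subrr expr0n.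
have := @bilap_pairing_zero (fun x => - phi 0 * bumpf 0 1 x + phi x) (tf_lin _ tb tp).
rewrite b1 mulr1 addNr => /(_ erefl); rewrite bilap_pairing_lin // mulNr => /eqP.
by rewrite addrC subr_eq0 => /eqP ->; rewrite mulrC.
Qed.

Lemma fundamental phi x : tf phi ->
  rint (fun y => ker 0 (y - x) * lap (lap phi) y) = bilap_cst * phi x.
Proof.
move=> tp; pose psi y := phi (y - - x).
have tpsi : tf psi.
  split.
    have := smooth_shift (- x) openT (tf_smooth tp).
    by congr smooth; apply/seteqP; split.
  have [_ [L L0 z]] := tp; exists (L + `|x|); first by rewrite ltr_wpDr.
  move=> y Ly; apply: z; rewrite opprK -(lerD2r `|x|); apply: le_trans Ly _.
  by rewrite -[in X in X <= _](addrK x y) ler_normB.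
have := bilap_pairing0 tpsi; rewrite {2}/psi sub0r opprK => <-.
have ck : continuous (fun y => ker 0 (y - x)).
  by move=> y; apply: continuous_comp; [exact: continuous_subr_cst | exact: continuous_ker].
have [L _ u] := ucc_mul_tf 0 ck (tf_lap (tf_lap tp)).
rewrite -(integral_shift x u); congr rint; apply/funext => y.
rewrite addrK; congr (_ * _).
have -> : lap psi = (fun y => lap phi (y - - x)) by apply/funext => z; apply: lap_shift.
by rewrite lap_shift opprK.
Qed.

End Kernel.

(** * Cauchy estimates and Taylor expansion of the fundamental solution *)

Section Homogeneous.
Context {R : realType}.
Local Notation V := 'rV[R]_3.
Implicit Types (x y v : V) (f g : V -> R).

Local Notation r := (ker 0).
Local Notation rh := (rho 0).

Definition om (j : 'I_3) x : R := x 0 j * rh x.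

Lemma kdom0P x : kdom 0 x <-> 0 < `|x|.
Proof.
rewrite /kdom /= addr0; split=> H.
  rewrite normr_gt0; apply/negP => /eqP x0; move: H; rewrite x0 /sqd big1 ?ltxx //.
  by move=> i _; rewrite subrr expr0n.
by apply: lt_le_trans (sqd_norm 0 x); rewrite subr0 exprn_gt0.
Qed.

Lemma ker0_ge x : `|x| <= r x.
Proof.
rewrite -[leLHS]normr_id -sqrtr_sqr ler_sqrt; first by have := sqd_norm 0 x; rewrite subr0 addr0.
by rewrite addr0 sqd_ge0.
Qed.

Lemma ker0_le x : r x <= 3 * `|x|.
Proof.
have -> : 3 * `|x| = Num.sqrt ((3 * `|x|) ^+ 2) by rewrite sqrtr_sqr ger0_norm // mulr_ge0.
rewrite ler_sqrt ?sqr_ge0 // addr0; apply: le_trans (sqd_norm_le _ _) _; rewrite subr0.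
by have := sqr_ge0 `|x|; rewrite exprMn; set t := `|x| ^+ 2; lra.
Qed.

Lemma om_le1 j x : kdom 0 x -> `|om j x| <= 1.
Proof.
move=> kx; rewrite normrM (gtr0_norm (rho_gt0 kx)) /rho ler_pdivrMr ?ker_gt0 // mul1r.
exact: le_trans (coord_le_norm x j) (ker0_ge x).
Qed.

Lemma ker_rho x : kdom 0 x -> r x * rh x = 1.
Proof. by move=> kx; rewrite /rho divff // lt0r_neq0 // ker_gt0. Qed.

Definition mono n (u : seq 'I_3) x := r x * rh x ^+ n * \prod_(j <- u) om j x.

(* Linear combinations of the functions [r^(1-n) omega_u], where [r] is the
   Euclidean norm, [omega = x / r] and [u] is a word of length at most [l];
   [N] bounds the sum of the absolute values of the coefficients. *)
Inductive hcls (n l : nat) : R -> (V -> R) -> Prop :=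
| hc_mono u : (size u <= l)%N -> hcls n l 1 (mono n u)
| hc_zero : hcls n l 0 (fun=> 0)
| hc_scale c N f : hcls n l N f -> hcls n l (`|c| * N) (fun x => c * f x)
| hc_add N N' f g : hcls n l N f -> hcls n l N' g -> hcls n l (N + N') (fun x => f x + g x)
| hc_eq N N' f g : (forall x, kdom 0 x -> f x = g x) -> N <= N' -> hcls n l N f -> hcls n l N' g.

Lemma hcls_bound n l N f x : hcls n l N f -> kdom 0 x -> `|f x| <= N * (r x * rh x ^+ n).
Proof.
move=> H kx; have r0 := ltW (ker_gt0 kx); have h0 := ltW (rho_gt0 kx).
have p0 : 0 <= r x * rh x ^+ n by rewrite mulr_ge0 // exprn_ge0.
elim: H => {N f}.
- move=> u _; rewrite /mono normrM (ger0_norm p0) mulrC; apply: ler_wpM2r => //.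
  elim: u => [|j u IH]; first by rewrite big_nil normr1.
  by rewrite big_cons normrM -[X in _ <= X]mulr1; apply: ler_pM => //; exact: om_le1.
- by rewrite normr0 mul0r.
- by move=> c N f _ IH; rewrite normrM -mulrA; apply: ler_wpM2l.
- by move=> N N' f g _ IH _ IH'; rewrite mulrDl; apply: le_trans (ler_normD _ _) _; apply: lerD.
- by move=> N N' f g fg NN _ IH; rewrite -fg //; apply: le_trans IH _; apply: ler_wpM2r.
Qed.

Lemma hcls_om n l N f j : hcls n l N f -> hcls n l.+1 N (fun x => om j x * f x).
Proof.
elim=> {N f}.
- move=> u ul; apply: (@hc_eq _ _ 1 _ (mono n (j :: u))) => //; last exact: hc_mono.
  by move=> x kx; rewrite /mono big_cons; ring.
- by apply: hc_eq (hc_zero _ _) => // x _; rewrite mulr0.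
- by move=> c N f _ IH; apply: hc_eq (hc_scale c IH) => // x _; ring.
- by move=> N N' f g _ IH _ IH'; apply: hc_eq (hc_add IH IH') => // x _; ring.
- by move=> N N' f g fg NN _ IH; apply: hc_eq NN IH => x /fg ->.
Qed.

Lemma hcls_widen n l l' N f : (l <= l')%N -> hcls n l N f -> hcls n l' N f.
Proof.
move=> ll; elim=> {N f}.
- by move=> u ul; apply: hc_mono; exact: leq_trans ul ll.
- exact: hc_zero.
- by move=> c N f _; exact: hc_scale.
- by move=> N N' f g _ IH _; exact: hc_add.
- by move=> N N' f g fg NN _; exact: hc_eq fg NN.
Qed.

Definition dotv v x : R := \sum_i v 0 i * om i x.

Lemma coord_is_derive_dir x v (j : 'I_3) : is_derive x v (fun y : V => y 0 j) (v 0 j).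
Proof.
apply: is_derive_line0.
have -> : (fun h : R => (h *: v + x) 0 j) = (fun h => h * v 0 j + x 0 j).
  by apply/funext => h; rewrite !mxE.
have := @is_deriveD _ _ _ (fun h : R => h * v 0 j) (fun=> x 0 j) 0 1 (v 0 j) 0.
rewrite addr0; apply.
have := @is_deriveM _ _ (fun h : R => h) (fun=> v 0 j) 0 1 1 0.
by rewrite scale0r add0r /GRing.scale /= mulr1; apply.
Qed.

Lemma ker0_is_derive x v : kdom 0 x -> is_derive x v r (dotv v x).
Proof.
move=> kx.
have H (j : 'I_3) : is_derive x v (fun y : V => (y 0 j - (0 : V) 0 j) ^+ 2) (2 * x 0 j * v 0 j).
  have h1 := coord_is_derive_dir x v j.
  have -> : (fun y : V => (y 0 j - (0 : V) 0 j) ^+ 2) = (fun y : V => y 0 j * y 0 j).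
    by apply/funext => y; rewrite mxE subr0 expr2.
  apply: is_derive_eq (@is_deriveM _ _ (fun y : V => y 0 j) (fun y : V => y 0 j) _ _ _ _ h1 h1) _.
  by rewrite /GRing.scale /=; ring.
have := @is_derive_sum _ _ _ 3 (fun j (y : V) => (y 0 j - (0 : V) 0 j) ^+ 2) x v _ H.
have -> : \sum_(i0 < 3) (fun y : V => (y 0 i0 - (0 : V) 0 i0) ^+ 2) = (fun y => sqd 0 y + 0).
  by apply/funext => y; rewrite fct_sumE addr0.
move=> E; have := is_derive_comp1 E (is_derive1_sqrt kx); rewrite -/(ker 0 x) => K.
apply: is_derive_eq K _; rewrite mulr_sumr; apply: eq_bigr => i _.
by rewrite /om /rho; field; rewrite lt0r_neq0 // ker_gt0.
Qed.

Lemma rho0_is_derive x v : kdom 0 x -> is_derive x v rh (- dotv v x * rh x ^+ 2).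
Proof.
move=> kx; have k0 := lt0r_neq0 (ker_gt0 kx).
have [dk ek] := ker0_is_derive v kx; apply: DeriveDef; first exact: derivableV.
by rewrite deriveV // ek /GRing.scale /= /rho -exprVn; ring.
Qed.

Lemma om_is_derive x v j : kdom 0 x ->
  is_derive x v (om j) (rh x * (v 0 j - om j x * dotv v x)).
Proof.
move=> kx; have h1 := coord_is_derive_dir x v j; have h2 := rho0_is_derive v kx.
apply: is_derive_eq (@is_deriveM _ _ (fun y : V => y 0 j) rh _ _ _ _ h1 h2) _.
by rewrite /GRing.scale /= /om; ring.
Qed.

Lemma radial_is_derive n x v : kdom 0 x ->
  is_derive x v (fun y => r y * rh y ^+ n) ((1 - n%:R) * (r x * rh x ^+ n.+1) * dotv v x).
Proof.
move=> kx; have h1 := ker0_is_derive v kx; have h2 := rho0_is_derive v kx.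
have h3 := @is_deriveX _ _ rh n x v _ h2.
have := @is_deriveM _ _ r (rh ^+ n) _ _ _ _ h1 h3.
have -> : r * rh ^+ n = (fun y => r y * rh y ^+ n).
  apply/funext => y; have -> : (r * rh ^+ n) y = r y * (rh ^+ n) y by [].
  by rewrite exprfctE.
move=> E; apply: is_derive_eq E _; rewrite exprfctE /GRing.scale /=.
have k1 := ker_rho kx.
have -> : r x * rh x ^+ n.+1 = rh x ^+ n by rewrite exprS mulrA k1 mul1r.
case: n h3 => [|n] h3 /=; first by rewrite expr0; ring.
have E (k A e p q : R) : p * q = 1 ->
    p * (k * A * (- e * (q * q))) + q * A * e = (1 - k) * (q * A) * e.
  move=> pq; transitivity ((1 - k * (p * q)) * (q * A) * e); first ring.
  by rewrite pq mulr1.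
by rewrite !(exprS (rh x) n); exact: E k1.
Qed.

(** The factor om_j has partial derivatives (delta_ij - om_i om_j) / r: two terms per letter, one
    more power of 1/r, and words longer by at most one. *)
Lemma prod_om_is_derive n (u : seq 'I_3) : exists q : 'I_3 -> V -> R,
  (forall i, hcls n.+1 (size u).+1 (2 * (size u)%:R) (fun x => r x * rh x ^+ n.+1 * q i x)) /\
  (forall x v, kdom 0 x -> is_derive x v (fun y => \prod_(j <- u) om j y)
     (rh x * \sum_i v 0 i * q i x)).
Proof.
elim: u => [|j u [q [Hq Dq]]].
  exists (fun _ _ => 0); split=> [i|x v kx].
    by rewrite mulr0; apply: hc_eq (hc_zero _ _) => // x _; rewrite mulr0.
  under eq_fun do rewrite big_nil.
  apply: is_derive_eq (is_derive_cst (1 : R) x v) _.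
  by rewrite big1 ?mulr0 // => i _; rewrite mulr0.
exists (fun i x => om j x * q i x + ((i == j)%:R * \prod_(k <- u) om k x +
   -1 * (om j x * (om i x * \prod_(k <- u) om k x)))); split.
  move=> i; have h1 := hcls_om j (Hq i).
  have hm : hcls n.+1 (size u) 1 (mono n.+1 u) by apply: hc_mono.
  have h2 := hc_scale (i == j)%:R hm.
  have h3 := hc_scale (-1) (hcls_om j (hcls_om i hm)).
  have := hc_add h1 (hc_add (hcls_widen (leqW (leqnSn _)) h2) h3).
  apply: hc_eq => [x kx|]; first by rewrite /mono; ring.
  by rewrite /= -natr1 normrN normr1; case: (i == j); rewrite ?normr1 ?normr0; lra.
move=> x v kx; have h1 := om_is_derive v j kx; have h2 := Dq x v kx.
under eq_fun do rewrite big_cons.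
apply: is_derive_eq (@is_deriveM _ _ (om j) (fun y => \prod_(k <- u) om k y) _ _ _ _ h1 h2) _.
rewrite /GRing.scale /=; set P := \prod_(k <- u) _.
have -> : \sum_i v 0 i * (om j x * q i x + ((i == j)%:R * P + -1 * (om j x * (om i x * P)))) =
   om j x * (\sum_i v 0 i * q i x) + (v 0 j * P - om j x * P * dotv v x).
  rewrite /dotv !mulr_sumr -[v 0 j * P](_ : \sum_i v 0 i * (i == j)%:R * P = _); last first.
    rewrite (bigD1 j) //= eqxx mulr1 big1 ?addr0 // => i ij.
    by rewrite (negbTE ij) mulr0 mul0r.
  by rewrite -sumrB -big_split /=; apply: eq_bigr => i _; ring.
ring.
Qed.

(** The factor counts terms: at most [n + 1] from the radial power r^(1-n), and 2 for each of at
    most [l] letters. All directions [v] are covered, not only the coordinate ones, because the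
    Taylor expansion runs along segments. *)
Lemma hcls_is_derive n l N f : hcls n l N f -> exists g : 'I_3 -> V -> R,
  (forall i, hcls n.+1 l.+1 ((n + 1 + 2 * l)%:R * N) (g i)) /\
  (forall x v, kdom 0 x -> is_derive x v f (\sum_i v 0 i * g i x)).
Proof.
elim=> {N f}.
- move=> u ul; have [q [Hq Dq]] := prod_om_is_derive n u.
  exists (fun i x => (1 - n%:R) * mono n.+1 (i :: u) x + r x * rh x ^+ n.+1 * q i x); split.
    move=> i.
    have hm : hcls n.+1 (size u).+1 1 (mono n.+1 (i :: u)) by apply: hc_mono.
    have := hcls_widen (ul : (size u).+1 <= l.+1)%N (hc_add (hc_scale (1 - n%:R) hm) (Hq i)).
    have E : (n + 1 + 2 * l)%:R = n%:R + 1 + 2 * l%:R :> R by rewrite 2!natrD natrM.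
    apply: hc_eq => //; rewrite E !mulr1.
    apply: lerD; last by apply: ler_wpM2l => //; rewrite ler_nat.
    by apply: le_trans (ler_normB _ _) _; rewrite normr1 normr_nat addrC.
  move=> x v kx; have h1 := radial_is_derive n v kx; have h2 := Dq x v kx.
  apply: is_derive_eq (@is_deriveM _ _ (fun y => r y * rh y ^+ n) (fun y => \prod_(k <- u) om k y) _ _ _ _ h1 h2) _.
  rewrite /GRing.scale /=; set P := \prod_(k <- u) _.
  have -> : \sum_i v 0 i * ((1 - n%:R) * mono n.+1 (i :: u) x + r x * rh x ^+ n.+1 * q i x) =
     (1 - n%:R) * (r x * rh x ^+ n.+1) * P * dotv v x + r x * rh x ^+ n.+1 * (\sum_i v 0 i * q i x).
    rewrite /dotv !mulr_sumr -big_split /=; apply: eq_bigr => i _.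
    by rewrite /mono big_cons -/P; ring.
  by rewrite exprS; ring.
- exists (fun _ _ => 0); split=> [i|x v kx]; first by rewrite mulr0; exact: hc_zero.
  apply: is_derive_eq (is_derive_cst (0 : R) x v) _.
  by rewrite big1 // => i _; rewrite mulr0.
- move=> c N f _ [g [Hg Dg]]; exists (fun i x => c * g i x); split.
    by move=> i; rewrite mulrCA; exact: hc_scale.
  move=> x v kx; have h := Dg x v kx.
  apply: is_derive_eq (@is_deriveZ _ _ _ f c x v _ h) _.
  by rewrite /GRing.scale /= mulr_sumr; apply: eq_bigr => i _; ring.
- move=> N N' f f' _ [g [Hg Dg]] _ [g' [Hg' Dg']]; exists (fun i x => g i x + g' i x); split.
    by move=> i; rewrite mulrDr; exact: hc_add.
  move=> x v kx; have h := Dg x v kx; have h' := Dg' x v kx.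
  apply: is_derive_eq (@is_deriveD _ _ _ f f' x v _ _ h h') _.
  by rewrite -big_split; apply: eq_bigr => i _ /=; ring.
- move=> N N' f f' ff NN _ [g [Hg Dg]]; exists g; split.
    by move=> i; apply: hc_eq (Hg i) => //; apply: ler_wpM2l.
  move=> x v kx; apply: near_eq_is_derive (Dg x v kx).
  by apply: filterS (near_open (@open_kdom R 0) kx) => y /ff.
Qed.

(** After k derivatives n = l = k, so the next factor is 3k + 1 <= 3(k + 1). Growth no faster than
    factorial is what makes the Taylor series converge. *)
Lemma hcls_dword w : hcls (size w) (size w) (3 ^+ size w * (size w)`!%:R) (D w r).
Proof.
elim: w => [|i w IH] /=.
  apply: (@hc_eq _ _ 1 _ (mono 0 [::])); last exact: hc_mono.
    by move=> x _; rewrite /mono big_nil expr0 !mulr1.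
  by rewrite expr0 mul1r.
have [g [Hg Dg]] := hcls_is_derive IH.
apply: hc_eq (Hg i).
  move=> x kx; apply/esym/pd_is_derive; apply: is_derive_eq (Dg x _ kx) _.
  rewrite (bigD1 i) //= mxE !eqxx mul1r big1 ?addr0 // => j ji.
  by rewrite mxE (negbTE ji) mul0r.
rewrite factS exprS natrM mulrACA; apply: ler_wpM2r.
  by rewrite mulr_ge0 // exprn_ge0.
by rewrite -natrM ler_nat; lia.
Qed.

Lemma dword_is_derive_dir w x v : kdom 0 x ->
  is_derive x v (D w r) (\sum_i v 0 i * D (i :: w) r x).
Proof.
move=> kx; have [g [Hg Dg]] := hcls_is_derive (hcls_dword w).
apply: is_derive_eq (Dg x v kx) _; apply: eq_bigr => i _; congr (_ * _).
apply/esym/pd_is_derive; apply: is_derive_eq (Dg x _ kx) _.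
rewrite (bigD1 i) //= mxE !eqxx mul1r big1 ?addr0 // => j ji.
by rewrite mxE (negbTE ji) mul0r.
Qed.

Lemma dword_ker_bound w x (d L : R) : 0 < d -> d <= `|x| <= L ->
  `|D w r x| <= 3 ^+ size w * (size w)`!%:R * (3 * L * d^-1 ^+ size w).
Proof.
move=> d0 /andP[dx xL]; have kx : kdom 0 x by apply/kdom0P; exact: lt_le_trans dx.
apply: le_trans (hcls_bound (hcls_dword w) kx) _; apply: ler_wpM2l.
  by rewrite mulr_ge0 // exprn_ge0.
apply: ler_pM; rewrite ?exprn_ge0 ?(ltW (ker_gt0 kx)) ?(ltW (rho_gt0 kx)) //.
  by apply: le_trans (ker0_le x) _; apply: ler_wpM2l.
rewrite lerXn2r ?nnegrE ?invr_ge0 ?(ltW d0) ?(ltW (ker_gt0 kx)) //.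
by rewrite /rho lef_pV2 ?posrE ?ker_gt0 //; apply: le_trans dx (ker0_ge x).
Qed.

End Homogeneous.

(** * Taylor expansion of the norm with a geometric remainder *)

Section Taylor.
Context {R : realType}.
Local Notation V := 'rV[R]_3.
Implicit Types (x y v a : V) (c : seq 'I_3 -> R) (w u s : seq 'I_3).
Local Notation r := (ker 0).

(* If [c u] are the partial derivatives [D u f a], this is the homogeneous term
   of degree [n] of the Taylor expansion of [D w f] at [a], evaluated at [v]. *)
Fixpoint tay n c v w : R :=
  if n is n'.+1 then n%:R^-1 * \sum_i v 0 i * tay n' c v (i :: w) else c w.

Lemma tay_bound n c v w M : (forall u, size u = n -> `|c (u ++ w)| <= M) ->
  `|tay n c v w| <= (3 * `|v|) ^+ n / n`!%:R * M.
Proof.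
elim: n w => [|n IH] w H /=; first by rewrite expr0 fact0 divr1 mul1r; exact: (H [::]).
have H' i : `|tay n c v (i :: w)| <= (3 * `|v|) ^+ n / n`!%:R * M.
  by apply: IH => u un; have := H (rcons u i); rewrite size_rcons un cat_rcons; apply.
rewrite normrM normfV normr_nat factS natrM exprS invfM.
set K := _ / _ * M in H'.
have -> : 3 * `|v| * (3 * `|v|) ^+ n * (n.+1%:R^-1 * n`!%:R^-1) * M =
  n.+1%:R^-1 * (3 * `|v| * K) by rewrite /K; ring.
apply: ler_wpM2l => //; apply: le_trans (ler_norm_sum _ _ _) _.
apply: (@le_trans _ _ (\sum_(i < 3) `|v| * K)).
  apply: ler_sum => i _; rewrite normrM; apply: ler_pM => //; exact: coord_le_norm.
by rewrite sumr_const card_ord -[(_ * K) *+ 3]mulr_natl mulrA lexx.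
Qed.

Lemma tay_ext n c c' v w w' : (forall u, c (u ++ w) = c' (u ++ w')) -> tay n c v w = tay n c' v w'.
Proof.
elim: n w w' => [|n IH] w w' H /=; first exact: (H [::]).
congr (_ * _); apply: eq_bigr => i _; congr (_ * _); apply: IH => u.
by rewrite -!cat_rcons.
Qed.

Definition psym c := forall u u', perm_eq u u' -> c u = c u'.

Lemma tay_perm n c v w w' : psym c -> perm_eq w w' -> tay n c v w = tay n c v w'.
Proof. by move=> cs ww; apply: tay_ext => u; apply: cs; rewrite perm_cat2l. Qed.

Lemma path_is_derive (a v : V) w (t : R) : kdom 0 (t *: v + a) ->
  is_derive t (1 : R) (fun t : R => D w r (t *: v + a)) (\sum_i v 0 i * D (i :: w) r (t *: v + a)).
Proof. by move=> k; apply: is_derive_line; apply: dword_is_derive_dir. Qed.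

Lemma tay_is_derive n (a v : V) w (t : R) : kdom 0 (t *: v + a) ->
  is_derive t (1 : R) (fun t : R => tay n (fun u => D u r (t *: v + a)) v w)
    (n.+1%:R * tay n.+1 (fun u => D u r (t *: v + a)) v w).
Proof.
move=> k; elim: n w => [|n IH] w.
  by rewrite /= invr1 !mul1r; apply: path_is_derive.
have H i := IH (i :: w).
have h := @is_derive_sum _ _ _ 3 (fun i (t : R) => v 0 i * tay n (fun u => D u r (t *: v + a)) v (i :: w)) t 1
  (fun i => v 0 i * (n.+1%:R * tay n.+1 (fun u => D u r (t *: v + a)) v (i :: w)))
  (fun i => @is_deriveZ _ _ _ (fun t : R => tay n (fun u => D u r (t *: v + a)) v (i :: w)) (v 0 i) t 1 _ (H i)).
have := @is_deriveZ _ _ _ _ (n.+1%:R^-1) t 1 _ h.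
have -> : n.+1%:R^-1 \*: \sum_(i < 3) (fun t : R => v 0 i * tay n (fun u => D u r (t *: v + a)) v (i :: w)) =
  (fun t : R => tay n.+1 (fun u => D u r (t *: v + a)) v w).
  by apply/funext => t'; rewrite /= fct_sumE.
move=> E; apply: is_derive_eq E _.
set T := tay n.+1; rewrite [tay n.+2 _ _ _]/= -/T mulrA divff ?mul1r; last by rewrite pnatr_eq0.
rewrite /GRing.scale /= mulr_sumr; apply: eq_bigr => i _.
set X := T _ v (i :: w); rewrite -[RHS]/(v 0 i * X); field.
by rewrite nat1r pnatr_eq0.
Qed.

(** [F n] stands for the n-th derivative divided by n!. The sum of (1-s)^k F_k(s) over k < N is the
    Taylor polynomial at s = 0 and F_0(1) at s = 1; its derivative telescopes to N (1-s)^(N-1)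
    F_N(s), whose absolute value is at most that of the derivative of - K (1-s)^N. *)
Lemma taylor_remainder N (F : nat -> R -> R) (K : R) :
  (forall n (t : R), 0 <= t <= 1 -> is_derive t (1 : R) (F n) (n.+1%:R * F n.+1 t)) ->
  (forall t, 0 <= t <= 1 -> `|F N t| <= K) ->
  `|F 0%N 1 - \sum_(n < N) F n 0| <= K.
Proof.
move=> dF FK; case: N FK => [|N] FK; first by rewrite big_ord0 subr0; apply: FK; rewrite ler01 lexx.
pose H n (s : R) : R := \sum_(k < n) (1 - s) ^+ k * F k s.
have d1 (s : R) : is_derive s (1 : R) (fun s : R => 1 - s) (- 1).
  have := @is_deriveB _ _ _ (fun=> 1 : R) (fun s : R => s) s 1 0 1 (is_derive_cst _ _ _) (is_derive_id _ _).
  by rewrite sub0r.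
have dp k (s : R) : is_derive s (1 : R) (fun s : R => (1 - s) ^+ k) (- (k%:R * (1 - s) ^+ k.-1)).
  have := @is_deriveX _ _ (fun s : R => 1 - s) k s 1 _ (d1 s).
  have -> : (fun s : R => 1 - s) ^+ k = (fun s : R => (1 - s) ^+ k) by apply/funext => y; rewrite exprfctE.
  by move=> E; apply: is_derive_eq E _; rewrite /GRing.scale /= mulrN1.
have dH n (s : R) : 0 <= s <= 1 -> is_derive s (1 : R) (H n) (n%:R * (1 - s) ^+ n.-1 * F n s).
  move=> s01; elim: n => [|n IH].
    have -> : H 0%N = fun=> 0 by apply/funext => y; rewrite /H big_ord0.
    by rewrite !mul0r; exact: is_derive_cst.
  have -> : H n.+1 = H n + (fun s : R => (1 - s) ^+ n) * F n.
    by apply/funext => y; rewrite /H big_ord_recr.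
  have h := @is_deriveM _ _ (fun s : R => (1 - s) ^+ n) (F n) s 1 _ _ (dp n s) (dF n s s01).
  apply: is_derive_eq (@is_deriveD _ _ _ _ _ s 1 _ _ IH h) _.
  by rewrite /GRing.scale /=; ring.
have dM (s : R) : 0 <= s <= 1 -> is_derive s (1 : R) (fun s : R => - K * (1 - s) ^+ N.+1) (K * (N.+1%:R * (1 - s) ^+ N)).
  move=> _; apply: is_derive_eq (@is_deriveZ _ _ _ (fun s : R => (1 - s) ^+ N.+1) (- K) s 1 _ (dp N.+1 s)) _.
  by rewrite /GRing.scale /=; ring.
have := deriv_maj ler01 (dH N.+1) dM.
rewrite /H !subrr expr0n mulr0 sub0r subr0 expr1n mulr1 opprK.
have -> : \sum_(k < N.+1) 0 ^+ k * F k 1 = F 0%N 1.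
  by rewrite big_ord_recl expr0 mul1r big1 ?addr0 // => i _; rewrite expr0n mul0r.
have -> : \sum_(k < N.+1) 1 ^+ k * F k 0 = \sum_(k < N.+1) F k 0.
  by apply: eq_bigr => k _; rewrite expr1n mul1r.
apply=> s s01; have s1 : 0 <= 1 - s by case/andP: s01; lra.
have p0 : 0 <= N.+1%:R * (1 - s) ^+ N by rewrite mulr_ge0 // exprn_ge0.
by rewrite normrM /= (ger0_norm p0) mulrC; apply: ler_wpM2r => //; exact: FK.
Qed.

(** A binomial coefficient is at most 2^(n+m). The bound separates the factorial of the remainder
    order, which Taylor's formula cancels, from that of the order of [w]. *)
Lemma fact_add_le n m : ((n + m)`! <= 2 ^ (n + m) * (n`! * m`!))%N.
Proof.
have H : ('C(n + m, m) <= 2 ^ (n + m))%N.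
  have := @Pascal 1 1 (n + m); rewrite addn1 => ->.
  under eq_bigr do rewrite !exp1n !muln1.
  have im : (m < (n + m).+1)%N by rewrite ltnS leq_addl.
  by rewrite (bigD1 (Ordinal im)) //= leq_addr.
have := bin_fact (leq_addl n m); rewrite addnK => <-.
by rewrite [(n`! * _)%N]mulnC leq_mul2r H orbT.
Qed.

(** In 18 = 3 * 3 * 2 the factors come from the three coordinates in [tay_bound], the base of the
    derivative bounds and the binomial estimate; 6 = 3 * 2 collects the last two for the letters of
    [w]. *)
Lemma taylor_est N w (a v : V) (d L : R) : 0 < d ->
  (forall t : R, 0 <= t <= 1 -> d <= `|t *: v + a| <= L) ->
  `|D w r (v + a) - \sum_(n < N) tay n (fun u => D u r a) v w| <=
  6 ^+ size w * (size w)`!%:R * (3 * L * d^-1 ^+ size w) * (18 * `|v| / d) ^+ N.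
Proof.
move=> d0 H.
have kd t : 0 <= t <= 1 -> kdom 0 (t *: v + a).
  by move=> /H /andP[h _]; apply/kdom0P; exact: lt_le_trans h.
have L0 : 0 <= L.
  have z01 : ((0 : R) <= 0) && ((0 : R) <= 1).
    by apply/andP; split; [exact: lexx | exact: ler01].
  by have /andP[_ h2] := H _ z01; apply: le_trans h2.
pose F n (t : R) := tay n (fun u => D u r (t *: v + a)) v w.
have := @taylor_remainder N F (6 ^+ size w * (size w)`!%:R * (3 * L * d^-1 ^+ size w) * (18 * `|v| / d) ^+ N).
rewrite /F scale1r; under eq_bigr do rewrite scale0r add0r.
apply; first by move=> n t t01; apply: tay_is_derive; exact: kd.
move=> t t01; set m := size w.
have B u : size u = N -> `|D (u ++ w) r (t *: v + a)| <=
    3 ^+ (N + m) * (N + m)`!%:R * (3 * L * d^-1 ^+ (N + m)).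
  by move=> uN; have := dword_ker_bound (u ++ w) d0 (H t t01); rewrite size_cat uN.
apply: le_trans (tay_bound _ B) _.
have f0 : 0 < N`!%:R :> R by rewrite ltr0n fact_gt0.
have fE : (N + m)`!%:R <= 2 ^+ (N + m) * (N`!%:R * m`!%:R) :> R.
  by rewrite -natrX -!natrM ler_nat fact_add_le.
have p0 : 0 <= (3 * `|v|) ^+ N / N`!%:R * 3 ^+ (N + m) * (3 * L * d^-1 ^+ (N + m)).
  by rewrite !mulr_ge0 ?exprn_ge0 ?invr_ge0 ?mulr_ge0 ?ler0n // ltW.
have -> : (3 * `|v|) ^+ N / N`!%:R * (3 ^+ (N + m) * (N + m)`!%:R * (3 * L * d^-1 ^+ (N + m))) =
  (3 * `|v|) ^+ N / N`!%:R * 3 ^+ (N + m) * (3 * L * d^-1 ^+ (N + m)) * (N + m)`!%:R by ring.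
apply: le_trans (ler_wpM2l p0 fE) _; rewrite le_eqVlt; apply/orP; left; apply/eqP.
have -> : (18 : R) = 3 * 3 * 2 by ring.
have -> : (6 : R) = 3 * 2 by ring.
by rewrite !exprMn !exprD; field; rewrite lt0r_neq0.
Qed.

Lemma tay_sum (I : Type) (l : seq I) n (c : I -> seq 'I_3 -> R) v w :
  \sum_(k <- l) tay n (c k) v w = tay n (fun u => \sum_(k <- l) c k u) v w.
Proof.
elim: n w => [|n IH] w //=; rewrite -mulr_sumr exchange_big /=; congr (_ * _).
by apply: eq_bigr => i _; rewrite -mulr_sumr IH.
Qed.

Lemma tay_zero n v w : tay n (fun=> 0) v w = 0.
Proof.
by elim: n w => [|n IH] w //=; rewrite big1 ?mulr0 // => i _; rewrite IH mulr0.
Qed.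

Lemma smooth_tay n c w : smooth setT (fun v => tay n c v w).
Proof.
elim: n w => [|n IH] w /=; first exact: smooth_const.
apply: smooth_scale; first exact: openT.
apply: smooth_sum => [|i]; first exact: openT.
by apply: smooth_mul => //; [exact: openT | apply: smooth_coord; exact: openT].
Qed.

Lemma pd_tay0 c w j x : pd j (fun v => tay 0 c v w) x = 0.
Proof. by rewrite /= pd_cst. Qed.

(* The sum over [i] below is Euler's identity for the homogeneous polynomial
   [tay n.+1 c x (j :: w)]. *)
Lemma pd_tay n c w j x : psym c ->
  pd j (fun v => tay n.+1 c v w) x = tay n c x (j :: w).
Proof.
move=> cs; elim: n w x => [|n IH] w x.
  apply: pd_is_derive.
  have h := @is_derive_sum _ _ _ 3 (fun i (v : V) => c (i :: w) * v 0 i) x (delta_mx 0 j)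
    (fun i => c (i :: w) * (j == i)%:R)
    (fun i => @is_deriveZ _ _ _ (fun v : V => v 0 i) (c (i :: w)) x (delta_mx 0 j) _ (coord_is_derive x j i)).
  have -> : (fun v => tay 1 c v w) = \sum_(i < 3) (fun v : V => c (i :: w) * v 0 i).
    by apply/funext => v; rewrite /= fct_sumE invr1 mul1r; apply: eq_bigr => i _; rewrite mulrC.
  apply: is_derive_eq h _; rewrite /= (bigD1 j) //= eqxx mulr1 big1 ?addr0 // => i ij.
  by rewrite eq_sym (negbTE ij) mulr0.
apply: pd_is_derive.
have dT i : is_derive x (delta_mx 0 j) (fun v => tay n.+1 c v (i :: w)) (tay n c x (j :: i :: w)).
  rewrite -IH; apply: smooth_is_derive (smooth_tay n.+1 c (i :: w)) _; exact: I.
have h := @is_derive_sum _ _ _ 3 (fun i (v : V) => v 0 i * tay n.+1 c v (i :: w)) x (delta_mx 0 j)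
    _ (fun i => @is_deriveM _ _ (fun v : V => v 0 i) (fun v => tay n.+1 c v (i :: w)) x (delta_mx 0 j) _ _ (coord_is_derive x j i) (dT i)).
have := @is_deriveZ _ _ _ _ (n.+2%:R^-1) x (delta_mx 0 j) _ h.
have -> : n.+2%:R^-1 \*: \sum_(i < 3) (fun v : V => v 0 i * tay n.+1 c v (i :: w)) =
   (fun v => tay n.+2 c v w).
  by apply/funext => v; rewrite /= fct_sumE.
move=> E; apply: is_derive_eq E _.
have TE : n.+1%:R * tay n.+1 c x (j :: w) = \sum_(i < 3) x 0 i * tay n c x [:: j, i & w].
  rewrite /= mulrA divff ?mul1r ?pnatr_eq0 //; apply: eq_bigr => i _; congr (_ * _).
  by apply: tay_perm => //; apply/permP => p /=; rewrite addnCA.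
move: (tay n.+1 c x) TE => T TE.
rewrite big_split -TE [X in _ *: (_ + X)](bigD1 j) //= eqxx big1 ?addr0; last first.
  by move=> i ij; rewrite eq_sym (negbTE ij) scaler0.
rewrite /GRing.scale /=; field.
by rewrite -natrD pnatr_eq0.
Qed.

End Taylor.

(** * Potentials with poles in the control set *)

Section TestFunctionals.
Context {R : realType} {d : nat}.
Local Notation V := 'rV[R]_d.
Implicit Types (x y : V) (f phi psi : V -> R) (T : (V -> R) -> R).

Definition tlin T := forall c phi psi, tf phi -> tf psi ->
  T (fun x => c * phi x + psi x) = c * T phi + T psi.

(** Continuity is expressed with balls and words in place of compact sets and multi-indices;
    differentiating the test function then merely replaces [L] by [L + 1] and lengthens the
    words. *)
Definition tbnd T := forall L : R, exists (C : R) (N : nat), 0 <= C /\ forall phi (M : R), tf phi ->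
  (forall x, L <= `|x| -> phi x = 0) ->
  (forall s x, (size s <= N)%N -> `|D s phi x| <= M) -> `|T phi| <= C * M.

Definition tdist T := tlin T /\ tbnd T.

Lemma tlin0 T : tlin T -> T (fun=> 0) = 0.
Proof.
move=> Tl; transitivity (T (fun x => -1 * (fun=> 0 : R) x + (fun=> 0 : R) x)).
  by congr T; apply/funext => x; rewrite mulr0 addr0.
by rewrite (Tl (-1) _ _ tf0 tf0) mulN1r addNr.
Qed.

Lemma tlin_scale T c phi : tlin T -> tf phi -> T (fun x => c * phi x) = c * T phi.
Proof.
move=> Tl tp; rewrite -[RHS]addr0 -(tlin0 Tl) -Tl //; last exact: tf0.
by congr T; apply/funext => x; rewrite addr0.
Qed.

Lemma tlin_sum T (I : Type) (l : seq I) (F : I -> V -> R) : tlin T -> (forall i, tf (F i)) ->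
  T (fun x => \sum_(i <- l) F i x) = \sum_(i <- l) T (F i).
Proof.
move=> Tl tF; elim: l => [|i l IH].
  rewrite big_nil -[RHS](tlin0 Tl); congr T; apply/funext => x; exact: big_nil.
rewrite big_cons -IH -[T (F i)]mul1r -Tl //; last exact: tf_sum.
by congr T; apply/funext => x; rewrite big_cons mul1r.
Qed.

Lemma tdist_lin c T T' : tdist T -> tdist T' -> tdist (fun phi => c * T phi + T' phi).
Proof.
move=> [Tl Tb] [Tl' Tb']; split.
  by move=> k phi psi tp tq; rewrite Tl // Tl' //; ring.
move=> L; have [C [N [C0 H]]] := Tb L; have [C' [N' [C0' H']]] := Tb' L.
exists (`|c| * C + C'), (maxn N N'); split; first by rewrite addr_ge0 // mulr_ge0.
move=> phi M tp z HM; rewrite mulrDl -mulrA; apply: le_trans (ler_normD _ _) _; apply: lerD.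
  rewrite normrM; apply: ler_wpM2l => //; apply: H => // s x sN.
  by apply: HM; apply: leq_trans sN (leq_maxl _ _).
by apply: H' => // s x sN; apply: HM; apply: leq_trans sN (leq_maxr _ _).
Qed.

Lemma tdist_add T T' : tdist T -> tdist T' -> tdist (fun phi => T phi + T' phi).
Proof.
move=> tT tT'; rewrite (_ : (fun _ => _) = fun phi => 1 * T phi + T' phi); first exact: tdist_lin.
by apply/funext => phi; rewrite mul1r.
Qed.

Lemma tdist0 : tdist (fun=> 0).
Proof.
split=> [c phi psi _ _|L]; first by rewrite mulr0 addr0.
by exists 0, 0%N; split=> // phi M _ _ _; rewrite mul0r normr0.
Qed.

Lemma tdist_sum (I : Type) (l : seq I) (c : I -> R) (T : I -> (V -> R) -> R) :
  (forall i, tdist (T i)) -> tdist (fun phi => \sum_(i <- l) c i * T i phi).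
Proof.
move=> H; elim: l => [|i l IH].
  rewrite (_ : (fun _ => _) = fun=> 0); first exact: tdist0.
  by apply/funext => phi; rewrite big_nil.
rewrite (_ : (fun _ => _) = fun phi => c i * T i phi + \sum_(i <- l) c i * T i phi).
  exact: tdist_lin.
by apply/funext => phi; rewrite big_cons.
Qed.

Lemma tdist_dword T s : tdist T -> tdist (fun phi => T (D s phi)).
Proof.
move=> [Tl Tb]; split.
  move=> c phi psi tp tq; rewrite -Tl; [|exact: tf_dword|exact: tf_dword].
  congr T; apply/funext => x.
  by apply: (dword_lin c s openT) => //; exact: tf_smooth.
move=> L; have [C [N [C0 H]]] := Tb (L + 1).
exists C, (N + size s)%N; split=> // phi M tp z HM; apply: H; first exact: tf_dword.
  exact: tf_zero_dword.
by move=> t x tN; rewrite -dword_cat; apply: HM; rewrite size_cat leq_add2r.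
Qed.

Lemma tf_mul_cont_int f c phi psi : continuous f -> tf phi -> tf psi ->
  rint (fun x => f x * (c * phi x + psi x)) =
  c * rint (fun x => f x * phi x) + rint (fun x => f x * psi x).
Proof.
move=> cf tp tq; have [L _ u1] := ucc_mul_tf 0 cf tp; have [L' LL' u2] := ucc_mul_tf L cf tq.
rewrite -(integral_lin _ (ucc_wide LL' u1) u2); congr rint; apply/funext => x; ring.
Qed.

Lemma rint_mul_bound f phi (L M C : R) : 0 < L -> continuous f -> tf phi ->
  (forall x, L <= `|x| -> phi x = 0) -> 0 <= C -> (forall x, `|x| <= L -> `|f x| <= C) ->
  (forall x, `|phi x| <= M) -> `|rint (fun x => f x * phi x)| <= C * (2 * L) ^+ d * M.
Proof.
move=> L0 cf tp z C0 HC HM; have M0 : 0 <= M := le_trans (normr_ge0 _) (HM 0).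
rewrite mulrAC; apply: integral_bound; [|exact: mulr_ge0|].
  apply: continuous_ucc => // [x|x /z ->]; last by rewrite mulr0.
  apply: (@continuousM _ _ f phi); [exact: cf | exact: smooth_continuous (tf_smooth tp) _].
move=> x; have [xL|Lx] := leP `|x| L; last by rewrite z ?mulr0 ?normr0 ?mulr_ge0 // ltW.
by rewrite normrM; apply: ler_pM => //; exact: HC.
Qed.

Lemma continuous_bounded_on f (L : R) : continuous f ->
  exists2 C : R, 0 <= C & forall x, `|x| <= L -> `|f x| <= C.
Proof.
move=> cf; have cA : compact (f @` [set x | `|x| <= L]).
  apply: continuous_compact; last exact: compact_ball.
  exact: continuous_subspaceT.
have [M [_ HM]] := compact_bounded cA.
exists (`|M| + 1); first by rewrite addr_ge0.
move=> y yL; apply: (HM (`|M| + 1)); first by apply: le_lt_trans (ler_norm _) _; rewrite ltrDl.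
by exists y.
Qed.

Lemma tdist_rint f : continuous f -> tdist (fun phi => rint (fun x => f x * phi x)).
Proof.
move=> cf; split=> [c phi psi tp tq|L]; first exact: tf_mul_cont_int.
pose L' := `|L| + 1; have L0 : 0 < L' by rewrite ltr_wpDl.
have [C C0 HC] := continuous_bounded_on L' cf.
exists (C * (2 * L') ^+ d), 0%N; split; first by rewrite mulr_ge0 // exprn_ge0 // mulr_ge0 // ltW.
move=> phi M tp z HM; apply: rint_mul_bound => //; last by move=> x; exact: (HM [::]).
by move=> x Lx; apply: z; apply: le_trans Lx; rewrite (le_trans (ler_norm _)) // lerDl.
Qed.

Lemma tdist_is_distribution T : tdist T -> is_distribution T.
Proof.
move=> [Tl Tb]; split=> [c phi psi /test_fun_tf tp /test_fun_tf tq|L cL]; first exact: Tl.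
have [M [_ HM]] := compact_bounded cL.
have [C [N [C0 H]]] := Tb (`|M| + 2); exists C, N => phi B tp sL B0 HB.
have tp' := test_fun_tf tp; apply: H => // [x Lx|s x sN].
  apply: tsupp_out => /sL Lx'; move: Lx; apply/negP; rewrite -ltNge.
  apply: le_lt_trans (_ : `|M| + 1 < _); last by rewrite ltrD2l ltrDl.
  apply: (HM (`|M| + 1)) => //; first by apply: le_lt_trans (ler_norm _) _; rewrite ltrDl.
rewrite (dword_mder s openT (tf_smooth tp')) //.
by apply: HB; rewrite sum_count.
Qed.

End TestFunctionals.

Section Potentials.
Context {R : realType}.
Local Notation V := 'rV[R]_3.
Local Notation word := (seq 'I_3).
Implicit Types (x y v a : V) (w u s : word) (K E W : set V) (b f phi : V -> R).
Local Notation r := (ker 0).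

Lemma open_punctured a : open [set y | y != a].
Proof.
have -> : [set y | y != a] = [set y | kdom 0 (y - a)].
  apply/seteqP; split=> y /=; first by rewrite -subr_eq0 -normr_gt0 => /kdom0P.
  by move=> /kdom0P; rewrite normr_gt0 subr_eq0.
by apply: open_shift; exact: open_kdom.
Qed.

Lemma kdom0_sub y a : y != a -> kdom 0 (y - a).
Proof. by move=> ya; apply/kdom0P; rewrite normr_gt0 subr_eq0. Qed.

Lemma smooth_ker_shift a w : smooth [set y | y != a] (fun y => D w r (y - a)).
Proof.
have := smooth_shift a (@open_kdom R 0) (smooth_dword w (@smooth_ker R 0)).
by apply: smooth_sub => y; exact: kdom0_sub.
Qed.

(* [pot K E b]: near [K] the function [b] coincides with a distribution on
   the whole space whose bilaplacian is a combination of derivatives of Dirac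
   masses at points of [E]. *)
Definition pot K E b := exists (T : (V -> R) -> R) (W : set V) (l : seq (R * word * V)),
  [/\ [/\ open W, K `<=` W & smooth W b],
      tdist T,
      (forall phi, tf phi -> tsupp phi `<=` W -> T phi = rint (fun x => b x * phi x)) &
      (forall p, p \in l -> E p.2) /\
      (forall phi, tf phi -> T (lap (lap phi)) = \sum_(p <- l) p.1.1 * D p.1.2 phi p.2)].

Lemma pot_lin K E c b b' : pot K E b -> pot K E b' -> pot K E (fun x => c * b x + b' x).
Proof.
move=> [T [W [l [[oW KW sb] Td Tw [lE TE]]]]] [T' [W' [l' [[oW' KW' sb'] Td' Tw' [lE' TE']]]]].
exists (fun phi => c * T phi + T' phi), (W `&` W'),
  ([seq (c * p.1.1, p.1.2, p.2) | p <- l] ++ l').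
have oI := openI oW oW'.
have s1 : smooth (W `&` W') b by apply: smooth_sub sb => x [].
have s2 : smooth (W `&` W') b' by apply: smooth_sub sb' => x [].
split.
- split=> //; first by move=> x Kx; split; [exact: KW | exact: KW'].
  exact: smooth_lin.
- exact: tdist_lin.
- move=> phi tp sW; have sW1 : tsupp phi `<=` W by move=> x /sW [].
  have sW2 : tsupp phi `<=` W' by move=> x /sW [].
  rewrite Tw // Tw' // -tf_int_lin; last exact: tf_mul_tsupp oW' sb' tp sW2.
    by congr rint; apply/funext => x; ring.
  exact: tf_mul_tsupp oW sb tp sW1.
- split.
    move=> p; rewrite mem_cat => /orP[/mapP[q ql ->]|pl]; [exact: (lE q ql) | exact: lE'].
  move=> phi tp; rewrite TE // TE' // big_cat big_map /= mulr_sumr; congr (_ + _).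
  by apply: eq_bigr => p _; rewrite mulrA.
Qed.

(** Integration by parts moves the bilaplacian onto [P], so the list of Dirac terms is empty. *)
Lemma pot_biharmonic K E P : smooth setT P -> (forall x, lap (lap P) x = 0) -> pot K E P.
Proof.
move=> sP P0; have oT := @openT V.
exists (fun phi => rint (fun x => P x * phi x)), setT, [::].
have cP : continuous P by move=> x; exact: smooth_continuous sP _.
split=> //; first exact: tdist_rint.
- split=> // phi tp; rewrite big_nil (by_parts_lap oT sP (tf_lap tp)) //.
  rewrite (by_parts_lap oT (smooth_lap oT sP) tp) //.
  rewrite -[RHS](@tf_int0 R 3).
  by congr rint; apply/funext => x; rewrite P0 mul0r.
Qed.

Lemma pot0 K E : pot K E (fun=> 0).
Proof.
apply: pot_biharmonic; first exact: smooth_const.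
have l0 : lap (fun _ : V => 0 : R) = (fun=> 0).
  by apply/funext => x; rewrite /lap big1 // => i _; rewrite dword_cst.
by move=> x; rewrite !l0.
Qed.

Lemma continuous_ker_sub a : continuous (fun y : V => r (y - a)).
Proof.
by move=> y; apply: continuous_comp; [exact: continuous_subr_cst | exact: continuous_ker].
Qed.

Lemma lap_dword_comm s phi x : smooth setT phi -> lap (D s phi) x = D s (lap phi) x.
Proof.
move=> sp; rewrite (dword_lap _ openT) //; apply: eq_bigr => i _.
have -> : D [:: i; i] (D s phi) x = D ([:: i; i] ++ s) phi x by [].
by apply: (dword_perm openT sp I); rewrite perm_catC.
Qed.

(** High derivatives of the norm are not integrable at the pole, so the distribution is defined with
    the derivative on the test function. It agrees with the function away from [e] by integration by
    parts, and its bilaplacian is [fundamental] applied to [D w phi]. *)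
Lemma pot_singular K E e w : E e -> ~ K e -> pot K E (fun x => D w r (x - e)).
Proof.
move=> Ee nKe; have ck := @continuous_ker_sub e; have oW := @open_punctured e.
have sr : smooth [set y | y != e] (fun y => r (y - e)) := smooth_ker_shift e [::].
exists (fun phi => (-1) ^+ size w * rint (fun y => r (y - e) * D w phi y)), [set y | y != e],
  [:: ((-1) ^+ size w * bilap_cst, w, e)]; split.
- split=> //; last exact: smooth_ker_shift.
  by move=> x Kx /=; apply/negP => /eqP xe; apply: nKe; rewrite -xe.
- rewrite (_ : (fun _ => _) = fun phi => (-1) ^+ size w * rint (fun y => r (y - e) * D w phi y) + 0).
    apply: tdist_lin (tdist_dword w (tdist_rint ck)) tdist0.
  by apply/funext => phi; rewrite addr0.
- move=> phi tp tW; rewrite (by_parts w oW sr tp tW) mulrA -expr2 sqrr_sign mul1r.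
  by congr rint; apply/funext => y; rewrite dword_shift.
- split; first by move=> p; rewrite inE => /eqP ->.
  move=> phi tp; rewrite big_seq1 /= -mulrA; congr (_ * _).
  rewrite -fundamental; last exact: tf_dword.
  congr rint; apply/funext => y; congr (_ * _); have st := tf_smooth tp.
  rewrite -(lap_dword_comm w _ (smooth_lap openT st)).
  apply: (lap_local openT) => // z _; rewrite lap_dword_comm //.
Qed.

(* A jet field [J] (thought of as [J s x = D s f x]) is approximable if it is
   a limit of potentials uniformly on [K] for every number of derivatives. *)
Definition approximable K E (J : word -> V -> R) := forall (m : nat) (e : R), 0 < e ->
  exists2 b, pot K E b & forall s x, (size s <= m)%N -> K x -> `|D s b x - J s x| <= e.

Lemma approximable_lim K E J : (forall (m : nat) (e : R), 0 < e -> exists2 J', approximable K E J' &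
    forall s x, (size s <= m)%N -> K x -> `|J' s x - J s x| <= e) -> approximable K E J.
Proof.
move=> H m e e0; have e2 : 0 < e / 2 by rewrite divr_gt0.
have [J' aJ HJ] := H m _ e2; have [b pb Hb] := aJ m _ e2.
exists b => // s x sm Kx; rewrite [e]splitr.
by apply: le_trans (ler_distD (J' s x) _ _) _; apply: lerD; [exact: Hb | exact: HJ].
Qed.

Lemma approximable_eq K E J J' : (forall s x, K x -> J s x = J' s x) -> approximable K E J -> approximable K E J'.
Proof.
move=> JJ aJ; apply: approximable_lim => m e e0; exists J => // s x _ Kx.
by rewrite JJ // subrr normr0 ltW.
Qed.

Lemma approximable_pot K E b : pot K E b -> approximable K E (fun s x => D s b x).
Proof. by move=> pb m e e0; exists b => // s x _ _; rewrite subrr normr0 ltW. Qed.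

Lemma pot_smooth K E b : pot K E b -> exists W, [/\ open W, K `<=` W & smooth W b].
Proof. by move=> [T [W [l [[oW KW sb] _ _ _]]]]; exists W. Qed.

Lemma approximable_lin K E c J J' : approximable K E J -> approximable K E J' ->
  approximable K E (fun s x => c * J s x + J' s x).
Proof.
move=> aJ aJ' m e e0.
have c0 : 0 < `|c| + 1 by rewrite ltr_wpDl.
have e2 : 0 < e / 2 by rewrite divr_gt0.
have e3 : 0 < e / 2 / (`|c| + 1) by rewrite divr_gt0.
have [b pb Hb] := aJ m _ e3; have [b' pb' Hb'] := aJ' m _ e2.
exists (fun x => c * b x + b' x); first exact: pot_lin.
have [W [oW KW sb]] := pot_smooth pb; have [W' [oW' KW' sb']] := pot_smooth pb'.
move=> s x sm Kx.
have oI := openI oW oW'.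
have s1 : smooth (W `&` W') b by apply: smooth_sub sb => z [].
have s2 : smooth (W `&` W') b' by apply: smooth_sub sb' => z [].
rewrite (dword_lin c s oI s1 s2); last by split; [exact: KW | exact: KW'].
have -> : c * D s b x + D s b' x - (c * J s x + J' s x) =
  c * (D s b x - J s x) + (D s b' x - J' s x) by ring.
apply: le_trans (ler_normD _ _) _; rewrite [e]splitr; apply: lerD; last exact: Hb'.
rewrite normrM; apply: le_trans (_ : (`|c| + 1) * (e / 2 / (`|c| + 1)) <= _); last first.
  by rewrite mulrC divfK // lt0r_neq0.
by apply: ler_pM => //; [rewrite lerDl | exact: Hb].
Qed.

Lemma approximable0 K E : approximable K E (fun _ _ => 0).
Proof.
apply: approximable_eq (approximable_pot (pot0 K E)) => s x _.
by case: s => // i s; rewrite dword_cst.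
Qed.

Lemma approximable_sum K E (I : eqType) (l : seq I) (c : I -> R) (J : I -> word -> V -> R) :
  (forall i, i \in l -> approximable K E (J i)) ->
  approximable K E (fun s x => \sum_(i <- l) c i * J i s x).
Proof.
elim: l => [|i l IH] H.
  by apply: approximable_eq (approximable0 K E) => s x _; rewrite big_nil.
have h1 : approximable K E (J i) by apply: H; rewrite inE eqxx.
have h2 : approximable K E (fun s x => \sum_(i <- l) c i * J i s x).
  by apply: IH => j jl; apply: H; rewrite inE jl orbT.
by apply: approximable_eq (approximable_lin (c i) h1 h2) => s x _; rewrite big_cons.
Qed.

End Potentials.

(** * Pole pushing *)

Section Pushing.
Context {R : realType}.
Local Notation V := 'rV[R]_3.
Local Notation word := (seq 'I_3).
Implicit Types (x y z v a : V) (w u s : word) (K E W : set V) (b f phi : V -> R).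
Local Notation r := (ker 0).

Lemma half_pow_small (C e : R) : 0 <= C -> 0 < e -> exists N, C * (1 / 2) ^+ N <= e.
Proof.
move=> C0 e0; pose N := (Num.trunc (C / e)).+1; exists N.
have H : C / e < N%:R by rewrite truncnS_gt.
have H2 : N%:R <= 2 ^+ N :> R by rewrite -natrX ler_nat ltnW // ltn_expl.
have p0 : 0 < 2 ^+ N :> R by rewrite exprn_gt0.
rewrite expr_div_n expr1n mulrA mulr1 ler_pdivrMr // mulrC -ler_pdivrMr //.
by apply: le_trans H2; apply: ltW.
Qed.

(* The constant in [taylor_est]. *)
Definition tcst (d L : R) k : R := 6 ^+ k * k`!%:R * (3 * L * d^-1 ^+ k).

Lemma tcst_ge0 d L k : 0 < d -> 0 <= L -> 0 <= tcst d L k.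
Proof.
by move=> d0 L0; rewrite /tcst !mulr_ge0 ?exprn_ge0 ?invr_ge0 // ltW.
Qed.

(** One threshold serves all words up to length [m], and every larger [N] as well; the latter
    matters because differentiating a Taylor polynomial lowers its degree. The condition on [v]
    makes the ratio in [taylor_est] at most 1/2. *)
Lemma taylor_uniform (d L e : R) m : 0 < d -> 0 <= L -> 0 < e -> exists N0, forall N w a v,
  (N0 <= N)%N -> (size w <= m)%N -> 18 * `|v| / d <= 1 / 2 ->
  (forall t : R, 0 <= t <= 1 -> d <= `|t *: v + a| <= L) ->
  `|D w r (v + a) - \sum_(n < N) tay n (fun u => D u r a) v w| <= e.
Proof.
move=> d0 L0 e0; pose C := \sum_(k < m.+1) tcst d L k.
have C0 : 0 <= C by apply: sumr_ge0 => k _; exact: tcst_ge0.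
have [N0 HN0] := half_pow_small C0 e0; exists N0 => N w a v NN wm vd H.
apply: le_trans (taylor_est N w d0 H) _; apply: le_trans HN0.
have q0 : 0 <= 18 * `|v| / d by rewrite divr_ge0 ?mulr_ge0 // ltW.
apply: ler_pM; rewrite ?exprn_ge0 //; first exact: tcst_ge0.
  have wm' : (size w < m.+1)%N by [].
  rewrite /C (bigD1 (Ordinal wm')) //= -/(tcst d L (size w)) lerDl.
  by apply: sumr_ge0 => k _; exact: tcst_ge0.
apply: le_trans (_ : (1 / 2) ^+ N <= _); first by rewrite lerXn2r // nnegrE.
by rewrite ler_wiXn2l //; lra.
Qed.

Definition pole_jet w y s x := D (s ++ w) r (x - y).

(** All derivatives of the kernel are included because the Taylor terms of a displaced kernel
    contain derivatives of every order at the old pole; only then does the property propagate. *)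
Definition good K E y := ~ K y /\ forall w, approximable K E (pole_jet w y).

Lemma ker_psym x : kdom 0 x -> psym (fun u => D u r x).
Proof.
by move=> kx u u' uu; apply: (dword_perm (@open_kdom R 0) (@smooth_ker R 0) kx).
Qed.

Lemma good_pole K E e : E e -> ~ K e -> good K E e.
Proof.
move=> Ee nK; split=> // w; apply: approximable_eq (approximable_pot (pot_singular w Ee nK)) => s x Kx.
by rewrite dword_shift /pole_jet dword_cat.
Qed.

(** By induction a Taylor term is a combination, with coefficients depending on [v] only, of pole
    jets at [y] with [n] more derivatives; the permutation moves the new letter past [s]. *)
Lemma approximable_tay K E y v n w : good K E y ->
  approximable K E (fun s x => tay n (fun u => D u r (x - y)) v (s ++ w)).
Proof.
move=> [nK gy]; elim: n w => [|n IH] w /=; first exact: gy.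
have H := approximable_sum (l := enum 'I_3) (fun i => n.+1%:R^-1 * v 0 i) (fun i _ => IH (i :: w)).
apply: approximable_eq H => s x Kx; rewrite big_enum mulr_sumr; apply: eq_bigr => i _.
rewrite mulrA; congr (_ * _); apply: tay_perm.
  apply: ker_psym; apply: kdom0_sub; apply/negP => /eqP xy; apply: nK; by rewrite -xy.
by rewrite -cat1s perm_catCA.
Qed.

Lemma norm_row_bounded K : compact K -> exists2 B : R, 0 < B & forall x, K x -> `|x| <= B.
Proof.
move=> /compact_bounded [M [_ HM]]; exists (`|M| + 1); first by rewrite ltr_wpDl.
by move=> x Kx; apply: (HM (`|M| + 1)) => //; apply: le_lt_trans (ler_norm _) _; rewrite ltrDl.
Qed.

(** The kernel with pole [y1] is expanded about the one with pole [y0], in the displacement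
    [v = y0 - y1]. Since [v] has norm at most d/36, the ratio 18|v|/d is at most 1/2; since [K] is
    at distance 2d from [y], the segment stays at distance d from the singularity. The two poles
    play symmetric roles around the centre [y]. *)
Lemma good_push K E y (d : R) y0 y1 : compact K -> 0 < d ->
  (forall x, K x -> 2 * d <= `|x - y|) -> `|y0 - y| <= d / 72 -> `|y1 - y| <= d / 72 ->
  good K E y0 -> good K E y1.
Proof.
move=> cK d0 Hd h0 h1 g0; have [B B0 HB] := norm_row_bounded cK.
split.
  move=> K1; have := Hd _ K1; apply/negP; rewrite -ltNge; apply: le_lt_trans h1 _; lra.
move=> w; apply: approximable_lim => m e e0.
have L0 : 0 <= B + `|y| + d by rewrite !addr_ge0 // ltW.
have [N0 HN] := taylor_uniform (m + size w) d0 L0 e0.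
pose v := y0 - y1.
have vb : `|v| <= d / 36.
  have := ler_distD y y0 y1; rewrite -/v [ `|y - y1|]distrC => H; apply: le_trans H _.
  by apply: le_trans (lerD h0 h1) _; lra.
exists (fun s x => \sum_(n < N0) tay n (fun u => D u r (x - y0)) v (s ++ w)).
  have := approximable_sum (l := enum 'I_N0) (fun=> 1) (fun (n : 'I_N0) _ => @approximable_tay K E y0 v n w g0).
  by apply: approximable_eq => s x _; rewrite big_enum; apply: eq_bigr => n _; rewrite mul1r.
move=> s x sm Kx; rewrite distrC /pole_jet.
have -> : x - y1 = v + (x - y0) by rewrite /v [RHS]addrC addrA subrK.
apply: HN => //.
- by rewrite size_cat leq_add2r.
- by rewrite ler_pdivrMr //; lra.
move=> t /andP[t0 t1].
have tv : `|t *: v + (y - y0)| <= d.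
  apply: le_trans (ler_normD _ _) _; rewrite normrZ ger0_norm // [ `|y - y0|]distrC.
  have : t * `|v| <= 1 * `|v| by apply: ler_wpM2r.
  lra.
have -> : t *: v + (x - y0) = (x - y) + (t *: v + (y - y0)) by rewrite [RHS]addrCA; congr (_ + _); rewrite addrA subrK.
have := Hd x Kx; have := HB x Kx; move: (t *: v + (y - y0)) tv => q qd xB dxy.
apply/andP; split.
  have := ler_normB (x - y + q) q; rewrite addrK => H; lra.
apply: le_trans (ler_normD _ _) _; have := ler_normB x y; lra.
Qed.

(** Here the expansion is in [x] about 0, the pole [y] being fixed: a polynomial approximating
    [D w r (x - y)] when [x] is small compared with [y]. *)
Definition far_poly (N : nat) y w x : R := \sum_(n < N) tay n (fun u => D u r (- y)) x w.

Lemma smooth_far_poly N y w : smooth setT (far_poly N y w).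
Proof. by apply: smooth_sum => [|n]; [exact: openT | exact: smooth_tay]. Qed.

Lemma pd_far_poly N y w j x : y != 0 ->
  pd j (far_poly N y w) x = far_poly N.-1 y (j :: w) x.
Proof.
move=> y0; have ps : psym (fun u => D u r (- y)).
  by apply: ker_psym; rewrite -sub0r; apply: kdom0_sub; rewrite eq_sym.
rewrite -[LHS]/(D [:: j] (far_poly N y w) x).
rewrite (dword_sum _ [:: j] (@openT V)) //; last by move=> n; exact: smooth_tay.
case: N => [|N]; first by rewrite /far_poly !big_ord0.
rewrite big_ord_recl [D _ _ _]pd_tay0 add0r; apply: eq_bigr => n _.
exact: pd_tay.
Qed.

Lemma dword_far_poly N y w s x : y != 0 ->
  D s (far_poly N y w) x = far_poly (N - size s) y (s ++ w) x.
Proof.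
move=> y0; elim: s x => [|j s IH] x /=; first by rewrite subn0.
rewrite (pd_local j (@openT V) (fun x _ => IH x)) // pd_far_poly //.
by rewrite subnS.
Qed.

(** Differentiation commutes with taking Taylor polynomials, up to the degree. The result is thus a
    Taylor polynomial at [- y] of a derivative of the bilaplacian of the norm, which vanishes off
    the origin. *)
Lemma bilap_far_poly N y w x : y != 0 -> lap (lap (far_poly N y w)) x = 0.
Proof.
move=> y0; have oT := @openT V; have sP := smooth_far_poly N y w.
have oW := @open_kdom R 0.
have ky : kdom 0 (- y) by rewrite -sub0r; apply: kdom0_sub; rewrite eq_sym.
have ps := ker_psym ky.
rewrite {1}/lap.
transitivity (\sum_k \sum_k' far_poly (N - 4) y ([:: k; k; k'; k'] ++ w) x).
  apply: eq_bigr => k _; rewrite (dword_lap [:: k; k] oT sP I); apply: eq_bigr => k' _.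
  by rewrite dword_far_poly.
rewrite /far_poly.
under eq_bigr do rewrite exchange_big /=.
rewrite exchange_big /= big1 // => n _.
pose c (p : 'I_3 * 'I_3) u := D (u ++ [:: p.1; p.1; p.2; p.2] ++ w) r (- y).
transitivity (\sum_(p : 'I_3 * 'I_3) tay n (c p) x [::]).
  rewrite -(pair_bigA _ (fun k k' => tay n (c (k, k')) x [::])) /=.
  apply: eq_bigr => k _; apply: eq_bigr => k' _; apply: tay_ext => u.
  by rewrite /c cats0.
rewrite tay_sum -[RHS](tay_zero n x [::]); apply: tay_ext => u; rewrite !cats0.
transitivity (D (u ++ w) (lap (lap r)) (- y)); last first.
  rewrite (dword_local (u ++ w) oW (g := fun=> 0)) //.
    by case: (u ++ w) => // i s; rewrite dword_cst.
  by move=> z kz; rewrite bilap_ker // expr0n mulr0 mul0r.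
have sl : smooth (kdom 0) (lap r) := smooth_lap oW (@smooth_ker R 0).
rewrite -(pair_bigA _ (fun k k' => c (k, k') u)) /= (dword_lap (u ++ w) oW sl ky).
apply: eq_bigr => k _; rewrite (dword_lap _ oW (@smooth_ker R 0) ky).
apply: eq_bigr => k' _; rewrite /c /=; apply: ps.
by rewrite -!catA perm_cat2l (perm_catC [:: k; k; k'; k']).
Qed.

(** With d = |y|/2 and |x| at most |y|/72 the ratio 18|x|/d is at most 1/2, and the segment from - y
    to x - y stays at distance d from 0. The approximants are biharmonic polynomials, which have no
    pole at all. *)
Lemma good_far K E y (B : R) : 0 < B -> (forall x, K x -> `|x| <= B) -> 72 * B <= `|y| -> good K E y.
Proof.
move=> B0 HB yB; have y0 : y != 0 by rewrite -normr_gt0; lra.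
split; first by move=> /HB; lra.
move=> w m e e0; pose d := `|y| / 2.
have d0 : 0 < d by rewrite /d; lra.
have L0 : 0 <= B + `|y| by rewrite addr_ge0 // ltW.
have [N0 HN] := taylor_uniform (m + size w) d0 L0 e0.
(* The [m] extra terms ensure that at least [N0] remain after up to [m] derivatives. *)
exists (far_poly (N0 + m) y w).
  apply: pot_biharmonic; first exact: smooth_far_poly.
  by move=> x; exact: bilap_far_poly.
move=> s x sm Kx; rewrite dword_far_poly // distrC /pole_jet; apply: HN.
- by rewrite -addnBA // leq_addr.
- by rewrite size_cat leq_add2r.
- by have := HB x Kx; rewrite ler_pdivrMr // /d; lra.
move=> t /andP[t0 t1]; have xB := HB x Kx.
have tx : `|t *: x| <= B.
  rewrite normrZ ger0_norm //; apply: le_trans xB.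
  by rewrite -[leRHS]mul1r; apply: ler_wpM2r.
apply/andP; split.
  have := ler_normB (t *: x - y) (t *: x); rewrite addrAC subrr sub0r normrN /d; lra.
by apply: le_trans (ler_normB _ _) _; lra.
Qed.

Lemma good_local K E y : compact K -> ~ K y -> exists2 p : R, 0 < p & forall y0 y1,
  `|y0 - y| <= p -> `|y1 - y| <= p -> good K E y0 -> good K E y1.
Proof.
move=> cK nK.
have oK : open (~` K) by apply: closed_openC; apply: compact_closed; [exact: norm_hausdorff | ].
have [e e0 He] := open_rowP oK (nK : (~` K) y).
have d0 : 0 < e / 2 by rewrite divr_gt0.
exists (e / 2 / 72); first by rewrite !divr_gt0.
move=> y0 y1 h0 h1; apply: (good_push cK d0 _ h0 h1) => x Kx.
rewrite leNgt; apply/negP => H; apply: (He x) => //; lra.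
Qed.

(** The good points form a relatively open and closed subset of [C]. Both properties follow from
    [good_local], whose radius does not depend on which of the two poles is the good one. *)
Lemma good_connected K E (C : set V) z : compact K -> connected C -> C `<=` ~` K ->
  C z -> good K E z -> forall y, C y -> good K E y.
Proof.
move=> cK cC CK Cz gz.
pose P := [set y | good K E y].
have E1 : C `&` P = C.
  apply: cC; first by exists z.
  - exists P => //; rewrite openE => y [nK gy].
    have [p p0 Hp] := good_local E cK nK.
    apply/nbhs_rowP; exists p => // y1 /ltW h1; apply: (Hp y) => //.
    by rewrite subrr normr0 ltW.
  - exists (closure P); first exact: closed_closure.
    apply/seteqP; split=> y [Cy Py]; split=> //; first exact: subset_closure.
    have [p p0 Hp] := good_local E cK (CK y Cy).
    have [y0 [Py0 y0y]] := Py [set y1 | `|y1 - y| < p] ((nbhs_rowP _ _).2 (ex_intro2 _ _ p p0 (fun _ h => h))).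
    by apply: (Hp y0) => //; [exact: ltW | rewrite subrr normr0 ltW].
by move=> y; rewrite -E1 => -[].
Qed.

Lemma all_good K E y : compact K -> control_set K E -> ~ K y -> good K E y.
Proof.
move=> cK [cE _] nK; pose C := connected_component (~` K) y.
have CK : C `<=` ~` K by exact: connected_component_sub.
have Cy : C y by exact: connected_component_refl.
have cC : connected C by exact: component_connected.
have [bC|nbC] := pselect (bounded_set C).
  have bc : bounded_component K C by split=> //; exists y.
  have [e [[Ee Ce] _]] := cE C bc.
  apply: (good_connected cK cC CK Ce) => //; apply: good_pole => //; exact: CK.
have [B B0 HB] := norm_row_bounded cK.
(* An unbounded component reaches beyond radius [72 * B], where points are good by [good_far],
   without recourse to [E]. *)
have [z Cz Hz] : exists2 z, C z & 72 * B <= `|z|.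
  apply: contrapT => H; apply: nbC; exists (72 * B); split; first exact: num_real.
  move=> M MB z Cz /=; apply: contrapT => nz; apply: H; exists z => //.
  apply: ltW; apply: lt_trans MB _; rewrite ltNge; exact/negP.
exact: (good_connected cK cC CK Cz (good_far _ B0 HB Hz)).
Qed.

End Pushing.

(** * Riemann sums *)

Section Riemann.
Context {R : realType}.
Local Notation V := 'rV[R]_3.
Local Notation word := (seq 'I_3).
Implicit Types (x y z a b : V) (w u s : word) (K E S W : set V) (h phi : V -> R).
Local Notation r := (ker 0).

(** There are finitely many words of length at most [m], so finitely many conditions on small
    positive numbers hold together. *)
Lemma uniform_words m (P : word -> R -> Prop) :
  (forall s, exists2 e : R, 0 < e & forall e' : R, 0 < e' -> e' <= e -> P s e') ->
  exists2 e : R, 0 < e & forall s, (size s <= m)%N -> P s e.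
Proof.
move=> H.
have F : \forall e \near (0 : R)^'+, forall b : {bseq m of 'I_3}, P b e.
  apply: filter_forall => b; have [e e0 He] := H b.
  near=> t; apply: He; first by near: t; exact: nbhs_right_gt.
  by near: t; exact: nbhs_right_le.
have [e [He e0]] : exists e : R, (forall b : {bseq m of 'I_3}, P b e) /\ 0 < e.
  by apply: (@filter_ex _ ((0 : R)^'+)); apply: filterI F _; exact: nbhs_right_gt.
by exists e => // s sm; exact: (He (Bseq sm)).
Unshelve. all: by end_near. Qed.

Lemma ker0N x : r (0 - x) = r x :> R.
Proof.
rewrite /ker /sqd; congr (Num.sqrt (_ + _)); apply: eq_bigr => i _.
by rewrite !mxE; ring.
Qed.

Lemma dword_kerN s x : kdom 0 x -> D s r x = (-1) ^+ size s * D s r (0 - x).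
Proof.
move=> kx; have k' : kdom 0 (0 - x).
  by apply/kdom0P; rewrite sub0r normrN; exact/kdom0P.
rewrite -(dword_reflect s (@open_kdom R 0) (@smooth_ker R 0) k').
by congr (D s _ x); apply/funext => y; rewrite ker0N.
Qed.

Lemma tsupp_sub S h : closed S -> (forall y, ~ S y -> h y = 0) -> tsupp h `<=` S.
Proof.
move=> cS hS; rewrite /tsupp [X in _ `<=` X](closure_id S).1 //; apply: closureS => y /= hy.
by apply: contrapT => /hS; apply/eqP.
Qed.

(** The sign produced by integration by parts cancels the one from the evenness of the norm, which
    exchanges [y - x] and [x - y]. The pole [x] is off the support of [h], so the kernel is smooth
    where it is differentiated. *)
Lemma potential_jet h S s x : tf h -> closed S -> (forall y, ~ S y -> h y = 0) -> ~ S x ->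
  rint (fun y => r (y - x) * D s h y) = rint (fun y => D s r (x - y) * h y).
Proof.
move=> th cS hS nSx.
have sW : tsupp h `<=` [set y | y != x].
  apply: subset_trans (tsupp_sub cS hS) _.
  by move=> y Sy /=; apply/eqP => yx; apply: nSx; rewrite -yx.
have sk : smooth [set y | y != x] (fun y => r (y - x)) := smooth_ker_shift x [::].
have ox : open [set y | y != x] by exact: open_punctured.
rewrite (by_parts s ox sk th sW).
have tg : tf (fun y => D s (fun y => r (y - x)) y * h y).
  exact: tf_mul_tsupp ox (smooth_dword s sk) th sW.
have := tf_int_lin ((-1) ^+ size s) tg tf0.
have -> : rint (fun _ : V => 0 : R) = 0 by exact: tf_int0.
rewrite addr0 => <-; congr rint; apply/funext => y; rewrite addr0.
have [->|hy] := eqVneq (h y) 0; first by rewrite !mulr0.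
rewrite mulrA; congr (_ * _); rewrite dword_shift.
have yx : y != x.
  by apply/negP => /eqP yx; move/eqP: hy; apply; apply: hS; rewrite yx.
rewrite -[x - y]opprB -(sub0r (y - x)) (dword_kerN s (kdom0_sub yx)).
by rewrite mulrA -expr2 sqrr_sign mul1r.
Qed.

(* Riemann sums: the potential of [h] is a limit of combinations of kernels
   with poles in the support of [h]. *)
Lemma approximable_potential K E h S : compact K -> control_set K E -> tf h -> compact S ->
  (forall y, ~ S y -> h y = 0) -> (forall x, K x -> ~ S x) ->
  approximable K E (fun s x => rint (fun y => r (y - x) * D s h y)).
Proof.
move=> cK cE th cS hS KS; have cS' : closed S by apply: compact_closed => //; exact: norm_hausdorff.
apply: (approximable_eq (J := fun s x => rint (fun y => D s r (x - y) * h y))).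
  by move=> s x Kx; rewrite (potential_jet s th cS' hS (KS _ Kx)).
apply: approximable_lim => m e e0.
have [sh [L L0 hL]] := th; have [C C0 Hquad] := integral_quad 3 L0.
pose e1 := e / (C + 1); have C1 : 0 < C + 1 by rewrite ltr_wpDl.
have e10 : 0 < e1 by rewrite divr_gt0.
have [Mh Mh0 hMh] := tf_bounded th.
(* Where [h] is nonzero the kernel is evaluated on the difference set of [K] and [S], which is
   compact and avoids the origin; the uniform bounds come from there. *)
pose A := [set z : V | exists x y, [/\ K x, S y & z = x - y]].
have cA : compact A.
  have -> : A = (fun p : V * V => p.1 - p.2) @` (K `*` S).
    apply/seteqP; split=> z.
      by move=> [x [y [Kx Sy ->]]]; exists (x, y).
    by move=> [[x y] [/= Kx Sy] <-]; exists x, y.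
  apply: continuous_compact; last exact: compact_setX.
  apply: continuous_subspaceT => p; apply: cvgB; [exact: cvg_fst | exact: cvg_snd].
have kA z : A z -> kdom 0 z.
  move=> [x [y [Kx Sy ->]]]; apply: kdom0_sub; apply/negP => /eqP xy.
  by apply: (KS _ Kx); rewrite xy.
have cD s z : A z -> {for z, continuous (D s r)}.
  by move=> Az; apply: (smooth_continuous (smooth_dword s (@smooth_ker R 0))); exact: kA.
have unif s : exists2 d : R, 0 < d & forall d' : R, 0 < d' -> d' <= d ->
    forall x y y', K x -> `|y - y'| <= d' ->
    `|D s r (x - y) * h y - D s r (x - y') * h y'| <= e1.
  have [M M0 HM] : exists2 M : R, 0 < M & forall z, A z -> `|D s r z| <= M.
    have cI : compact (D s r @` A).
      apply: continuous_compact => //; apply: continuous_in_subspaceT => z.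
      by rewrite inE => Az; exact: cD.
    have [M [_ HM]] := compact_bounded cI; exists (`|M| + 1); first by rewrite ltr_wpDl.
    move=> z Az; apply: (HM (`|M| + 1)); last by exists z.
    by apply: le_lt_trans (ler_norm _) _; rewrite ltrDl.
  have q0 : 0 < e1 / 2 / (Mh + 1) by rewrite !divr_gt0 // ltr_wpDl.
  have [d1 d10 Hd1] := heine cA q0 (cD s).
  have [L' uh] := tf_ucc th; have [_ uch _] := uh.
  have q1 : 0 < e1 / 2 / M by rewrite !divr_gt0.
  have [d2 d20 Hd2] := uch _ q1.
  have half x y y' : K x -> S y' -> `|y - y'| < d1 -> `|y - y'| < d2 ->
      `|D s r (x - y) * h y - D s r (x - y') * h y'| <= e1.
    move=> Kx Sy' y1 y2.
    have -> : D s r (x - y) * h y - D s r (x - y') * h y' =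
      D s r (x - y') * (h y - h y') + (D s r (x - y) - D s r (x - y')) * h y by ring.
    apply: le_trans (ler_normD _ _) _; rewrite [e1]splitr !normrM; apply: lerD.
      have -> : e1 / 2 = M * (e1 / 2 / M) by rewrite [RHS]mulrC divfK // lt0r_neq0.
      apply: ler_pM => //; last by apply: ltW; exact: Hd2.
      by apply: HM; exists x, y'.
    have -> : e1 / 2 = e1 / 2 / (Mh + 1) * (Mh + 1) by rewrite divfK // lt0r_neq0 // ltr_wpDl.
    apply: ler_pM => //; last by apply: le_trans (hMh y) _; rewrite lerDl.
    apply: ltW; apply: Hd1; first by exists x, y'.
    by rewrite opprB addrC addrA subrK distrC.
  exists (Num.min d1 d2 / 2); first by rewrite divr_gt0 // lt_min d10.
  move=> d' d'0 dd x y y' Kx yy.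
  have lm : `|y - y'| < Num.min d1 d2.
    apply: le_lt_trans yy _; apply: le_lt_trans dd _.
    by rewrite gtr_pMr ?invf_lt1 ?ltr1n // lt_min d10.
  move: lm; rewrite lt_min => /andP[y1 y2].
  have [Sy'|nSy'] := pselect (S y'); first exact: half.
  have [Sy|nSy] := pselect (S y); first by rewrite distrC; apply: half => //; rewrite distrC.
  by rewrite !hS // !mulr0 subrr normr0 ltW.
have [d d0 Hd] := uniform_words m unif; have [q Hq] := Hquad _ d0.
(* A quadrature node may fall in [K], where no pole is allowed; [h] vanishes there, and the term is
   replaced by zero. *)
pose J (p : R * V) s x := if h p.2 == 0 then 0 else pole_jet [::] p.2 s x.
exists (fun s x => \sum_(p <- q) p.1 * h p.2 * J p s x).
  apply: approximable_sum => p _; rewrite /J; case: eqP => hp; first exact: approximable0.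
  have nK : ~ K p.2 by move=> Kp; apply: hp; apply: hS; exact: KS.
  by have [_ /(_ [::])] := all_good cK cE nK.
move=> s x sm Kx; rewrite distrC.
have -> : \sum_(p <- q) p.1 * h p.2 * J p s x = \sum_(p <- q) p.1 * (D s r (x - p.2) * h p.2).
  apply: eq_bigr => p _; rewrite /J /pole_jet cats0.
  by case: eqP => [->|_]; rewrite ?mulr0 ?mulr0 // -mulrA [h _ * _]mulrC.
apply: le_trans (_ : C * e1 <= _); last first.
  rewrite /e1 mulrCA -[leRHS]mulr1 ler_pM2l // ler_pdivrMr // mul1r.
  by rewrite lerDl.
apply: Hq; [ | exact: ltW | by move=> y y' yy; apply: Hd].
apply: continuous_ucc => //; last by move=> y yL; rewrite hL // mulr0.
have sW : tsupp h `<=` [set y | kdom 0 (x - y)].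
  by move=> y Sy; apply: kA; exists x, y; split=> //; exact: (tsupp_sub cS' hS).
have oW := open_reflect (a := x) (@open_kdom R 0).
have sr := smooth_reflect x (@open_kdom R 0) (smooth_dword s (@smooth_ker R 0)).
by move=> y; apply: (smooth_continuous (smooth_mul_tsupp oW sr sh sW)).
Qed.

End Riemann.

(** * Factorization of the bilaplacian *)

Section Systems.
Context {R : realType} {n : nat}.
Local Notation V := 'rV[R]_3.
Local Notation word := (seq 'I_3).
Implicit Types (x y : V) (s : word) (W : set V) (f phi psi : V -> R)
  (u v : 'I_n -> V -> R) (T : 'I_n -> (V -> R) -> R) (P Q : 'I_n -> seq (R * 'I_n * word)).

(* A system lists, for each component of a constant-coefficient operator, triples
   (coefficient, component of the argument, word of derivatives). *)
Definition sys_fun P u j x : R := \sum_(q <- P j) q.1.1 * D q.2 (u q.1.2) x.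

Definition sys_dist P T j phi : R :=
  \sum_(q <- P j) q.1.1 * ((-1) ^+ size q.2 * T q.1.2 (D q.2 phi)).

Lemma dword_scale W c f s x : open W -> smooth W f -> W x ->
  D s (fun y => c * f y) x = c * D s f x.
Proof.
move=> oW sf Wx; have := dword_lin c s oW sf (smooth_const W 0) Wx.
rewrite [D s (fun=> 0) x](_ : _ = 0) ?addr0; last by case: (s) => // i t; rewrite dword_cst.
by move=> <-; congr (D s _ x); apply/funext => y; rewrite addr0.
Qed.

Lemma smooth_sys_fun P u W j : open W -> (forall l, smooth W (u l)) -> smooth W (sys_fun P u j).
Proof.
move=> oW su; apply: smooth_sum => // q; apply: smooth_scale => //.
exact: smooth_dword.
Qed.

Lemma dword_sys_fun P u W j s x : open W -> (forall l, smooth W (u l)) -> W x ->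
  D s (sys_fun P u j) x = \sum_(q <- P j) q.1.1 * D (s ++ q.2) (u q.1.2) x.
Proof.
move=> oW su Wx; rewrite (dword_sum _ s oW) //; last first.
  by move=> q; apply: smooth_scale => //; exact: smooth_dword.
apply: eq_bigr => q _; rewrite dword_cat.
exact: (dword_scale _ _ oW (smooth_dword q.2 (su _)) Wx).
Qed.

Lemma tf_sys_fun P u j : (forall l, tf (u l)) -> tf (sys_fun P u j).
Proof.
by move=> tu; apply: tf_sum => q; apply: tf_scale; exact: tf_dword.
Qed.

Lemma sys_fun_local P u v W j x : open W -> (forall l y, W y -> u l y = v l y) -> W x ->
  sys_fun P u j x = sys_fun P v j x.
Proof.
by move=> oW uv Wx; apply: eq_bigr => q _; rewrite (dword_local q.2 oW (uv q.1.2) Wx).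
Qed.

Lemma sys_fun_lin P c u v W j x : open W -> (forall l, smooth W (u l)) ->
  (forall l, smooth W (v l)) -> W x ->
  sys_fun P (fun l y => c * u l y + v l y) j x = c * sys_fun P u j x + sys_fun P v j x.
Proof.
move=> oW su sv Wx; rewrite mulr_sumr -big_split; apply: eq_bigr => q _.
by rewrite (dword_lin c q.2 oW (su _) (sv _) Wx) mulrDr mulrCA.
Qed.

Lemma sys_fun_comp P Q u W j x : open W -> (forall l, smooth W (u l)) -> W x ->
  sys_fun P (sys_fun Q u) j x =
  \sum_(q <- P j) \sum_(a <- Q q.1.2) q.1.1 * a.1.1 * D (q.2 ++ a.2) (u a.1.2) x.
Proof.
move=> oW su Wx; apply: eq_bigr => q _; rewrite (dword_sys_fun _ _ _ oW su Wx) mulr_sumr.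
by apply: eq_bigr => a _; rewrite mulrA.
Qed.

Lemma sys_dist_comp P Q T j phi : tf phi ->
  sys_dist P (sys_dist Q T) j phi =
  \sum_(q <- P j) \sum_(a <- Q q.1.2) q.1.1 * a.1.1 *
    ((-1) ^+ size (q.2 ++ a.2) * T a.1.2 (D (q.2 ++ a.2) phi)).
Proof.
move=> tp; apply: eq_bigr => q _; rewrite !mulr_sumr; apply: eq_bigr => a _.
have -> : D (q.2 ++ a.2) phi = D a.2 (D q.2 phi).
  apply/funext => x; rewrite -dword_cat.
  by apply: (dword_perm openT (tf_smooth tp) I); rewrite perm_catC.
by rewrite size_cat exprD; ring.
Qed.

Lemma sys_dist_add P T T' T'' j phi : (forall l psi, tf psi -> T'' l psi = T l psi + T' l psi) ->
  tf phi -> sys_dist P T'' j phi = sys_dist P T j phi + sys_dist P T' j phi.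
Proof.
move=> H tp; rewrite -big_split; apply: eq_bigr => q _.
by rewrite H ?mulrDr ?mulrDr //; exact: tf_dword.
Qed.

Lemma tdist_sys P T j : (forall l, tdist (T l)) -> tdist (sys_dist P T j).
Proof.
move=> H; apply: (tdist_sum (P j) (fun q => q.1.1)
  (T := fun q phi => (-1) ^+ size q.2 * T q.1.2 (D q.2 phi))) => q.
rewrite (_ : (fun _ => _) = fun phi => (-1) ^+ size q.2 * T q.1.2 (D q.2 phi) + 0).
  apply: tdist_lin (tdist_dword q.2 (H q.1.2)) tdist0.
by apply/funext => phi; rewrite addr0.
Qed.

Lemma sys_adjoint P T u W j phi : open W -> (forall l, smooth W (u l)) ->
  (forall l psi, tf psi -> tsupp psi `<=` W -> T l psi = rint (fun x => u l x * psi x)) ->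
  tf phi -> tsupp phi `<=` W ->
  rint (fun x => sys_fun P u j x * phi x) = sys_dist P T j phi.
Proof.
move=> oW su HT tp sW.
have tq (q : R * 'I_n * word) : tf (fun x => D q.2 (u q.1.2) x * phi x).
  exact: tf_mul_tsupp oW (smooth_dword _ (su _)) tp sW.
rewrite [LHS](_ : _ = rint (fun x => \sum_(q <- P j) (q.1.1 * (D q.2 (u q.1.2) x * phi x)))).
  rewrite tf_int_sum; last by move=> q; apply: tf_scale; exact: tq.
  apply: eq_bigr => q _; have := tf_int_lin q.1.1 (tq q) tf0.
  rewrite [rint (fun=> 0)](_ : _ = 0) ?addr0; last exact: tf_int0.
  rewrite HT; [ | exact: tf_dword | exact: subset_trans (@tsupp_dword _ _ phi q.2) sW].
  rewrite (by_parts q.2 oW (su _) tp sW) mulrA -expr2 sqrr_sign mul1r => <-.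
  by congr rint; apply/funext => y; rewrite addr0.
by congr rint; apply/funext => x; rewrite mulr_suml; apply: eq_bigr => q _; rewrite mulrA.
Qed.

End Systems.

Section StokesSystems.
Context {R : realType}.
Local Notation V := 'rV[R]_3.
Local Notation word := (seq 'I_3).
Implicit Types (x y : V) (i k l : 'I_3) (j : 'I_(3 + 1)) (s : word) (X : 'I_(3 + 1) -> word -> R).
Local Notation li := (@lshift 3 1).
Local Notation pr := (rshift 3 (ord0 : 'I_1)).

Definition stokes_sys j : seq (R * 'I_(3 + 1) * word) :=
  match fintype.split j with
  | inl i => [seq (1, li i, [:: k; k]) | k <- enum 'I_3] ++ [:: (-1, pr, [:: i])]
  | inr _ => [seq (1, li k, [:: k]) | k <- enum 'I_3]
  end.

(* With [pi := div b - lap b4], this is the operator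
   [(b, b4) |-> (lap b - grad pi, - lap pi)]: composed with the Stokes operator
   on either side, it gives the bilaplacian on every component. *)
Definition costokes_sys j : seq (R * 'I_(3 + 1) * word) :=
  match fintype.split j with
  | inl i => [seq (1, li i, [:: k; k]) | k <- enum 'I_3] ++
      [seq (-1, li k, [:: i; k]) | k <- enum 'I_3] ++
      [seq (1, pr, [:: i; k; k]) | k <- enum 'I_3]
  | inr _ => [seq (-1, li l, [:: k; k; l]) | k <- enum 'I_3, l <- enum 'I_3] ++
      [seq (1, pr, [:: k; k; l; l]) | k <- enum 'I_3, l <- enum 'I_3]
  end.

Lemma split_l i : fintype.split (li i) = inl i. Proof. exact: (unsplitK (inl i)). Qed.
Lemma split_r : fintype.split pr = inr ord0. Proof. exact: (unsplitK (inr ord0)). Qed.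

Variable F : R * 'I_(3 + 1) * word -> R.

Lemma big_stokes_l i : \sum_(q <- stokes_sys (li i)) F q =
  \sum_k F (1, li i, [:: k; k]) + F (-1, pr, [:: i]).
Proof. by rewrite /stokes_sys split_l big_cat big_map big_enum big_seq1. Qed.

Lemma big_stokes_r : \sum_(q <- stokes_sys pr) F q = \sum_k F (1, li k, [:: k]).
Proof. by rewrite /stokes_sys split_r big_map big_enum. Qed.

Lemma big_costokes_l i : \sum_(q <- costokes_sys (li i)) F q =
  \sum_k F (1, li i, [:: k; k]) + (\sum_k F (-1, li k, [:: i; k]) + \sum_k F (1, pr, [:: i; k; k])).
Proof. by rewrite /costokes_sys split_l 2!big_cat; congr (_ + (_ + _)); rewrite big_map big_enum. Qed.

Lemma big_costokes_r : \sum_(q <- costokes_sys pr) F q =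
  \sum_k \sum_l F (-1, li l, [:: k; k; l]) + \sum_k \sum_l F (1, pr, [:: k; k; l; l]).
Proof.
rewrite /costokes_sys split_r big_cat !big_allpairs_dep !big_enum.
by congr (_ + _); apply: eq_bigr => k _; rewrite big_enum.
Qed.

End StokesSystems.

Section StokesIdentities.
Context {R : realType}.
Local Notation V := 'rV[R]_3.
Local Notation word := (seq 'I_3).
Implicit Types (x y : V) (i k l : 'I_3) (j : 'I_(3 + 1)) (s : word) (phi : V -> R).
Local Notation li := (@lshift 3 1).
Local Notation pr := (rshift 3 (ord0 : 'I_1)).
Local Notation S := (@stokes_sys R).
Local Notation Q := (@costokes_sys R).

Lemma size_costokes j q : q \in Q j -> (size q.2 <= 4)%N.
Proof.
rewrite /costokes_sys; case: (fintype.split j) => [i|_]; rewrite !mem_cat.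
  by case/or3P => /mapP[k _ ->].
by case/orP => /allpairsP[[k l] [_ _ ->]].
Qed.

Variable X : 'I_(3 + 1) -> word -> R.
Hypothesis Xp : forall j s t, perm_eq s t -> X j s = X j t.

(** [X] stands for any array of derivatives symmetric in the letters, so the identity is purely
    algebraic. On (lap u - grad p, div u) the auxiliary [pi] equals div(lap u - grad p) - lap div u
    = - lap p; hence grad pi cancels the pressure in lap(lap u - grad p), and - lap pi is the
    bilaplacian of p. *)
Lemma costokes_stokes j :
  \sum_(q <- Q j) \sum_(a <- S q.1.2) q.1.1 * a.1.1 * X a.1.2 (q.2 ++ a.2) =
  \sum_k \sum_l X j [:: k; k; l; l].
Proof.
case: (split_ordP j) => [i|o] -> {j}; last rewrite ord1.
  rewrite big_costokes_l.
  have -> : \sum_k \sum_(a <- S (li i)) 1 * a.1.1 * X a.1.2 ([:: k; k] ++ a.2) =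
      \sum_k \sum_l X (li i) [:: k; k; l; l] - \sum_k X pr [:: i; k; k].
    rewrite -sumrB; apply: eq_bigr => k _; rewrite big_stokes_l /= [1 * -1]mul1r mulN1r.
    congr (_ - _); last by apply: Xp; rewrite (perm_catC [:: k; k] [:: i]).
    by apply: eq_bigr => l _; rewrite !mul1r.
  have -> : \sum_k \sum_(a <- S (li k)) -1 * a.1.1 * X a.1.2 ([:: i; k] ++ a.2) =
      - \sum_l \sum_k X (li l) [:: i; k; k; l] + \sum_k X pr [:: i; k; k].
    rewrite -sumrN -big_split; apply: eq_bigr => k _; rewrite big_stokes_l /= mulrNN !mul1r.
    congr (_ + _); rewrite -sumrN; apply: eq_bigr => l _; rewrite mulr1 mulN1r.
    by congr (- _); apply: Xp; rewrite perm_cons (perm_catC [:: k] [:: l; l]).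
  have -> : \sum_k \sum_(a <- S pr) 1 * a.1.1 * X a.1.2 ([:: i; k; k] ++ a.2) =
      \sum_l \sum_k X (li l) [:: i; k; k; l].
    rewrite [RHS]exchange_big; apply: eq_bigr => k _; rewrite big_stokes_r.
    by apply: eq_bigr => l _; rewrite !mul1r.
  ring.
rewrite big_costokes_r.
have -> : \sum_k \sum_l \sum_(a <- S (li l)) -1 * a.1.1 * X a.1.2 ([:: k; k; l] ++ a.2) =
    - (\sum_k \sum_l \sum_m X (li l) [:: k; k; m; m; l]) + \sum_k \sum_l X pr [:: k; k; l; l].
  rewrite -sumrN -big_split; apply: eq_bigr => k _; rewrite -sumrN -big_split.
  apply: eq_bigr => l _; rewrite big_stokes_l /= mulrNN !mul1r.
  congr (_ + _); rewrite -sumrN; apply: eq_bigr => m _; rewrite mulr1 mulN1r.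
  by congr (- _); apply: Xp; rewrite !perm_cons (perm_catC [:: l] [:: m; m]).
have -> : \sum_k \sum_l \sum_(a <- S pr) 1 * a.1.1 * X a.1.2 ([:: k; k; l; l] ++ a.2) =
    \sum_k \sum_l \sum_m X (li l) [:: k; k; m; m; l].
  apply: eq_bigr => k _; rewrite [RHS]exchange_big; apply: eq_bigr => l _; rewrite big_stokes_r.
  by apply: eq_bigr => m _; rewrite !mul1r.
ring.
Qed.

(** In the velocity rows lap(- grad pi) cancels against - grad(- lap pi). In the divergence row
    div(lap b - grad pi) = lap div b - lap pi, which is the bilaplacian of b4. *)
Lemma stokes_costokes j :
  \sum_(q <- S j) \sum_(a <- Q q.1.2) q.1.1 * a.1.1 * X a.1.2 (q.2 ++ a.2) =
  \sum_k \sum_l X j [:: k; k; l; l].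
Proof.
case: (split_ordP j) => [i|o] -> {j}; last rewrite ord1.
  rewrite big_stokes_l.
  have -> : \sum_k \sum_(a <- Q (li i)) 1 * a.1.1 * X a.1.2 ([:: k; k] ++ a.2) =
      \sum_k \sum_l X (li i) [:: k; k; l; l] -
      \sum_k \sum_l X (li l) [:: k; k; l; i] + \sum_k \sum_l X pr [:: k; k; l; l; i].
    rewrite -sumrB -big_split; apply: eq_bigr => k _; rewrite big_costokes_l /= -addrA.
    congr (_ + _); first by apply: eq_bigr => l _; rewrite !mul1r.
    congr (_ + _).
      rewrite -sumrN; apply: eq_bigr => l _; rewrite mul1r mulN1r; congr (- _).
      by apply: Xp; rewrite !perm_cons (perm_catC [:: i] [:: l]).
    apply: eq_bigr => l _; rewrite !mul1r.
    by apply: Xp; rewrite !perm_cons (perm_catC [:: i] [:: l; l]).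
  rewrite big_costokes_r /=.
  have -> : \sum_k \sum_l -1 * -1 * X (li l) [:: i; k; k; l] = \sum_k \sum_l X (li l) [:: k; k; l; i].
    apply: eq_bigr => k _; apply: eq_bigr => l _; rewrite mulrNN !mul1r.
    by apply: Xp; rewrite (perm_catC [:: i] [:: k; k; l]).
  have -> : \sum_k \sum_l -1 * 1 * X pr [:: i; k; k; l; l] = - \sum_k \sum_l X pr [:: k; k; l; l; i].
    rewrite -sumrN; apply: eq_bigr => k _; rewrite -sumrN; apply: eq_bigr => l _; rewrite mulr1 mulN1r.
    by congr (- _); apply: Xp; rewrite (perm_catC [:: i] [:: k; k; l; l]).
  ring.
rewrite big_stokes_r.
have -> : \sum_k \sum_(a <- Q (li k)) 1 * a.1.1 * X a.1.2 ([:: k] ++ a.2) =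
    \sum_k \sum_l X (li k) [:: k; l; l] - \sum_k \sum_l X (li l) [:: k; k; l] +
    \sum_k \sum_l X pr [:: k; k; l; l].
  rewrite -sumrB -big_split; apply: eq_bigr => k _; rewrite big_costokes_l /= -addrA.
  congr (_ + _); first by apply: eq_bigr => l _; rewrite !mul1r.
  congr (_ + _); last by apply: eq_bigr => l _; rewrite !mul1r.
  by rewrite -sumrN; apply: eq_bigr => l _; rewrite mul1r mulN1r.
have -> : \sum_k \sum_l X (li l) [:: k; k; l] = \sum_k \sum_l X (li k) [:: k; l; l].
  rewrite exchange_big; apply: eq_bigr => k _; apply: eq_bigr => l _.
  by apply: Xp; rewrite (perm_catC [:: l; l] [:: k]).
ring.
Qed.

End StokesIdentities.

(** * Local solutions of the homogeneous Stokes system as limits of potentials *)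

Section Representation.
Context {R : realType}.
Local Notation V := 'rV[R]_3.
Local Notation word := (seq 'I_3).
Implicit Types (x y : V) (i k : 'I_3) (j : 'I_(3 + 1)) (s : word) (K E W : set V) (phi : V -> R)
  (u : 'I_(3 + 1) -> V -> R) (T : 'I_(3 + 1) -> (V -> R) -> R).
Local Notation S := (@stokes_sys R).
Local Notation Q := (@costokes_sys R).
Local Notation r := (ker 0).

Lemma dword_bilap W f s x : open W -> smooth W f -> W x ->
  D s (lap (lap f)) x = \sum_k \sum_l D (s ++ [:: k; k; l; l]) f x :> R.
Proof.
move=> oW sf Wx; rewrite (dword_lap s oW (smooth_lap oW sf) Wx); apply: eq_bigr => k _.
rewrite (dword_lap _ oW sf Wx); apply: eq_bigr => l _.
by rewrite -catA.
Qed.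

Lemma costokes_stokes_fun W u j x : open W -> (forall l, smooth W (u l)) -> W x ->
  sys_fun Q (sys_fun S u) j x = lap (lap (u j)) x.
Proof.
move=> oW su Wx; rewrite (sys_fun_comp _ _ _ oW su Wx).
rewrite (@costokes_stokes R (fun l s => D s (u l) x)) //.
  by rewrite -(dword_bilap [::] oW (su j) Wx).
by move=> l s t; apply: (dword_perm oW (su l) Wx).
Qed.

Lemma stokes_costokes_dist T j phi : (forall l, tlin (T l)) -> tf phi ->
  sys_dist S (sys_dist Q T) j phi = T j (lap (lap phi)).
Proof.
move=> Tl tp; have sp := tf_smooth tp; rewrite sys_dist_comp //.
rewrite (@stokes_costokes R (fun l s => (-1) ^+ size s * T l (D s phi))); last first.
  move=> l s t st; rewrite (perm_size st); congr (_ * T _ _); apply/funext => x.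
  exact: (dword_perm openT sp I).
have -> : lap (lap phi) = fun x => \sum_k \sum_l D [:: k; k; l; l] phi x.
  by apply/funext => x; exact: (dword_bilap [::] openT sp I).
rewrite tlin_sum //; last by move=> k; apply: tf_sum => l; exact: (tf_dword [:: k; k; l; l] tp).
apply: eq_bigr => k _; rewrite tlin_sum //; last by move=> l; exact: (tf_dword [:: k; k; l; l] tp).
by apply: eq_bigr => l _; rewrite -signr_odd expr0 mul1r.
Qed.

Lemma open_forall (I : finType) (W : I -> set V) : (forall n, open (W n)) ->
  open [set y | forall n, W n y].
Proof.
move=> oW; rewrite openE => y Wy.
have H : \forall z \near y, forall n, W n z.
  apply: (@filter_forall _ I W (nbhs y) (nbhs_filter y)) => n; exact: near_open.
exact: H.
Qed.

Lemma stokes_solution_approx K E Om u m (e : R) :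
  compact K -> control_set K E -> open Om -> K `<=` Om -> (forall j, smooth Om (u j)) ->
  (forall j x, Om x -> sys_fun S u j x = 0) -> 0 < e ->
  exists2 b : 'I_(3 + 1) -> V -> R, (forall j, pot K E (b j)) &
    forall j s x, (size s <= m)%N -> K x -> `|D s (sys_fun Q b j) x - D s (u j) x| <= e.
Proof.
move=> cK cE oO KO su Su e0.
have [chi [N [S0 [schi oN KN chi1 [cS0 S0O chi0]]]]] := cutoff cK oO KO.
have cS0' : closed S0 by apply: compact_closed => //; exact: norm_hausdorff.
have sup : tsupp chi `<=` Om by apply: subset_trans (tsupp_sub cS0' chi0) S0O.
have [L L0 HL] := norm_row_bounded cS0.
have tchi : tf chi.
  split=> //; exists (L + 1); first by rewrite ltr_wpDl // ltW.
  move=> x Lx; apply: chi0 => /HL; rewrite leNgt => /negP; apply.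
  by apply: lt_le_trans Lx; rewrite ltrDl.
pose phi j x := u j x * chi x.
have tphi j : tf (phi j) by exact: tf_mul_tsupp oO (su j) tchi sup.
have sphi j := tf_smooth (tphi j).
pose h j := sys_fun S phi j.
have th j : tf (h j) by exact: tf_sys_fun.
have phiN l y : N y -> phi l y = u l y by move=> Ny; rewrite /phi chi1 // mulr1.
have NO : N `<=` Om.
  move=> y Ny; apply: S0O; apply: contrapT => nS.
  by have /eqP := chi0 y nS; rewrite chi1 // oner_eq0.
(* On [N] the cutoff is 1 and [phi] coincides with the solution [u], so the source [h] vanishes
   there as well as off [S0]. *)
pose S1 := S0 `&` ~` N.
have cS1 : compact S1 by apply: compact_closedI => //; exact: open_closedC.
have hS y : ~ S1 y -> forall j, h j y = 0.
  move=> nS j; have [Ny|nN] := pselect (N y).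
    by rewrite /h (sys_fun_local _ _ oN phiN Ny) Su //; exact: NO.
  have nS0 : (~` S0) y by move=> Sy; apply: nS.
  have oS := closed_openC cS0'.
  have z l z : (~` S0) z -> phi l z = 0 by move=> nz; rewrite /phi chi0 // mulr0.
  rewrite /h (@sys_fun_local _ _ _ _ (fun _ _ => 0) _ _ _ oS z nS0).
  by apply: big1 => q _; case: q.2 => [|i s] /=; rewrite ?mulr0 // -[pd _ _]/(D (i :: s) _) dword_cst ?mulr0.
have KS x : K x -> ~ S1 x by move=> /KN Nx [].
pose J j s x := bilap_cst^-1 * rint (fun y => r (y - x) * D s (h j) y).
have aJ j : approximable K E (J j).
  have H := approximable_potential cK cE (th j) cS1 (fun y ny => hS y ny j) KS.
  by apply: approximable_eq (approximable_lin bilap_cst^-1 H (approximable0 K E)) => s x _; rewrite addr0.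
(* [fundamental] recovers [D s (phi j)] at [x] from its bilaplacian, which the factorization writes
   as [Q] applied to [h]. All derivatives stay on the density, so [J] with longer words expresses
   the action of [Q]. *)
have repr j s x : K x -> \sum_(q <- Q j) q.1.1 * J q.1.2 (s ++ q.2) x = D s (u j) x.
  move=> Kx; rewrite -(dword_local s oN (phiN j) (KN x Kx)).
  have cr := @continuous_ker_sub R x; have [Rl _] := tdist_rint cr.
  apply: (mulfI (@bilap_cst_neq0 R)); rewrite -fundamental; last exact: tf_dword.
  have -> : lap (lap (D s (phi j))) = fun y => \sum_(q <- Q j) q.1.1 * D (s ++ q.2) (h q.1.2) y.
    apply/funext => y; rewrite -(dword_sys_fun _ _ _ openT (fun l => tf_smooth (th l)) I).
    rewrite (dword_local s openT (g := lap (lap (phi j)))) //; last first.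
      by move=> z _; exact: (costokes_stokes_fun _ openT sphi I).
    rewrite -(lap_dword_comm s _ (smooth_lap openT (sphi j))).
    by apply: (lap_local openT) => // z _; rewrite lap_dword_comm.
  have tq q := tf_scale q.1.1 (tf_dword (s ++ q.2) (th q.1.2)).
  rewrite [RHS](tlin_sum (Q j) Rl tq) mulr_sumr; apply: eq_bigr => q _.
  rewrite [RHS](tlin_scale q.1.1 Rl (tf_dword (s ++ q.2) (th q.1.2))).
  by rewrite /J mulrCA; congr (_ * _); rewrite mulrA divff ?mul1r //; exact: bilap_cst_neq0.
pose C := \sum_j \sum_(q <- Q j) `|q.1.1|.
have C0 : 0 <= C by apply: sumr_ge0 => j _; apply: sumr_ge0.
have C1 : 0 < C + 1 by rewrite ltr_wpDl.
have e1 : 0 < e / (C + 1) by rewrite divr_gt0.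
(* Four more derivatives are approximated because the words in [Q] have length at most four; the
   tolerance is divided by a bound for the sum of the coefficients of a row of [Q] in absolute
   value. *)
have ab j := cid2 (aJ j (m + 4)%N _ e1).
pose b j := s2val (ab j); have pb j : pot K E (b j) := s2valP (ab j).
have Hb j : forall s x, (size s <= m + 4)%N -> K x -> `|D s (b j) x - J j s x| <= e / (C + 1) := s2valP' (ab j).
exists b => // j s x sm Kx.
have [W HW] := choice (fun j => pot_smooth (pb j)).
pose W' := [set y | forall j, W j y].
have oW : open W' by apply: open_forall => l; have [] := HW l.
have Wx : W' x by move=> l; have [_ KW _] := HW l; exact: KW.
have sb l : smooth W' (b l) by have [_ _ sl] := HW l; apply: smooth_sub sl => y /(_ l).
rewrite (dword_sys_fun _ _ _ oW sb Wx) -repr // -sumrB.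
apply: le_trans (ler_norm_sum _ _ _) _.
apply: le_trans (_ : C * (e / (C + 1)) <= _); last first.
  by rewrite mulrCA -[leRHS]mulr1 ler_pM2l // ler_pdivrMr // mul1r lerDl.
apply: le_trans (_ : (\sum_(q <- Q j) `|q.1.1|) * (e / (C + 1)) <= _); last first.
  rewrite ler_pM2r // /C (bigD1 j) //= lerDl.
  by apply: sumr_ge0 => l _; apply: sumr_ge0.
rewrite mulr_suml !big_seq; apply: ler_sum => q qQ.
rewrite -mulrBr normrM; apply: ler_wpM2l => //; apply: Hb => //.
by rewrite size_cat leq_add // (size_costokes qQ).
Qed.

End Representation.

(** * The Runge property *)

Section StokesRunge.
Context {R : realType}.
Local Notation V := 'rV[R]_3.
Local Notation word := (seq 'I_3).
Implicit Types (x y : V) (i k : 'I_3) (j : 'I_(3 + 1)) (s : word) (K E W : set V) (phi : V -> R)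
  (U : V -> 'cV[R]_(3 + 1)) (T : 'I_(3 + 1) -> (V -> R) -> R).
Local Notation S := (@stokes_sys R).
Local Notation Q := (@costokes_sys R).
Local Notation li := (@lshift 3 1).
Local Notation pr := (rshift 3 (ord0 : 'I_1)).

Lemma op_fun_stokes U j x : op_fun (stokes R) U x j 0 = sys_fun S (vcoord U) j x.
Proof.
have UE : U = fun y => col_mx (usubmx (U y)) (vcoord U pr y)%:M.
  apply/funext => y; apply/colP => l; case: (split_ordP l) => [i|o] ->; last rewrite (ord1 o).
    by rewrite col_mxEu mxE.
  by rewrite col_mxEd mxE eqxx.
have uE i : vcoord (fun y => usubmx (U y)) i = vcoord U (li i).
  by apply/funext => y; rewrite /vcoord mxE.
rewrite {1}UE stokesE /sys_fun; case: (split_ordP j) => [i|o] -> {j}; last rewrite (ord1 o).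
  rewrite col_mxEu mxE big_stokes_l /= mulN1r /laplacian -pdE uE; congr (_ - _).
  by apply: eq_bigr => k _; rewrite mul1r.
rewrite col_mxEd mxE eqxx mulr1n big_stokes_r /divergence -pdE; apply: eq_bigr => k _.
by rewrite mul1r uE.
Qed.

(** The coefficients are constants, so [mul_dist], which places them on the test function, comes out
    by linearity; the zero entries of the block matrices then leave the triples of [stokes_sys]. *)
Lemma op_dist_stokes T j phi : (forall l, tlin (T l)) -> tf phi ->
  op_dist (stokes R) T j phi = sys_dist S T j phi.
Proof.
move=> Tl tp; pose w (t : bool * 'I_3) := if t.1 then [:: t.2; t.2] else [:: t.2].
have term (t : bool * 'I_3) l :
    mul_dist (fun=> @stokes_coef R t j l) (mder_dist (stokes_mi t) (T l)) phi =
    stokes_coef R t j l * ((-1) ^+ size (w t) * T l (D (w t) phi)).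
  have -> : mul_dist (fun=> stokes_coef R t j l) (mder_dist (stokes_mi t) (T l)) phi =
      (-1) ^+ size (w t) * T l (D (w t) (fun x => stokes_coef R t j l * phi x)).
    rewrite /mul_dist /mder_dist; congr (_ ^+ _ * T l _).
      rewrite /stokes_mi /w; case: t => [[] i] /=.
        by rewrite (bigD1 i) //= eqxx big1 // => k /negbTE ->.
      by rewrite (bigD1 i) //= eqxx big1 // => k /negbTE ->.
    by rewrite mder_stokes_mi -pdE /w; case: t => [[] i].
  rewrite [RHS]mulrCA; congr (_ * _); rewrite -(tlin_scale _ (Tl l)); last exact: tf_dword.
  congr (T l _); apply/funext => x.
  by rewrite (dword_scale _ (w t) openT (tf_smooth tp)).
rewrite /op_dist (eq_bigr _ (fun t _ => eq_bigr _ (fun l _ => term t l))).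
rewrite -(pair_bigA _ (fun b k => \sum_l stokes_coef R (b, k) j l *
  ((-1) ^+ size (w (b, k)) * T l (D (w (b, k)) phi)))) /=.
rewrite big_bool /sys_dist /w /stokes_coef /=.
case: (split_ordP j) => [i|o] -> {j term}; last rewrite (ord1 o).
  rewrite big_stokes_l /=; congr (_ + _).
    apply: eq_bigr => k _; rewrite big_split_ord /= big_ord1 block_mxEur mxE mul0r addr0.
    rewrite (bigD1 i) //= block_mxEul mxE eqxx big1 ?addr0 // => l li.
    by rewrite block_mxEul mxE eq_sym (negbTE li) mul0r.
  rewrite (bigD1 i) //= [X in _ + X]big1 ?addr0 => [|k ki].
    rewrite big_split_ord /= big1 ?add0r => [|l _]; last by rewrite block_mxEul mxE mul0r.
    by rewrite big_ord1 block_mxEur !mxE !eqxx.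
  rewrite big_split_ord /= big1 ?add0r => [|l _]; last by rewrite block_mxEul mxE mul0r.
  by rewrite big_ord1 block_mxEur !mxE eq_sym (negbTE ki) oppr0 mul0r.
rewrite big_stokes_r big1 ?add0r => [|k _]; last first.
  by rewrite big1 // => l _; rewrite -[l]splitK; case: (fintype.split l) => m;
    rewrite /= ?block_mxEdl ?block_mxEdr mxE mul0r.
apply: eq_bigr => k _; rewrite big_split_ord /= big_ord1 block_mxEdr mxE mul0r addr0.
rewrite (bigD1 k) //= block_mxEdl mxE !eqxx big1 ?addr0 // => l lk.
by rewrite block_mxEdl mxE (negbTE lk) andbF mul0r.
Qed.

(** [point_control] prescribes [g] on every argument through [mder_dist], so [g] is defined by that
    formula and its word form is claimed on test functions only. A triple of component [o] becomes a
    coefficient vector supported on [o], and the sign inside [mder_dist] is compensated in the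
    coefficient. *)
Lemma point_control_seq m E (l : 'I_m -> seq (R * word * V)) :
  (forall (o : 'I_m) p, p \in l o -> E p.2) -> exists2 g : 'I_m -> functional R 3, point_control E g &
  forall (o : 'I_m) phi, tf phi -> g o phi = \sum_(p <- l o) p.1.1 * D p.1.2 phi p.2.
Proof.
move=> lE; pose L := [seq (o, p) | o <- enum 'I_m, p <- l o].
pose t n := tnth (in_tuple L) n.
pose c (n : 'I_(size L)) : 'cV[R]_m :=
  \col_o (((t n).1 == o)%:R * ((-1) ^+ size (t n).2.1.2 * (t n).2.1.1)).
pose a (n : 'I_(size L)) i := count_mem i (t n).2.1.2.
exists (fun o phi => \sum_n c n o 0 * mder_dist (a n) (dirac_dist (t n).2.2) phi).
  exists (size L), c, a, (fun n => (t n).2.2); split=> // n.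
  have /allpairsPdep : t n \in L := mem_tnth n (in_tuple L).
  by move=> [i [p [_ pl ->]]]; exact: lE pl.
move=> o phi tp.
pose G (q : 'I_m * (R * word * V)) : R := (q.1 == o)%:R * (q.2.1.1 * D q.2.1.2 phi q.2.2).
transitivity (\sum_(q <- L) G q).
  rewrite [RHS]big_tnth; apply: eq_bigr => n _; rewrite -/(t n) /G mxE -mulrA; congr (_ * _).
  rewrite /mder_dist sum_count /dirac_dist -(dword_mder _ openT (tf_smooth tp)) //.
  by rewrite mulrAC mulrA -expr2 sqrr_sign mul1r mulrC.
rewrite big_allpairs_dep big_enum (bigD1 o) //= [X in _ + X]big1 ?addr0 => [|o' oo].
  by apply: eq_bigr => p _; rewrite /G eqxx mul1r.
by apply: big1 => p _; rewrite /G (negbTE oo) mul0r.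
Qed.

Lemma enorm_le n (v : 'cV[R]_n) (e : R) : 0 <= e -> (forall j : 'I_n, `|v j 0| <= e) ->
  enorm v <= Num.sqrt n%:R * e.
Proof.
move=> e0 H; rewrite /enorm -[in leRHS](ger0_norm e0) -sqrtr_sqr -sqrtrM ?ler0n //.
rewrite ler_wsqrtr // -[n in leRHS]card_ord -sum1_card natr_sum mulr_suml.
apply: ler_sum => j _; rewrite mul1r -real_normK ?num_real //.
by rewrite lerXn2r // nnegrE.
Qed.

Lemma Ck_norm_le n (k : nat) K (F : V -> 'cV[R]_n) (e : R) : 0 <= e ->
  (forall (j : 'I_n) s x, (size s <= k)%N -> K x -> `|D s (vcoord F j) x| <= e) ->
  (Ck_norm k K F <= (Num.sqrt n%:R * e)%:E)%E.
Proof.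
move=> e0 H; have e1 : (0 <= (Num.sqrt n%:R * e)%:E)%E by rewrite lee_fin mulr_ge0 // sqrtr_ge0.
rewrite /Ck_norm; apply: (big_ind (fun y : \bar R => (y <= (Num.sqrt n%:R * e)%:E)%E)) => //.
  by move=> y z ye ze; rewrite ge_max ye.
move=> a ak; apply: ge_ereal_sup => _ [x Kx <-].
rewrite lee_fin; apply: enorm_le => // j; rewrite mxE mder_word; apply: H => //.
by rewrite size_word_of.
Qed.

End StokesRunge.

Theorem corollary5p5 (R : realType) : runge_point_controls (stokes R).
Proof.
move=> K f k eps E Om U cK [v sv ->] eps0 cE oO KO sU HU.
have sv' j : smooth setT (vcoord v j) by rewrite smoothE; exact: sv.
have sU' j : smooth Om (vcoord U j) by rewrite smoothE; exact: sU.
have svO j : smooth Om (vcoord v j) by apply: smooth_sub (sv' j).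
pose u j x := -1 * vcoord v j x + vcoord U j x.
have su j : smooth Om (u j) by exact: smooth_lin.
have Su j x : Om x -> sys_fun (@stokes_sys R) u j x = 0.
  move=> Ox; rewrite (sys_fun_lin _ _ _ oO svO sU' Ox) -!op_fun_stokes HU // mulN1r.
  by rewrite addNr.
(* Four components, each bounded by eps/2, have Euclidean norm at most sqrt(4) * eps/2 = eps. *)
have e0 : 0 < eps / 2 by rewrite divr_gt0.
have [b pb Hb] := stokes_solution_approx k cK cE oO KO su Su e0.
have [tau Htau] := choice pb; have [Wb HWb] := choice Htau; have [l Hl] := choice HWb.
pose W := [set y | forall j, Wb j y].
have oW : open W by apply: open_forall => j; have [[]] := Hl j.
have KW : K `<=` W by move=> x Kx j; have [[_ H _] _ _ _] := Hl j; exact: H.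
have sb j : smooth W (b j).
  by have [[_ _ H] _ _ _] := Hl j; apply: smooth_sub H => y /(_ j).
have td j : tdist (tau j) by have [_ H _ _] := Hl j.
have tW j phi : tf phi -> tsupp phi `<=` W -> tau j phi = rint (fun x => b j x * phi x).
  by have [_ _ H _] := Hl j => tp sW; apply: H => // x /sW /(_ j).
have [g gc gE] := @point_control_seq R _ E l (fun j => proj1 (let: And4 _ _ _ H := Hl j in H)).
have tE j phi : tf phi -> tau j (lap (lap phi)) = g j phi.
  by move=> tp; rewrite gE //; have [_ _ _ [_ H]] := Hl j; exact: H.
pose Tv j phi := rint (fun x => vcoord v j x * phi x).
have tTv j : tdist (Tv j) by apply: tdist_rint => x; exact: smooth_continuous (sv' j) _.
(* The auxiliary operator acts on [tau] in the sense of distributions, so that the Stokes operator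
   turns this part into the bilaplacian of [tau], which is [g] on the whole space. Near [K] the
   function [w] is the same expression in the smooth representatives. *)
pose T j phi := Tv j phi + sys_dist (@costokes_sys R) tau j phi.
have tT j : tdist (T j) by apply: tdist_add => //; exact: tdist_sys.
have sQ j : smooth W (sys_fun (@costokes_sys R) b j) by exact: smooth_sys_fun.
have svW j : smooth W (vcoord v j) by apply: smooth_sub (sv' j).
pose w x : 'cV[R]_(3 + 1) := \col_j (1 * vcoord v j x + sys_fun (@costokes_sys R) b j x).
have wE j : vcoord w j = fun x => 1 * vcoord v j x + sys_fun (@costokes_sys R) b j x.
  by apply/funext => x; rewrite /vcoord mxE.
exists T, g, W, w; split=> //.
- by move=> j; exact: tdist_is_distribution.
- split=> // [j|j phi /test_fun_tf tp sW].
    by rewrite wE -smoothE; exact: smooth_lin.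
  rewrite /fun_dist -rintE wE /T -(sys_adjoint _ _ oW sb tW tp sW) -[Tv j phi]mul1r.
  rewrite -tf_int_lin; first by congr rint; apply/funext => x; ring.
    exact: tf_mul_tsupp oW (svW j) tp sW.
  exact: tf_mul_tsupp oW (sQ j) tp sW.
- move=> j phi /test_fun_tf tp.
  rewrite op_dist_stokes //; last by move=> i; have [] := tT i.
  have -> : sys_dist (@stokes_sys R) T j phi = sys_dist (@stokes_sys R) Tv j phi +
      sys_dist (@stokes_sys R) (sys_dist (@costokes_sys R) tau) j phi by exact: sys_dist_add.
  rewrite stokes_costokes_dist //; last by move=> i; have [] := td i.
  rewrite tE //; congr (_ + _).
  rewrite -(sys_adjoint _ _ openT sv' (fun _ _ _ _ => erefl) tp (fun _ _ => I)).
  rewrite /fun_dist -rintE; congr rint; apply/funext => x.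
  by rewrite /vcoord op_fun_stokes.
have -> : eps = Num.sqrt (3 + 1)%N%:R * (eps / 2).
  have -> : (3 + 1)%N%:R = 2 ^+ 2 :> R by rewrite -natrX.
  by rewrite sqrtr_sqr ger0_norm // mulrC divfK.
apply: Ck_norm_le; first exact: ltW.
move=> j s x sk Kx; apply: le_trans (Hb j s x sk Kx).
have Ox : (W `&` Om) x by split; [exact: KW | exact: KO].
have oI := openI oW oO.
have s1 : smooth (W `&` Om) (u j) by apply: smooth_sub (su j) => y [].
have s2 : smooth (W `&` Om) (sys_fun (@costokes_sys R) b j) by apply: smooth_sub (sQ j) => y [].
rewrite [X in _ <= `|X|]addrC -[X in _ <= `|X + _|]mulN1r -(dword_lin (-1) s oI s1 s2 Ox).
rewrite le_eqVlt; apply/orP; left; apply/eqP; congr (`|D s _ x|); apply/funext => y.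
by rewrite /vcoord !mxE /u /vcoord; ring.
Qed.
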